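(* Let $G$ be a fixed undirected, connected, non-bipartite, $d$-regular graph (its number of vertices $|G|$ is a constant independent of $n$). There is a succinct cell-probe data structure which, given any walk $(v_0,v_1,\ldots,v_n)$ in $G$, stores it using at most $\lg_2|G| + n\lg_2 d + 3$ bits of memory and supports retrieving any $v_q$, $q\in\{0,\ldots,n\}$, in constant time, assuming word size $w\geq \Omega(\lg n)$. Moreover, the data structure can be implemented on a word RAM using an extra $r$-bit lookup table that depends only on $G$ (not on the walk), supporting retrieval of any $v_q$ in $O\!\left(\frac{\lg\lg n}{\lg\lg r}\right)$ time, for any $r\geq \Omega(\lg^2 n)$.
   Context: A walk $(v_0,\ldots,v_n)$ in $G$ is a sequence of vertices with $\{v_i,v_{i+1}\}$ an edge for each $i$. In the cell-probe model, memory consists of $w$-bit words (cells) and only the number of cells accessed by the query algorithm is charged; in the word-RAM model, the query algorithm uses standard word operations on $w$-bit words with $w=\Theta(\lg n)$. The storage is for worst-case inputs (any walk), and the time bounds are worst case over queries. The lookup table is precomputed information about $G$ only (shared across inputs) and is not counted in the stated space. All logarithms are base 2. *)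

(* Defs.v *)
From HB Require Import structures.
From mathcomp Require Import all_boot all_order all_algebra.
From mathcomp Require Import reals exp.
Set Implicit Arguments.
Unset Strict Implicit.
Unset Printing Implicit Defensive.
Import Order.TTheory GRing.Theory Num.Theory.

(* Binary logarithm. [ln] is total and [ln x = 0] for [x <= 0], so [lg 0 = 0]. *)
Definition lg (R : realType) (x : R) : R := (ln x / ln 2)%R.

(* A simple graph is a finite vertex type with a symmetric irreflexive
   adjacency relation. *)
Definition bipartite (T : finType) (e : rel T) : Prop :=
  exists side : T -> bool, forall x y, e x y -> side x != side y.

Definition regular_graph (T : finType) (e : rel T) (d : nat) : Prop :=
  forall x, #|[set y | e x y]| = d.

(* The [i]-th [w]-bit cell of a memory of bits, as a number below [2 ^ w],
   least significant bit first; bits beyond the end of the memory read as 0,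
   so the last cell may be only partially used. *)
Definition cell (w : nat) (mem : seq bool) (i : nat) : nat :=
  \sum_(j < w) nth false mem (i * w + j) * 2 ^ j.

(* Adaptive cell-probe algorithms. The next address, or the answer, is an
   arbitrary function of the contents of the cells probed so far. *)
Inductive cp_algo (A : Type) : Type :=
  | Answer of A
  | Probe of nat & (nat -> cp_algo A).

(* The answer, and the number of probes made. *)
Fixpoint cp_run (A : Type) (cells : nat -> nat) (a : cp_algo A) : A * nat :=
  match a with
  | Answer x => (x, 0)
  | Probe i k => let out := cp_run cells (k (cells i)) in (out.1, out.2.+1)
  end.

(* The walks v_0, ..., v_n are the tuples [v] of size [n.+1] with [sorted e v],
   which says that consecutive entries are related by [e] and involves no
   ordering of the vertices. *)
Definition cell_probe_retrieval (T : finType) (e : rel T) (n w t m : nat)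
    (enc : n.+1.-tuple T -> m.-tuple bool) : Prop :=
  exists query : 'I_n.+1 -> cp_algo T,
    forall v : n.+1.-tuple T, sorted e v -> forall q : 'I_n.+1,
      let out := cp_run (cell w (enc v)) (query q) in
      out.1 = tnth v q /\ out.2 <= t.

(* Word RAM with [w]-bit words, i.e. numbers below [2 ^ w]. Registers are
   indexed by numbers fixed in the program, so a program uses finitely many.
   The stored data and the lookup table are read-only; the scratch memory is
   working space of a query. *)
Inductive binop : Type :=
  | Add | Sub | Mul | Div | Mod | And | Or | Xor | Shl | Shr.

Definition eval_binop (w : nat) (op : binop) (a b : nat) : nat :=
  match op with
  | Add => a + b
  | Sub => a + 2 ^ w - b
  | Mul => a * b
  | Div => a %/ b
  | Mod => a %% b
  | And => Nat.land a b
  | Or => Nat.lor a b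
  | Xor => Nat.lxor a b
  | Shl => a * 2 ^ b
  | Shr => a %/ 2 ^ b
  end %% 2 ^ w.

Inductive instr : Type :=
  | Const (x k : nat)               (* x := k *)
  | Op (op : binop) (x y z : nat)   (* x := y op z *)
  | ReadScratch (x y : nat)         (* x := scratch[y] *)
  | WriteScratch (x y : nat)        (* scratch[x] := y *)
  | ReadData (x y : nat)            (* x := data[y] *)
  | ReadTable (x y : nat)           (* x := table[y] *)
  | Jump (l : nat)                  (* goto l *)
  | JumpEq (x y l : nat)            (* if x = y goto l *)
  | JumpLt (x y l : nat).           (* if x < y goto l *)

Record ram_state : Type := RamState {
  pc : nat;
  regs : nat -> nat;
  scratch : nat -> nat
}.

Definition upd (f : nat -> nat) (i a : nat) : nat -> nat :=
  fun j => if j == i then a else f j.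

Definition exec (w : nat) (data table : nat -> nat) (c : instr)
    (s : ram_state) : ram_state :=
  let: RamState p R M := s in
  match c with
  | Const x k => RamState p.+1 (upd R x (k %% 2 ^ w)) M
  | Op op x y z => RamState p.+1 (upd R x (eval_binop w op (R y) (R z))) M
  | ReadScratch x y => RamState p.+1 (upd R x (M (R y))) M
  | WriteScratch x y => RamState p.+1 R (upd M (R x) (R y))
  | ReadData x y => RamState p.+1 (upd R x (data (R y))) M
  | ReadTable x y => RamState p.+1 (upd R x (table (R y))) M
  | Jump l => RamState l R M
  | JumpEq x y l => RamState (if R x == R y then l else p.+1) R M
  | JumpLt x y l => RamState (if R x < R y then l else p.+1) R M
  end.

(* The machine has halted once [pc] points outside the program. *)
Definition ram_halted (P : seq instr) (s : ram_state) : bool :=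
  size P <= pc s.

Definition ram_step (w : nat) (data table : nat -> nat) (P : seq instr)
    (s : ram_state) : ram_state :=
  if ram_halted P s then s
  else exec w data table (nth (Jump 0) P (pc s)) s.

(* Register 0 holds the query; all other registers and the scratch memory
   are 0. In particular parameters such as the length of the walk reach the
   program only through the lookup table. *)
Definition ram_init (w q : nat) : ram_state :=
  RamState 0 (upd (fun=> 0) 0 (q %% 2 ^ w)) (fun=> 0).

(* On query [q], the program halts after at most [k] instructions with
   [out] in register 0. *)
Definition ram_computes (w : nat) (data table : seq bool) (P : seq instr)
    (q k out : nat) : Prop :=
  let s := iter k (ram_step w (cell w data) (cell w table) P) (ram_init w q) in
  ram_halted P s /\ regs s 0 = out.

(* Main.v *)
(** The walk is cut into blocks of [ell = Theta(log n)] steps. Since the graph is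
    connected and not bipartite, the walk mixes: up to a factor [1 + O(1/n)], the number
    of walks of length [ell] between two given vertices is [d ^ ell / |T|]. Hence a block
    can be coded by its first vertex together with its index among the walks with the same
    ends at a cost of [ell * log d + O(1/n)] bits, its last vertex being the first vertex
    of the next block.

    The block values go to the nodes of a binary tree (Dodis, Patrascu and Thorup). Each
    value is split into a content and a small spill; a node stores its content and the
    spills of its two children in a word of an integral number of bits, sized so that
    almost nothing is wasted. Reading a value takes the word of a node and that of its
    parent. The sizes depend only on the level [k] of a node, and [2 ^ k] is the lowest set
    bit of its number.

    Inside a block, the index is decoded by splitting the block into [b] pieces: the alias
    method finds the tuple of vertices between the pieces in constant time, and division
    then gives the index of the one piece that contains the queried position. With
    [b = Theta(min(log r, log n))] there are [O(log log n / log log r)] rounds or [O(1)], and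
    the tables fit in [r] bits. *)

Require Import Defs.
From HB Require Import structures.
From mathcomp Require Import all_boot all_order all_algebra.
From mathcomp Require Import boolp reals exp.
From mathcomp Require Import zify lra.
Set Implicit Arguments.
Unset Strict Implicit.
Unset Printing Implicit Defensive.
Import Order.TTheory GRing.Theory Num.Theory.

(** * Bits and cells *)

Definition bitsval (f : nat -> bool) p len := \sum_(j < len) f (p + j) * 2 ^ j.

Lemma bitsval0 f p : bitsval f p 0 = 0.
Proof. by rewrite /bitsval big_ord0. Qed.

Lemma bitsvalD f p a b :
  bitsval f p (a + b) = bitsval f p a + 2 ^ a * bitsval f (p + a) b.
Proof.
rewrite /bitsval big_split_ord /= big_distrr /=; congr (_ + _).
by apply: eq_bigr => j _; rewrite expnD addnA mulnCA.
Qed.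

Lemma bitsval_lt f p len : bitsval f p len < 2 ^ len.
Proof.
elim: len p => [|len IH] p; first by rewrite bitsval0.
rewrite -(add1n len) bitsvalD expnD.
have : bitsval f p 1 <= 1 by rewrite /bitsval big_ord1 muln1; case: (f _).
by have := IH (p + 1); lia.
Qed.

Lemma bitsval_mod f p a len : a <= len -> bitsval f p len %% 2 ^ a = bitsval f p a.
Proof.
move=> /subnKC <-; rewrite bitsvalD addnC mulnC modnMDl modn_small //.
exact: bitsval_lt.
Qed.

Lemma bitsval_div f p a len :
  a <= len -> bitsval f p len %/ 2 ^ a = bitsval f (p + a) (len - a).
Proof.
move=> /subnKC {1}<-; rewrite bitsvalD addnC mulnC divnMDl ?expn_gt0 //.
by rewrite divn_small ?addn0 // bitsval_lt.
Qed.

Lemma bitsval_of_nat f p len v : v < 2 ^ len ->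
  (forall j, j < len -> f (p + j) = odd (v %/ 2 ^ j)) -> bitsval f p len = v.
Proof.
elim: len p v => [|len IH] p v.
  by rewrite bitsval0 expn0 ltnS leqn0 => /eqP ->.
rewrite expnSr => v_lt fE; rewrite -(add1n len) bitsvalD {1}/bitsval big_ord1.
rewrite muln1 -/(bitsval _ _ _) fE // divn1 (IH (p + 1) (v./2)).
- by rewrite expn1 mul2n odd_double_half.
- by rewrite -divn2 ltn_divLR.
- move=> j jlt; rewrite -addnA add1n fE // -divn2 -divnMA expnS //.
Qed.

Lemma cellE w mem i : cell w mem i = bitsval (nth false mem) (i * w) w.
Proof. by []. Qed.

(* Shifting the second cell left by [w - p %% w] drops its excess high bits. *)
Lemma bitsval_two_cells f p w : 0 < w ->
  bitsval f p w = bitsval f (p %/ w * w) w %/ 2 ^ (p %% w)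
    + (bitsval f ((p %/ w).+1 * w) w * 2 ^ (w - p %% w)) %% 2 ^ w.
Proof.
move=> w_gt0; have o_lt : p %% w < w by rewrite ltn_mod.
rewrite bitsval_div; last exact: ltnW.
rewrite -divn_eq; set o := p %% w in o_lt *.
have pE : (p %/ w).+1 * w = p + (w - o).
  by rewrite {2}(divn_eq p w) -/o mulSn -addnA subnKC 1?addnC // ltnW.
have -> : (bitsval f ((p %/ w).+1 * w) w * 2 ^ (w - o)) %% 2 ^ w =
          2 ^ (w - o) * bitsval f (p + (w - o)) o.
  rewrite -[X in _ %% 2 ^ X](subnKC (ltnW o_lt)) expnD -muln_modl bitsval_mod 1?ltnW // pE.
  by rewrite mulnC.
by rewrite -bitsvalD subnK // ltnW.
Qed.

Section Layout.
Variables (I : finType) (pos len val : I -> nat) (m : nat).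

Definition layout : m.-tuple bool :=
  [tuple if [pick i | pos i <= p < pos i + len i] is Some i
         then odd (val i %/ 2 ^ (p - pos i)) else false | p < m].

Hypothesis val_lt : forall i, val i < 2 ^ len i.
Hypothesis pos_le : forall i, pos i + len i <= m.
Hypothesis disj : forall i j p, pos i <= p < pos i + len i ->
  pos j <= p < pos j + len j -> i = j.

Lemma layoutP i : bitsval (nth false layout) (pos i) (len i) = val i.
Proof.
apply: bitsval_of_nat => // j jlt.
have plt : pos i + j < m by apply: leq_trans (pos_le i); rewrite ltn_add2l.
rewrite (_ : nth _ _ _ = tnth layout (Ordinal plt)); last first.
  by rewrite (tnth_nth false).
rewrite tnth_mktuple /=; case: pickP => [i' i'P|/(_ i)]; last by lia.
have -> : i' = i by apply: disj i'P _; lia.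
by rewrite addKn.
Qed.

End Layout.

(** * Cell-probe algorithms that read bit fields *)

Fixpoint cp_bind (A B : Type) (a : cp_algo A) (f : A -> cp_algo B) : cp_algo B :=
  match a with
  | Answer x => f x
  | Probe i k => Probe i (fun v => cp_bind (k v) f)
  end.

Lemma cp_run_bind A B cells (a : cp_algo A) (f : A -> cp_algo B) :
  cp_run cells (cp_bind a f) =
  ((cp_run cells (f (cp_run cells a).1)).1,
   (cp_run cells a).2 + (cp_run cells (f (cp_run cells a).1)).2).
Proof. by elim: a => [x|i k IH] /=; [case: cp_run | rewrite IH addSn]. Qed.

Fixpoint read_cells w i c : cp_algo nat :=
  if c is c'.+1 then
    Probe i (fun x => cp_bind (read_cells w i.+1 c') (fun y => Answer (x + 2 ^ w * y)))
  else Answer 0.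

Lemma read_cellsP w mem i c :
  cp_run (cell w mem) (read_cells w i c) =
  (bitsval (nth false mem) (i * w) (c * w), c).
Proof.
elim: c i => [|c IH] i /=; first by rewrite bitsval0.
by rewrite cp_run_bind IH /= addn0 cellE (mulSn c) bitsvalD (mulSnr i).
Qed.

(** Two cells more than [len %/ w] always cover the field: one for the partial cell at its end, one
    for its offset in the first cell. *)
Definition read_field w pos len : cp_algo nat :=
  cp_bind (read_cells w (pos %/ w) (len %/ w).+2)
    (fun x => Answer ((x %/ 2 ^ (pos %% w)) %% 2 ^ len)).

Lemma read_fieldP w mem pos len : 0 < w ->
  cp_run (cell w mem) (read_field w pos len) =
  (bitsval (nth false mem) pos len, (len %/ w).+2).
Proof.
move=> w_gt0; rewrite /read_field cp_run_bind read_cellsP /= addn0; congr (_, _).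
have o_lt : pos %% w < w by rewrite ltn_mod.
have := divn_eq len w; have : len %% w < w by rewrite ltn_mod.
set a := len %/ w => h1 h2.
rewrite bitsval_div; last by lia.
by rewrite -divn_eq bitsval_mod //; lia.
Qed.

(** * Counting walks *)

Section Walks.
Variables (T : finType) (e : rel T).

(** Number of walks of [L] steps from [a] whose last vertex satisfies [B]. The end is a predicate so
    that [pred1] gives a fixed end and [predT] a free one. *)
Fixpoint nw L a (B : pred T) : nat :=
  if L is L'.+1 then \sum_(c | e a c) nw L' c B else B a.

Lemma nw_add L M a B :
  nw (L + M) a B = \sum_c nw L a (pred1 c) * nw M c B.
Proof.
elim: L a => [|L IH] a.
  rewrite (bigD1 a) //= eqxx mul1n big1 ?addn0 // => c ca.
  by rewrite eq_sym (negPf ca).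
rewrite addSn /=; under eq_bigr do rewrite IH.
by rewrite exchange_big; apply: eq_bigr => c _; rewrite big_distrl.
Qed.

Lemma nw_end L a B : nw L a B = \sum_(c | B c) nw L a (pred1 c).
Proof.
rewrite -{1}[L]addn0 nw_add [RHS]big_mkcond /=; apply: eq_bigr => c _.
by case: (B c); rewrite ?muln1 ?muln0.
Qed.

Lemma nw_walk L (v : nat -> T) (B : pred T) :
  (forall i, i < L -> e (v i) (v i.+1)) -> B (v L) -> 0 < nw L (v 0) B.
Proof.
elim: L v => [|L IH] v ev Bv; first by rewrite /= Bv.
rewrite /= (bigD1 (v 1)) /=; last exact: ev.
by rewrite ltn_addr // (IH (fun i => v i.+1)) // => i iL; exact: ev.
Qed.

Lemma nw_regular d L a : regular_graph e d -> nw L a predT = d ^ L.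
Proof.
move=> reg; elim: L a => [|L IH] a //=.
under eq_bigr do rewrite IH.
rewrite sum_nat_const expnS; congr (_ * _).
by rewrite -(reg a); apply: eq_card => x; rewrite inE.
Qed.

Lemma nw_le_pow d L a B : regular_graph e d -> nw L a B <= d ^ L.
Proof.
move=> reg; rewrite -(nw_regular L a reg) (nw_end L a B) (nw_end L a predT).
by rewrite big_mkcond; apply: leq_sum => c _; case: ifP.
Qed.

Lemma nw_sym L a b : symmetric e -> nw L a (pred1 b) = nw L b (pred1 a).
Proof.
move=> es; elim: L a b => [|L IH] a b; first by rewrite /= eq_sym.
rewrite -[in RHS]addn1 nw_add /= [RHS](bigID (fun c => e a c)) /=.
rewrite [X in _ = _ + X]big1 ?addn0 => [|c /negPf nac]; last first.
  rewrite big1 ?muln0 // => x; rewrite es; case: eqP => // ->.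
  by rewrite nac.
apply: eq_bigr => c ac; rewrite IH (bigD1 a) /=; last by rewrite es.
rewrite eqxx big1 ?addn0 ?muln1 // => x /andP[_ /negPf ->] //.
Qed.

(** * Parity of walks and the bipartite double cover *)

(** The Boolean flips at every step, so a path between two lifts records the parity of the length of
    the walk below it. *)
Definition double_cover (x y : T * bool) := e x.1 y.1 && (x.2 != y.2).
Local Notation e2 := double_cover.

Lemma double_cover_walk x y : connect e2 x y ->
  exists2 L, 0 < nw L x.1 (pred1 y.1) & odd L = x.2 (+) y.2.
Proof.
case/connectP => p; elim: p x => [|z p IH] x /=.
  by move=> _ ->; exists 0; rewrite /= ?eqxx ?addbb.
case/andP => /andP[exz nxz] /IH{}IH /IH[L L_gt0 oddL].
exists L.+1; first by rewrite /= (bigD1 z.1) //= ltn_addr.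
by rewrite /= oddL; move: nxz; case: x.2 z.2 y.2 => [] [] [].
Qed.

Hypothesis e_sym : symmetric e.

Lemma double_cover_sym : connect_sym e2.
Proof.
by apply: sym_connect_sym => x y; rewrite /e2 e_sym eq_sym.
Qed.

Lemma double_cover_flip a s b s' :
  connect e2 (a, s) (b, s') -> connect e2 (a, ~~ s) (b, ~~ s').
Proof.
case/connectP => p; elim: p a s => [|[c u] p IH] a s /=.
  by move=> _ [-> ->].
case/andP => /andP[/= ac su] pp /(IH _ _ pp); apply: connect_trans.
by apply: connect1; rewrite /e2 /= ac; move: su; case: (s) (u) => [] [].
Qed.

Lemma double_cover_lift a b :
  connect e a b -> exists s, connect e2 (a, false) (b, s).
Proof.
case/connectP => p; elim: p a => [|c p IH] a /=.
  by move=> _ ->; exists false; exact: connect0.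
case/andP => ac /IH{}IH /IH[s /double_cover_flip cs]; exists (~~ s).
by apply: connect_trans cs; apply: connect1; rewrite /e2 /= ac.
Qed.

Hypothesis e_connected : forall x y : T, connect e x y.
Hypothesis e_nonbip : ~ bipartite e.

(** Otherwise each vertex is reached from [(a, false)] with exactly one Boolean, and this Boolean
    two-colours the graph. *)
Lemma odd_cycle a : connect e2 (a, false) (a, true).
Proof.
apply/negPn/negP => na; case: e_nonbip.
exists (fun x => connect e2 (a, false) (x, true)) => x y exy.
have step s : connect e2 (a, false) (x, s) -> connect e2 (a, false) (y, ~~ s).
  move=> h; apply: connect_trans h _; apply: connect1.
  by rewrite /e2 /= exy; case: s.
have [s xs] := double_cover_lift (e_connected a x).
have [xt|xf] := boolP (connect e2 (a, false) (x, true)).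
  apply: contra na => yt; have /= yf := step _ xt.
  apply: connect_trans yf _; rewrite double_cover_sym.
  exact: (double_cover_flip yt).
by case: s xs => xs; [rewrite xs in xf | rewrite (step _ xs)].
Qed.

Lemma even_walk a b : exists2 L, 0 < nw L a (pred1 b) & ~~ odd L.
Proof.
suff /double_cover_walk[L L_gt0 oddL] : connect e2 (a, false) (b, false).
  by exists L; rewrite ?oddL.
have [[] ab] := double_cover_lift (e_connected a b) => //.
have := double_cover_flip ab; apply: connect_trans; exact: odd_cycle.
Qed.

Variable d : nat.
Hypothesis e_regular : regular_graph e d.

Lemma degree_gt0 : 0 < d.
Proof.
case: (posnP d) => // d0; case: e_nonbip.
exists (fun=> true) => x y exy; have := e_regular x; rewrite d0 => /eqP.
by rewrite cards_eq0 => /eqP/setP/(_ y); rewrite !inE exy.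
Qed.

(** The two additional steps go to a neighbour of [a] and back. *)
Lemma nwSS L a b : 0 < nw L a (pred1 b) -> 0 < nw L.+2 a (pred1 b).
Proof.
move=> h; rewrite -add2n nw_add (bigD1 a) //= ltn_addr // muln_gt0 h andbT.
have : 0 < #|[set y | e a y]| by rewrite e_regular degree_gt0.
case/card_gt0P => c; rewrite inE => ac.
rewrite (bigD1 c) //= ltn_addr // (bigD1 a) /= ?eqxx //.
by rewrite e_sym.
Qed.

(** Even walks join all pairs and can be lengthened by 2, so a single even length serves all pairs
    at once. *)
Lemma primitive : exists2 k, 0 < k & forall a b, 0 < nw k a (pred1 b).
Proof.
have /fin_all_exists[f fP] (ab : T * T) :
    exists h, 0 < nw h.*2 ab.1 (pred1 ab.2).
  have [L L_gt0 evL] := even_walk ab.1 ab.2; exists L./2.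
  by rewrite even_halfK.
exists (\max_ab f ab).+1.*2 => // a b.
have le : f (a, b) <= (\max_ab f ab).+1 by apply: leqW; exact: leq_bigmax.
have := fP (a, b); rewrite -(subnKC le) /= => h0.
elim: (_ - _) => [|m IH].
  by rewrite addn0.
by rewrite addnS doubleS; exact: nwSS.
Qed.

(** With [d = 1] there is one walk of each length from [a], yet [k] steps reach every vertex. The
    graph then has a single vertex and, without loops, no edge, hence is bipartite. *)
Lemma degree_gt1 : irreflexive e -> 1 < d.
Proof.
move=> e_irr; rewrite ltn_neqAle degree_gt0 andbT; apply/eqP => d1.
have [k _ k_pos] := primitive.
have noedge a c : ~~ e a c.
  have : \sum_x nw k a (pred1 x) = 1 by rewrite -(nw_end k a predT) (nw_regular _ _ e_regular) -d1 exp1n.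
  have [-> _|ca] := eqVneq c a; first by rewrite e_irr.
  rewrite (bigD1 a) //= (bigD1 c) //=.
  move=> h; exfalso; have := k_pos a a; have := k_pos a c; move: h.
  by move: (nw k a (pred1 a)) (nw k a (pred1 c)) (\sum_(_ | _) _) => u u' s; lia.
apply: e_nonbip; exists (fun=> true) => x y.
by rewrite (negPf (noedge x y)).
Qed.

(** * Mixing of the walk *)

(** [D] bounds the oscillation, as the start varies, of the number of walks into a fixed end. *)
Definition osc L D := forall b a a', nw L a (pred1 b) <= nw L a' (pred1 b) + D.

(* After splitting off the uniform part of the [k]-step transition counts, what is
   left has total mass at most [d ^ k - 1]. *)
Lemma osc_step k L D : (forall a b, 0 < nw k a (pred1 b)) ->
  osc L D -> osc (k + L) ((d ^ k).-1 * D).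
Proof.
move=> k_pos oscL b a a'.
have mass x : \sum_c nw k x (pred1 c) = d ^ k.
  by rewrite -(nw_end k x predT) (nw_regular _ _ e_regular).
rewrite !nw_add; set f := fun c => nw L c (pred1 b).
have [c0 _ c0P] := @arg_minnP _ a predT f isT.
pose g c := f c - f c0.
have fE c : f c = f c0 + g c by rewrite subnKC // c0P.
have gD c : g c <= D by rewrite leq_subLR oscL.
have sumE x : \sum_c nw k x (pred1 c) * f c =
    d ^ k * f c0 + \sum_c g c + \sum_c (nw k x (pred1 c)).-1 * g c.
  rewrite -(mass x) big_distrl -!big_split /=; apply: eq_bigr => c _.
  rewrite {1}fE; have := k_pos x c; case: (nw k x _) => // m _ /=; lia.
rewrite !sumE; rewrite -!addnA leq_add2l leq_add2l.
apply: leq_trans (leq_addl _ _).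
apply: (@leq_trans (\sum_c (nw k a (pred1 c)).-1 * D)).
  by apply: leq_sum => c _; rewrite leq_mul2l gD orbT.
rewrite -big_distrl leq_mul2r /=; apply/orP; right.
rewrite -(mass a) (bigD1 a) //= [X in _ <= X.-1](bigD1 a) //=.
have := k_pos a a; case: (nw k a _) => // m _ /=.
by rewrite leq_add2l; apply: leq_sum => c _; exact: leq_pred.
Qed.

(** A round of [k] steps shrinks the oscillation relative to the number of walks by the factor
    [1 - 1/x], where [x = d ^ k], so [x] rounds halve it. After [h + #|T|] halvings, even [#|T|]
    times the oscillation is at most [d ^ L / 2 ^ h], because [#|T| < 2 ^ #|T|]. *)
Lemma mixing : exists2 c, 0 < c & forall h a b,
  2 ^ h * (#|T| * nw (c * (h + #|T|)) a (pred1 b)) <=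
  (2 ^ h).+1 * d ^ (c * (h + #|T|)).
Proof.
have [k k_gt0 k_pos] := primitive.
have x_gt0 : 0 < d ^ k by rewrite expn_gt0 degree_gt0.
exists (k * d ^ k) => [|h a b]; first by rewrite muln_gt0 k_gt0.
set s := h + #|T|; set x := d ^ k in x_gt0 *; rewrite -mulnA.
have oscj j : osc (k * j) (x.-1 ^ j).
  elim: j => [|j IH]; last by rewrite mulnS expnS; exact: osc_step.
  by rewrite muln0 expn0 => y z z' /=; case: (_ == _) => //; rewrite addn1.
(* The first two terms of the binomial expansion of [(y + 1) ^ y.+1] suffice. *)
have half : 2 * x.-1 ^ x <= x ^ x.
  case: (x) x_gt0 => // y _; rewrite succnK.
  have -> : y.+1 ^ y.+1 = (y + 1) ^ y.+1 by rewrite addn1.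
  rewrite expnDn big_ord_recl /= big_ord_recl /= subn0 subSS subn0 bin0 bin1.
  rewrite !exp1n !muln1 mul1n addnA expnS; apply: leq_trans (leq_addr _ _).
  by rewrite mulSn; lia.
have decay : 2 ^ s * x.-1 ^ (x * s) <= x ^ (x * s).
  by rewrite !expnM -expnMn leq_exp2r // /s; move: (max_card (pred1 a)); rewrite card1; lia.
have tau_lt : #|T| < 2 ^ #|T| by apply: ltn_expl.
set L := k * (x * s).
(* Reversal turns the walks into [b] into walks out of [b], so the average over the starts is
   [d ^ L / #|T|]. *)
have sumL : \sum_a' nw L a' (pred1 b) = d ^ L.
  under eq_bigr do rewrite nw_sym //.
  by rewrite -(nw_end L b predT) (nw_regular _ _ e_regular).
have : #|T| * nw L a (pred1 b) <= d ^ L + #|T| * x.-1 ^ (x * s).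
  rewrite -sumL -[X in _ + X]sum_nat_const -big_split /= -sum_nat_const.
  by apply: leq_sum => a' _; exact: oscj.
have dL : d ^ L = x ^ (x * s) by rewrite /L expnM.
move=> bound; rewrite mulSn addnC.
apply: leq_trans (_ : 2 ^ h * (d ^ L + #|T| * x.-1 ^ (x * s)) <= _).
  by rewrite leq_mul2l bound orbT.
rewrite mulnDr leq_add2l mulnA dL; apply: leq_trans decay.
by rewrite leq_mul2r /s expnD leq_mul2l ltnW // orbT orbT.
Qed.

End Walks.

(** * The alias method *)

Section Alias.
Variable I : eqType.

(* A bucket [(t, (i, f), (i', f'))] of the alias method holds codes [f, f+1, ...]
   of the item [i] at positions below [t] and codes [f', f'+1, ...] of [i'] from
   position [t] on. *)
Definition bucket := (nat * (I * nat) * (I * nat))%type.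

Definition bucket_get (b : bucket) p : I * nat :=
  let: (t, (i, f), (i', f')) := b in
  if p < t then (i, f + p) else (i', f' + (p - t)).

Definition alias_get s (tb : nat -> bucket) j := bucket_get (tb (j %/ s)) (j %% s).

Definition bucket_ok s M (items : seq I) (b : bucket) :=
  let: (t, (i, f), (i', f')) := b in
  [&& t <= s, i \in items, f <= M, i' \in items & f' <= M].

Definition total (ps : seq (I * nat * nat)) := \sum_(x <- ps) x.2.

Lemma total_cons x ps : total (x :: ps) = x.2 + total ps.
Proof. by rewrite /total big_cons. Qed.

Lemma total1 x : total [:: x] = x.2.
Proof. by rewrite /total big_seq1. Qed.

Lemma perm_total ps ps' : perm_eq ps ps' -> total ps = total ps'.
Proof. exact: perm_big. Qed.

(** A piece [(i, f, l)] stands for the codes [f] to [f + l - 1] of the item [i], still to be placed;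
    each step of the induction fills one bucket of size [s]. The invariant [(size ps).-1 * s < M]
    says that there are at most as many pieces as buckets to fill; it supplies a partner for any
    piece shorter than [s]. *)
Lemma alias_pieces s (items : seq I) K (ps : seq (I * nat * nat)) M : 0 < s ->
  (forall x, x \in ps -> [&& x.1.1 \in items, 0 < x.2 & x.1.2 + x.2 <= K]) ->
  M = total ps -> 0 < size ps -> (size ps).-1 * s < M ->
  exists tb : nat -> bucket,
    (forall x, x \in ps -> forall o, o < x.2 ->
      exists2 j, j < M & alias_get s tb j = (x.1.1, x.1.2 + o)) /\
    (forall k, k * s < M -> bucket_ok s K items (tb k)).
Proof.
move=> s_gt0; elim/ltn_ind: M ps => M IH ps psP ME ps_gt0 avg.
(* A single piece takes all remaining buckets, both halves of each naming the same item. *)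
have [ps1|ps2] := leqP (size ps) 1.
  case: ps ps1 ps_gt0 psP ME avg => [|[[i f] l] [|]] // _ _ psP + _.
  rewrite total1 /= => ->.
  have /and3P[/= iI l_gt0 flK] := psP _ (mem_head _ _).
  exists (fun k => (s, (i, f + k * s), (i, f + k * s))); split.
    move=> x; rewrite inE => /eqP -> /= o ol; exists o => //.
    by rewrite /alias_get /= ltn_mod s_gt0 -addnA -divn_eq.
  by move=> k kl; rewrite /= leqnn iI !andTb; apply/andP; split; lia.
have step b (ps' : seq (I * nat * nat)) : bucket_ok s K items b ->
    (forall z, z \in ps' -> [&& z.1.1 \in items, 0 < z.2 & z.1.2 + z.2 <= K]) ->
    M = s + total ps' -> 0 < size ps' ->
    (size ps').-1 * s < total ps' ->
    (forall z, z \in ps -> forall o, o < z.2 ->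
      (exists2 p, p < s & bucket_get b p = (z.1.1, z.1.2 + o)) \/
      exists z' o', [/\ z' \in ps', o' < z'.2 &
        (z.1.1, z.1.2 + o) = (z'.1.1, z'.1.2 + o')]) ->
    exists tb : nat -> bucket,
    (forall x, x \in ps -> forall o, o < x.2 ->
      exists2 j, j < M & alias_get s tb j = (x.1.1, x.1.2 + o)) /\
    (forall k, k * s < M -> bucket_ok s K items (tb k)).
  move=> bok ps'P ME' ps'_gt0 avg' cover.
  have [|tb [tbP tbK]] := IH _ _ ps' ps'P erefl ps'_gt0 avg'.
    by rewrite ME' -[X in X < _]add0n ltn_add2r.
  exists (fun k => if k is k'.+1 then tb k' else b); split.
    move=> z zps o oz; case: (cover z zps o oz) => [[p ps_lt bp]|].
      by exists p; rewrite ?ME' ?ltn_addr // /alias_get divn_small // modn_small.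
    move=> [z' [o' [z'P o'z' ->]]]; have [j jlt jE] := tbP z' z'P o' o'z'.
    exists (s + j); first by rewrite ME' ltn_add2l.
    by rewrite -jE /alias_get divnDl // divnn s_gt0 modnDl.
  by case=> [|k] //; rewrite mulSn ME' ltn_add2l => /tbK.
have [/hasP[x xps xs]|/hasPn big] := boolP (has (fun x => x.2 < s) ps).
- have [r pm] : exists r, perm_eq ps (x :: r) by exists (rem x ps); exact: perm_to_rem.
  have ME1 : M = x.2 + total r by rewrite ME (perm_total pm) total_cons.
  have sz1 : size ps = (size r).+1 by rewrite (perm_size pm).
  (* Were every other piece at most [s - x.2] long, the total would be too small for the invariant.
     The strict inequality leaves a nonempty rest of [y]. *)
  have [/hasP[y yr ys]|/hasPn small] := boolP (has (fun y => s - x.2 < y.2) r); last first.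
    have : total r <= size r * (s - x.2).
      rewrite /total -sum1_size big_distrl /= !big_seq.
      by apply: leq_sum => z /small; rewrite -leqNgt mul1n.
    rewrite mulnBr => h; move: avg; rewrite ME1 sz1 /= => h'.
    have r_gt0 : 0 < size r by lia.
    have aux (n t l : nat) : t <= n * s - n * l -> n * s < l + t -> l <= n * l ->
      n * l <= n * s -> False by clear; lia.
    case: (aux _ _ _ h h'); first by rewrite leq_pmull.
    by rewrite leq_mul2l ltnW ?orbT.
  have [r2 pm2] : exists r', perm_eq r (y :: r') by exists (rem y r); exact: perm_to_rem.
  have memps z : z \in ps -> [|| z == x, z == y | z \in r2].
    by rewrite (perm_mem pm) inE (perm_mem pm2) inE.
  have yps : y \in ps by rewrite (perm_mem pm) inE yr orbT.
  have r2ps z : z \in r2 -> z \in ps.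
    by move=> zr; rewrite (perm_mem pm) inE (perm_mem pm2) inE zr !orbT.
  have ME2 : total r = y.2 + total r2.
    by rewrite (perm_total pm2) total_cons.
  have sz2 : size r = (size r2).+1 by rewrite (perm_size pm2).
  case: x => [[i f] l] /= in xps xs pm ME1 ys memps *.
  case: y => [[i' f'] l'] /= in yps yr ys memps ME2 pm2 *.
  have /and3P[/= xI xl xK] := psP _ xps; have /and3P[/= yI yl yK] := psP _ yps.
  apply: (step (l, (i, f), (i', f'))
    ((i', f' + (s - l), l' - (s - l)) :: r2)).
  + by rewrite /= xI yI /=; lia.
  + move=> z; rewrite inE => /orP[/eqP ->|/r2ps /psP //].
    by rewrite /= yI /=; lia.
  + by rewrite total_cons /= ME1 ME2; lia.
  + by [].
  + by rewrite total_cons /=; move: avg; rewrite ME1 ME2 sz1 sz2 /=; lia.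
  + move=> z /memps /or3P[/eqP ->|/eqP ->|zr2] o /= oz.
    * by left; exists o; rewrite ?oz // (ltn_trans oz).
    * have [o1|o1] := ltnP o (s - l).
        left; exists (l + o); first by lia.
        by rewrite ltnNge leq_addr /= addKn.
      right; exists (i', f' + (s - l), l' - (s - l)), (o - (s - l)).
      by rewrite mem_head /=; split; [|lia|congr (_, _); lia].
    * by right; exists z, o; rewrite inE zr2 orbT.
(* No piece is shorter than [s], and the first one fills a whole bucket. *)
- have big' z : z \in ps -> s <= z.2 by move/big; rewrite -leqNgt.
  case: ps ps2 psP ME avg big' {ps_gt0 big} step => [|[[i f] l] ps] //= ps2 psP.
  rewrite total_cons /= => ME avg big step.
  have sums : size ps * s <= total ps.
    rewrite /total -sum1_size big_distrl /= !big_seq.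
    by apply: leq_sum => z zp; rewrite mul1n big // inE zp orbT.
  have sl := big _ (mem_head _ _); have /and3P[/= iI l_gt0 fK] := psP _ (mem_head _ _).
  have psP' z : z \in ps -> [&& z.1.1 \in items, 0 < z.2 & z.1.2 + z.2 <= K].
    by move=> zp; apply: psP; rewrite inE zp orbT.
  have bok : bucket_ok s K items (s, (i, f), (i, f)) by rewrite /= leqnn iI /=; lia.
  case: (ltngtP s l) sl => // [sl _|sl _].
    apply: (step (s, (i, f), (i, f)) ((i, f + s, l - s) :: ps)) => //.
    + by move=> z; rewrite inE => /orP[/eqP ->|/psP' //]; rewrite /= iI; lia.
    + by rewrite total_cons /=; lia.
    + by rewrite total_cons /=; lia.
    + move=> z; rewrite inE => /orP[/eqP ->|zp] o /= ol.
        have [os|so] := ltnP o s; first by left; exists o; rewrite ?os.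
        right; exists (i, f + s, l - s), (o - s); rewrite mem_head /=.
        by split; [|lia|congr (_, _); lia].
      by right; exists z, o; rewrite inE zp orbT.
  apply: (step (s, (i, f), (i, f)) ps) => //.
  + by lia.
  + case: (size ps) sums ps2 => [|m] //=; rewrite mulSn; lia.
  + move=> z; rewrite inE => /orP[/eqP ->|zp] o /= ol.
      by left; exists o; rewrite sl ?ol.
    by right; exists z, o.
Qed.

Variables (i0 : I) (items : seq I) (wt : I -> nat).

(** Dividing by the number of items of positive weight, rather than of all items, keeps the size
    positive whenever there is something to code. *)
Definition alias_size := (\sum_(i <- items) wt i) %/ count (fun i => 0 < wt i) items.

Lemma alias_exists : exists tb : nat -> bucket,
  (forall i, i \in items -> forall o, o < wt i ->
    exists2 j, j < \sum_(i <- items) wt i & alias_get alias_size tb j = (i, o)) /\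
  (forall k, k * alias_size < \sum_(i <- items) wt i ->
    bucket_ok alias_size (\sum_(i <- items) wt i) items (tb k)).
Proof.
rewrite /alias_size; set M := \sum_(i <- items) wt i; set n := count _ _.
pose ps := [seq (i, 0, wt i) | i <- items & 0 < wt i].
have n0E : size ps = n by rewrite size_map size_filter.
have ME : M = total ps.
  rewrite /total big_map big_filter /M (bigID (fun i => 0 < wt i)) /=.
  by rewrite [X in _ + X]big1 ?addn0 // => i; case: (wt i).
have nM : n <= M.
  rewrite ME -n0E /total -sum1_size !big_seq; apply: leq_sum => x.
  by case/mapP => i; rewrite mem_filter => /andP[? _] ->.
have wtM i : i \in items -> wt i <= M.
  by move=> ii; rewrite /M (perm_big _ (perm_to_rem ii)) big_cons leq_addr.
have [n0|n_gt0] := posnP n.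
  exists (fun=> (0, (i0, 0), (i0, 0))); split=> [i ii o oi|k].
    suff : i \in [seq i <- items | 0 < wt i].
      by move: n0E; rewrite n0 size_map; case: [seq i <- items | _].
    by rewrite mem_filter ii andbT (leq_ltn_trans _ oi).
  by rewrite n0 divn0 muln0 ltnNge ME /total (size0nil (etrans n0E n0)) big_nil.
have s_gt0 : 0 < M %/ n by rewrite divn_gt0.
have [||||tb [tbP tbK]] := @alias_pieces (M %/ n) items M ps M s_gt0.
- move=> x /mapP[i]; rewrite mem_filter => /andP[wi ii] -> /=.
  by rewrite ii wi wtM.
- exact: ME.
- by rewrite n0E.
- rewrite n0E; apply: (@leq_trans (n * (M %/ n))); last by rewrite mulnC leq_divM.
  by rewrite ltn_mul2r s_gt0 /= prednK.
exists tb; split=> // i ii o oi.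
have [|j jM jE] := tbP (i, 0, wt i) _ o oi; last by exists j.
by apply: map_f; rewrite mem_filter ii andbT (leq_ltn_trans _ oi).
Qed.

(** A fixed choice depending only on [items] and [wt], so that the encoder and the lookup table
    agree on the buckets. *)
Definition alias_table : nat -> bucket := projT1 (cid alias_exists).

Lemma alias_code i o : i \in items -> o < wt i ->
  exists2 j, j < \sum_(i <- items) wt i & alias_get alias_size alias_table j = (i, o).
Proof. by move=> ii oi; have [+ _] := projT2 (cid alias_exists); apply. Qed.

Lemma alias_table_ok k : k * alias_size < \sum_(i <- items) wt i ->
  bucket_ok alias_size (\sum_(i <- items) wt i) items (alias_table k).
Proof. by have [_] := projT2 (cid alias_exists); apply. Qed.

(** Rounding the bucket size down at most doubles the number of buckets. *)
Lemma alias_buckets j : 0 < count (fun i => 0 < wt i) items ->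
  j < \sum_(i <- items) wt i -> j %/ alias_size < 2 * size items.
Proof.
set n := count _ _ => n_gt0; set M := \sum_(i <- items) wt i => jM.
have nM : n <= M.
  rewrite /n -sum1_count [X in _ <= X](bigID (fun i => 0 < wt i)) /=.
  by apply: leq_trans (leq_addr _ _); apply: leq_sum.
have s_gt0 : 0 < alias_size by rewrite divn_gt0.
rewrite ltn_divLR //; apply: leq_trans jM _.
apply: (@leq_trans (2 * n * alias_size)); last first.
  by rewrite leq_mul2r leq_mul2l count_size !orbT.
have := divn_eq M n; have : M %% n < n by rewrite ltn_mod.
rewrite -/alias_size -/M => h1 h2; rewrite {1}h2 -/(alias_size).
have : 1 * n <= (M %/ n) * n by rewrite leq_mul2r divn_gt0 // nM orbT.
by rewrite /alias_size -/M -/n; lia.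
Qed.

End Alias.

(** * Codes for pieces of a walk *)

(** One number below the product codes the indices of all pieces, and any index is recovered by a
    division and a remainder without touching the others. *)
Lemma mixed_radix (ns js : seq nat) : size js = size ns ->
  (forall c, c < size ns -> nth 0 js c < nth 0 ns c) ->
  exists2 o, o < \prod_(n <- ns) n & forall c, c < size ns ->
    (o %/ \prod_(n <- take c ns) n) %% nth 0 ns c = nth 0 js c.
Proof.
elim: ns js => [|n ns IH] [|j js] //=; first by exists 0; rewrite ?big_nil.
case=> /IH{}IH jn; have /= j0 := jn 0 isT.
have [c cs|o oP oE] := IH; first by have := jn c.+1; rewrite /= ltnS; apply.
have n_gt0 : 0 < n by lia.
exists (o * n + j).
  rewrite big_cons; apply: (@leq_trans (o.+1 * n)); first by rewrite mulSn; lia.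
  by rewrite mulnC leq_mul2l oP orbT.
case=> [|c]; first by rewrite take0 big_nil divn1 modnMDl modn_small.
rewrite ltnS big_cons divnMA divnMDl // [j %/ n]divn_small // addn0.
exact: oE.
Qed.

Section Codec.
Variables (T : finType) (e : rel T) (b : nat).
Local Notation nw := (nw e).

Definition pieces l L : seq nat :=
  nseq (L %/ l) l ++ (if L %% l == 0 then [::] else [:: L %% l]).

Lemma sumn_pieces l L : sumn (pieces l L) = L.
Proof.
rewrite sumn_cat sumn_nseq [X in _ = X](divn_eq L l) mulnC; congr (_ + _).
by case: eqP => [->|_] //=; rewrite addn0.
Qed.

Lemma size_pieces l L : size (pieces l L) = L %/ l + (L %% l != 0).
Proof. by rewrite size_cat size_nseq; case: eqP. Qed.

Lemma size_pieces_le l L m : 0 < l -> L <= m * l -> size (pieces l L) <= m.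
Proof.
move=> l_gt0 Lm; rewrite size_pieces.
have := divn_eq L l; case: eqP => [->|/eqP rem] LE /=.
  by rewrite addn0; rewrite -(@leq_pmul2r l) //; lia.
rewrite addn1 -(@ltn_pmul2r l) //; apply: leq_trans Lm.
by rewrite [X in _ < X]LE -{1}[_ * _]addn0 ltn_add2l lt0n.
Qed.

Lemma nth_pieces l L c : 0 < l -> nth 0 (pieces l L) c = minn l (L - c * l).
Proof.
move=> l_gt0; have LE := divn_eq L l; rewrite nth_cat size_nseq nth_nseq.
have [cL|Lc] := ltnP c (L %/ l).
  rewrite (minn_idPl _) //; have : c.+1 * l <= L %/ l * l by rewrite leq_pmul2r.
  by rewrite mulSn; lia.
have : L %% l < l by rewrite ltn_mod.
have : L %/ l * l <= c * l by rewrite leq_pmul2r.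
have [->|ne] := eqVneq c (L %/ l).
  by rewrite subnn; case: eqP => /=; rewrite ?nth_nil; lia.
have : (L %/ l).+1 * l <= c * l by rewrite leq_pmul2r // ltn_neqAle eq_sym ne.
rewrite mulSn => h1 h2 h3; rewrite (_ : L - _ = 0); last by lia.
by rewrite minn0 nth_default //; case: eqP => _ //=; lia.
Qed.


Fixpoint paths m : seq (seq T) :=
  if m is m'.+1 then [seq c :: p | c <- enum T, p <- paths m'] else [:: [::]].

Lemma size_paths m : size (paths m) = #|T| ^ m.
Proof. by elim: m => //= m IH; rewrite size_allpairs IH -cardE expnS. Qed.

Lemma mem_paths p : p \in paths (size p).
Proof. by elim: p => //= c p IH; apply: allpairs_f; rewrite ?mem_enum. Qed.

(** [p] lists the ends of the successive pieces, and each entry counts the walks within one piece.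
    The product in [weight] therefore counts the walks through these breakpoints. *)
Fixpoint factors (Ls : seq nat) a (p : seq T) : seq nat :=
  match Ls, p with
  | L :: Ls', c :: p' => nw L a (pred1 c) :: factors Ls' c p'
  | _, _ => [::]
  end.

Definition weight Ls a (B : pred T) p := B (last a p) * \prod_(n <- factors Ls a p) n.

Lemma size_factors Ls a p : size p = size Ls -> size (factors Ls a p) = size Ls.
Proof. by elim: Ls a p => [|L Ls IH] a [|c p] //= [/IH ->]. Qed.

Lemma nth_factors Ls a p c : size p = size Ls -> c < size Ls ->
  nth 0 (factors Ls a p) c = nw (nth 0 Ls c) (nth a (a :: p) c) (pred1 (nth a p c)).
Proof.
elim: Ls a p c => [|L Ls IH] a [|x p] [|c] //= [sz] cs; rewrite IH //.
by congr (nw _ _ (pred1 _)); apply: set_nth_default; rewrite /= sz // ltnW.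
Qed.

Lemma sum_weight Ls a B : \sum_(p <- paths (size Ls)) weight Ls a B p = nw (sumn Ls) a B.
Proof.
elim: Ls a => [|L Ls IH] a.
  by rewrite /= big_seq1 /weight /= big_nil muln1.
rewrite [paths _]/= big_allpairs_dep big_enum /= nw_add.
apply: eq_bigr => c _; rewrite -IH big_distrr /=; apply: eq_bigr => p _.
by rewrite /weight /= big_cons mulnCA.
Qed.

Definition ending (oa : option T) : pred T := if oa is Some a then pred1 a else predT.

Definition node_pieces t L := pieces (b ^ t) L.
Definition node_paths t L := paths (size (node_pieces t L)).
Definition node_weight t L a oa := weight (node_pieces t L) a (ending oa).
Definition node_size t L a oa := alias_size (node_paths t L) (node_weight t L a oa).
Definition node_table t L a oa :=
  alias_table [::] (node_paths t L) (node_weight t L a oa).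

Lemma node_total t L a oa :
  \sum_(p <- node_paths t L) node_weight t L a oa p = nw L a (ending oa).
Proof. by rewrite sum_weight sumn_pieces. Qed.

(* The vertex at distance [z.+1] along the piece of length [L <= b ^ t] that starts
   at [a], ends at [oa] (or anywhere) and has code [j]. *)
Fixpoint piece_get t L a oa j z : T :=
  if t is t'.+1 then
    let: (p, o) := alias_get (node_size t' L a oa) (node_table t' L a oa) j in
    let Ls := node_pieces t' L in
    let c := z %/ b ^ t' in
    let ns := factors Ls a p in
    piece_get t' (nth 0 Ls c) (nth a (a :: p) c) (Some (nth a p c))
      ((o %/ \prod_(n <- take c ns) n) %% nth 0 ns c) (z %% b ^ t')
  else odflt a oa.

(** Validity of the arguments in every round of decoding. The correctness of [piece_get] alone would
    not bound the addresses and values that the program meets on the way. *)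
Fixpoint piece_ok t L a oa j z : bool :=
  [&& j < nw L a (ending oa), z < L &
    if t is t'.+1 then
      let: (p, o) := alias_get (node_size t' L a oa) (node_table t' L a oa) j in
      let Ls := node_pieces t' L in
      let c := z %/ b ^ t' in
      let ns := factors Ls a p in
      piece_ok t' (nth 0 Ls c) (nth a (a :: p) c) (Some (nth a p c))
        ((o %/ \prod_(n <- take c ns) n) %% nth 0 ns c) (z %% b ^ t')
    else oa != None].

Hypothesis b_gt0 : 0 < b.

(** Induction provides codes for the pieces; they become the digits of one number, and the alias
    method joins that number to the breakpoints. Without a subdivision only a prescribed end can be
    returned, whence the condition on [t] and [oa]. *)
Lemma piece_codes t L (v : nat -> T) oa : L <= b ^ t -> (0 < t) || (oa != None) ->
  (forall i, i < L -> e (v i) (v i.+1)) -> ending oa (v L) ->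
  exists2 j, j < nw L (v 0) (ending oa) &
    forall z, z < L -> piece_ok t L (v 0) oa j z /\ piece_get t L (v 0) oa j z = v z.+1.
Proof.
elim: t L v oa => [|t IH] L v oa Lt t_oa ev vL.
  (* A piece of at most one step has only its end to return, so any code will do; 0 is in range
     because the walk itself is counted. *)
  exists 0; first exact: nw_walk.
  case: oa t_oa vL => [a|] // _ /eqP vL z zL; split.
    rewrite [piece_ok _ _ _ _ _ _]/= zL !andbT.
    by apply: nw_walk => //; rewrite /= vL.
  by rewrite /= -vL; congr v; move: Lt; rewrite expn0; lia.
have l_gt0 : 0 < b ^ t by rewrite expn_gt0 b_gt0.
set l := b ^ t in l_gt0; set Ls := node_pieces t L; set m := size Ls.
pose p := [seq v (minn (c.+1 * l) L) | c <- iota 0 m].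
have szp : size p = m by rewrite size_map size_iota.
have nthp c a : c < m -> nth a p c = v (minn (c.+1 * l) L).
  by move=> cm; rewrite (nth_map 0) ?size_iota // nth_iota.
have cl_le c : c < m -> c * l <= L.
  rewrite /m size_pieces -/l; have LE := divn_eq L l.
  case: eqP => /= _; rewrite ?addn0 ?addn1 ?ltnS => cm;
  by rewrite LE; apply: leq_trans (leq_addr _ _); rewrite leq_pmul2r // ltnW.
have nthp0 c : c < m -> nth (v 0) (v 0 :: p) c = v (c * l).
  case: c => [|c] cm //=; rewrite nthp; last exact: ltnW.
  by congr v; apply/minn_idPl; exact: cl_le.
have nthL c : nth 0 Ls c = minn l (L - c * l) by apply: nth_pieces.
have pL : last (v 0) p = v L.
  have [m0|m_gt0] := posnP m.
    rewrite /p m0 /=; congr v; rewrite -[RHS](sumn_pieces l); move: m0.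
    by rewrite /m /Ls /node_pieces -/l; case: pieces.
  rewrite (last_nth (v 0)) szp -[m]prednK //= nthp ?prednK //; congr v.
  apply/minn_idPr; have := sumn_pieces l L; rewrite -/(node_pieces t L) -/Ls => {1}<-.
  have : all (fun x => x <= l) Ls.
    by apply/(all_nthP 0) => c _; rewrite nthL geq_minl.
  rewrite /m; elim: (Ls) => //= x s IHs /andP[xl /IHs]; rewrite mulSn; lia.
have /choice[jf jP] c : exists j, c < m -> j < nw (nth 0 Ls c) (v (c * l)) (pred1 (nth (v 0) p c)) /\
    forall z, z < nth 0 Ls c ->
      piece_ok t (nth 0 Ls c) (v (c * l)) (Some (nth (v 0) p c)) j z /\
      piece_get t (nth 0 Ls c) (v (c * l)) (Some (nth (v 0) p c)) j z = v (c * l + z).+1.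
  have [cm|] := ltnP c m; last by exists 0.
  have [||||j jlt jE] := IH (nth 0 Ls c) (fun i => v (c * l + i)) (Some (nth (v 0) p c)).
  - by rewrite nthL geq_minl.
  - by rewrite orbT.
  - by move=> i; rewrite nthL addnS => iL; apply: ev; lia.
  - rewrite /= nthp // nthL; apply/eqP; congr v; have := cl_le _ cm; rewrite mulSn; lia.
  exists j => _; rewrite addn0 in jlt jE; split=> // z zL.
  by have [? ->] := jE z zL; rewrite addnS.
pose ns := factors Ls (v 0) p.
have szns : size ns = m by rewrite size_factors.
have nthns c : c < m -> nth 0 ns c = nw (nth 0 Ls c) (v (c * l)) (pred1 (nth (v 0) p c)).
  by move=> cm; rewrite nth_factors // nthp0.
have [||o oP oE] := @mixed_radix ns [seq jf c | c <- iota 0 m].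
- by rewrite size_map size_iota.
- rewrite szns => c cm; rewrite (nth_map 0) ?size_iota // nth_iota // nthns //.
  by have [] := jP _ cm.
have [||j jlt jE] := @alias_code _ [::] (node_paths t L) (node_weight t L (v 0) oa) p o.
- by rewrite /node_paths -/Ls -/m -szp mem_paths.
- by rewrite /node_weight /weight pL vL mul1n.
have jM : j < nw L (v 0) (ending oa) by rewrite -(node_total t).
exists j => // z zL; rewrite [piece_ok _ _ _ _ _ _]/= [piece_get _ _ _ _ _ _]/= jM zL jE.
rewrite -/Ls -/ns -/l.
have zE := divn_eq z l; have zl : z %% l < l by rewrite ltn_mod.
have cm : z %/ l < m.
  rewrite ltnNge; apply/negP => mz; have := nthL m; rewrite nth_default //.
  have : m * l <= z by apply: leq_trans (leq_divM z l); rewrite leq_pmul2r.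
  by move=> h1 h2; lia.
rewrite oE ?szns // (nth_map 0) ?size_iota // nth_iota // add0n nthp0 //.
have [_ okget] := jP _ cm; have [|-> ->] := okget (z %% l); last by rewrite -zE.
by rewrite nthL; lia.
Qed.

End Codec.

(** * The spill tree *)

Section OddParts.

Definition level i := logn 2 i.
Definition rank_at i := i %/ 2 ^ (level i).+1.

Lemma level_rankE i : 0 < i -> i = 2 ^ level i * (rank_at i).*2.+1.
Proof.
move=> i_gt0; have [m + iE] := pfactor_coprime (isT : prime 2) i_gt0.
rewrite prime_coprime // dvdn2 negbK => m_odd.
rewrite [LHS]iE mulnC; congr (_ * _).
rewrite /rank_at {1}iE /level expnS divnMr ?expn_gt0 // divn2.
by rewrite -[LHS]odd_double_half m_odd.
Qed.

Lemma level_odd k u : level (2 ^ k * u.*2.+1) = k.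
Proof.
rewrite /level lognM ?expn_gt0 // pfactorK // logn_coprime ?addn0 //.
by rewrite coprime2n /= odd_double.
Qed.

End OddParts.

Lemma up_log_lt n : 0 < n -> 2 ^ up_log 2 n < 2 * n.
Proof.
case: n => [|[|n]] // _.
have := @up_log_bounds 2 n.+2 isT isT; have : 0 < up_log 2 n.+2 by rewrite up_log_gt0.
by case: up_log => // m _ /= /andP[h _]; rewrite expnS ltn_pmul2l.
Qed.

Section SpillTree.
Variables (N X G : nat).

(** The least number of bits with room for [G] contents beside each of the [Y] combinations of
    spills of the children. Minimality leaves a content size between [G] and [2 * G]. *)
Definition word_bits Y := up_log 2 (Y * G).
Definition content_size Y := 2 ^ word_bits Y %/ Y.
Definition spill_size Y := (X %/ content_size Y).+1.

(* Numbers [1 .. N] form a binary tree in symmetric order: [i = 2^k (2u + 1)] is at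
   level [k]. Its subtree is full if [i + 2^k <= N]; otherwise [i] is one of the at
   most one node per level ("top" nodes) on the right boundary of the tree. *)
Definition top i := N < i + 2 ^ level i.

(** Number of spills coming from a full subtree whose root has level [k - 1]; the value 1 at [k = 0]
    stands for an absent child. *)
Fixpoint full_spill k := if k is k'.+1 then spill_size (full_spill k' * full_spill k') else 1.

(** Number of spills coming from the part of the right boundary below level [k]. It changes only at
    the set bits of [N], which are the levels with a top node. *)
Fixpoint top_spill k :=
  if k is k'.+1 then
    if odd (N %/ 2 ^ k') then spill_size (full_spill k' * top_spill k') else top_spill k'
  else 1.

Definition slots k (t : bool) := full_spill k * (if t then top_spill k else full_spill k).

(** Words are stored level by level, so that an address costs one product. Level [k] has
    [N %/ 2 ^ k.+1] full nodes, followed by a top node if bit [k] of [N] is set. *)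
Fixpoint level_pos k :=
  if k is k'.+1 then
    level_pos k' + N %/ 2 ^ k'.+1 * word_bits (slots k' false)
      + odd (N %/ 2 ^ k') * word_bits (slots k' true)
  else 0.

Definition node_slots i := slots (level i) (top i).
Definition node_pos i := level_pos (level i) + rank_at i * word_bits (slots (level i) false).
Definition node_len i := word_bits (node_slots i).

(** Removing the lowest set bit of a top node gives the next higher node of the right boundary, or 0
    at the root. *)
Definition parent i :=
  if top i then i - 2 ^ level i
  else 2 ^ (level i).+2 * (i %/ 2 ^ (level i).+2) + 2 ^ (level i).+1.

Definition left_child i := i - 2 ^ (level i).-1.
(** The right boundary continues at the next lower set bit of [N], which is the leading bit of
    [N - i]. *)
Definition right_child i :=
  if top i then i + 2 ^ trunc_log 2 (N - i) else i + 2 ^ (level i).-1.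

Definition spill (x : nat -> nat) i := x i %/ content_size (node_slots i).

(** The reductions make the bound on the word unconditional. The spills of an absent child have
    universe 1, so it contributes 0 whatever number the child functions return. *)
Definition node_word (x : nat -> nat) i :=
  let k := level i in
  let Y := node_slots i in
  (spill x (left_child i) %% full_spill k
     + full_spill k * (spill x (right_child i) %% (Y %/ full_spill k)))
  * content_size Y + x i %% content_size Y.

Definition children_spills (rd : nat -> nat -> nat) i :=
  rd (node_pos i) (node_len i) %/ content_size (node_slots i).

Definition node_spill rd F H i :=
  let p := parent i in
  if p == 0 then F %% top_spill H
  else if i < p then children_spills rd p %% full_spill (level p)
  else children_spills rd p %/ full_spill (level p).

Definition tree_read rd F H i :=
  node_spill rd F H i * content_size (node_slots i)
  + rd (node_pos i) (node_len i) %% content_size (node_slots i).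

Hypothesis G_gt0 : 0 < G.

Lemma full_spill_gt0 k : 0 < full_spill k. Proof. by case: k. Qed.

Lemma top_spill_gt0 k : 0 < top_spill k.
Proof. by elim: k => //= k IH; case: ifP. Qed.

Lemma slots_gt0 k t : 0 < slots k t.
Proof. by rewrite muln_gt0 full_spill_gt0; case: t; rewrite ?top_spill_gt0 ?full_spill_gt0. Qed.

Lemma slots_le Y : Y * G <= 2 ^ word_bits Y.
Proof. exact: up_logP. Qed.

Lemma content_ge Y : 0 < Y -> G <= content_size Y.
Proof. by move=> Y_gt0; rewrite leq_divRL // mulnC slots_le. Qed.

Lemma node_slotsE i : node_slots i %/ full_spill (level i) =
  if top i then top_spill (level i) else full_spill (level i).
Proof. by rewrite mulKn ?full_spill_gt0. Qed.

Lemma node_word_lt x i : node_word x i < 2 ^ node_len i.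
Proof.
have Yk := full_spill_gt0 (level i); have Y_gt0 := slots_gt0 (level i) (top i).
rewrite /node_word -/(node_slots i) in Y_gt0 *.
set k := level i; set Y := node_slots i in Y_gt0 *.
have C_gt0 : 0 < content_size Y by apply: leq_trans (content_ge Y_gt0).
have YE : Y = full_spill k * (Y %/ full_spill k).
  by rewrite /Y /k node_slotsE.
have Z_gt0 : 0 < Y %/ full_spill k.
  by rewrite lt0n; apply: contraL Y_gt0 => /eqP Z0; rewrite YE Z0 muln0.
have h1 : spill x (left_child i) %% full_spill k < full_spill k by rewrite ltn_mod.
have h2 : spill x (right_child i) %% (Y %/ full_spill k) < Y %/ full_spill k.
  by rewrite ltn_mod.
have h3 : x i %% content_size Y < content_size Y by rewrite ltn_mod.
set a := spill _ _ %% _ in h1 *; set a' := spill _ _ %% (_ %/ _) in h2 *.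
apply: (@leq_trans (Y * content_size Y)); last by rewrite mulnC leq_divM.
apply: (@leq_trans ((a + full_spill k * a').+1 * content_size Y)).
  by rewrite mulSn; lia.
rewrite leq_mul2r; apply/orP; right; rewrite [X in _ < X]YE.
apply: (@leq_trans (full_spill k * a'.+1)); last by rewrite leq_mul2l h2 orbT.
by rewrite mulnS; lia.
Qed.

(** For a top node of level [k], [N] lies between [i] and [i + 2 ^ k - 1], so the bits of [N] from
    [k] upwards are those of [i]. *)
Lemma top_rank i : 0 < i <= N -> rank_at i <= N %/ 2 ^ (level i).+1 /\
  (top i = (rank_at i == N %/ 2 ^ (level i).+1)) /\
  (top i -> odd (N %/ 2 ^ level i)).
Proof.
case/andP => i_gt0 iN; have iE := level_rankE i_gt0.
set k := level i in iE *; set u := rank_at i in iE *.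
have b_gt0 : 0 < 2 ^ k by rewrite expn_gt0.
have uN : u <= N %/ 2 ^ k.+1.
  rewrite leq_divRL ?expn_gt0 // expnS; apply: leq_trans iN; rewrite iE.
  by rewrite -mul2n mulnS; lia.
have NE := divn_eq N (2 ^ k.+1); have Nr : N %% 2 ^ k.+1 < 2 ^ k.+1 by rewrite ltn_mod expn_gt0.
have topE : top i = (u == N %/ 2 ^ k.+1).
  rewrite /top -/k eqn_leq uN /= -[in RHS]ltnS ltn_divLR ?expn_gt0 // {1}iE.
  by congr (N < _); rewrite expnS -mul2n mulSn mulnS; lia.
split=> //; split=> //; rewrite topE => /eqP uE.
have : N %/ 2 ^ k = u.*2.+1.
  apply/eqP; rewrite eqn_leq leq_divRL // mulnC -iE iN andbT.
  rewrite -ltnS ltn_divLR // -doubleS -mul2n mulnC mulnA -expnSr.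
  by rewrite mulnC -ltn_divLR ?expn_gt0 // ltnS uE.
by move=> ->; rewrite /= odd_double.
Qed.

Lemma node_range i : 0 < i <= N ->
  level_pos (level i) <= node_pos i /\ node_pos i + node_len i <= level_pos (level i).+1.
Proof.
move=> iN; have [uN [topE topO]] := top_rank iN.
rewrite /node_pos /node_len /node_slots; split; first exact: leq_addr.
rewrite [level_pos _.+1]/=; case: (boolP (top i)) => [ti|].
  rewrite topO // mul1n; move: ti; rewrite topE => /eqP ->; lia.
rewrite topE => ne; have : rank_at i < N %/ 2 ^ (level i).+1 by rewrite ltn_neqAle ne.
set w := word_bits (slots _ _); set U := N %/ _ => uU.
have : (rank_at i).+1 * w <= U * w by rewrite leq_mul2r uU orbT.
rewrite mulSn; lia.
Qed.

Lemma level_pos_mono k k' : k <= k' -> level_pos k <= level_pos k'.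
Proof.
move=> /subnKC <-; elim: (k' - k) => [|m IH]; first by rewrite addn0.
rewrite addnS /= -addnA; by apply: leq_trans IH (leq_addr _ _).
Qed.

Lemma node_disjoint i j p : 0 < i <= N -> 0 < j <= N ->
  node_pos i <= p < node_pos i + node_len i ->
  node_pos j <= p < node_pos j + node_len j -> i = j.
Proof.
move=> iN jN pi pj.
have [li ri] := node_range iN; have [lj rj] := node_range jN.
have ij : level i = level j.
  case: (ltngtP (level i) (level j)) => // /level_pos_mono; lia.
have [ui [topi _]] := top_rank iN; have [uj [topj _]] := top_rank jN.
suff uij : rank_at i = rank_at j.
  have [i_gt0 j_gt0] : 0 < i /\ 0 < j by lia.
  by rewrite [LHS]level_rankE // [RHS]level_rankE // uij ij.
move: pi pj; rewrite /node_pos /node_len /node_slots topi topj ij.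
rewrite ij in ui topi; set w := word_bits (slots _ false).
have aux a c n U : a < c -> c <= U -> level_pos (level j) + c * w <= n ->
    n < level_pos (level j) + a * w + word_bits (slots (level j) (a == U)) -> False.
  move=> ac cU; rewrite (_ : (a == U) = false) -/w; last by lia.
  have : a.+1 * w <= c * w by rewrite leq_mul2r ac orbT.
  rewrite mulSn; lia.
case: (ltngtP (rank_at i) (rank_at j)) => // lt /andP[h1 h2] /andP[h3 h4].
  by case: (aux _ _ _ _ lt uj h3 h2).
by case: (aux _ _ _ _ lt ui h1 h4).
Qed.

Lemma level_lt i H : 0 < i <= N -> N < 2 ^ H -> level i < H.
Proof.
case/andP=> i_gt0 iN NH; rewrite -(ltn_exp2l _ _ (isT : 1 < 2)).
by apply: leq_ltn_trans NH; apply: leq_trans iN; rewrite dvdn_leq // pfactor_dvdnn.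
Qed.

Lemma node_le i H : 0 < i <= N -> N < 2 ^ H -> node_pos i + node_len i <= level_pos H.
Proof.
move=> iN NH; have [_ h] := node_range iN; apply: leq_trans h _.
by apply: level_pos_mono; exact: level_lt NH.
Qed.

Lemma top_spill_gap k k' : k <= k' ->
  (forall j, k <= j < k' -> ~~ odd (N %/ 2 ^ j)) -> top_spill k' = top_spill k.
Proof.
move=> /subnKC <-; elim: (k' - k) => [|m IH] h; first by rewrite addn0.
have hm : ~~ odd (N %/ 2 ^ (k + m)) by apply: h; lia.
by rewrite addnS /= (negPf hm); apply: IH => j jlt; apply: h; lia.
Qed.

Lemma parent_full i : 0 < i -> ~~ top i ->
  parent i = 2 ^ (level i).+1 * ((rank_at i)./2).*2.+1.
Proof.
move=> i_gt0 /negPf nt; rewrite /parent nt.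
have -> : i %/ 2 ^ (level i).+2 = (rank_at i)./2.
  by rewrite expnSr divnMA divn2.
by rewrite -mul2n mulnS mulnA -expnSr addnC.
Qed.

Lemma parent_full_level i : 0 < i -> ~~ top i -> level (parent i) = (level i).+1.
Proof. by move=> i_gt0 nt; rewrite parent_full // level_odd. Qed.

Lemma parent_fullE i : 0 < i -> ~~ top i ->
  parent i = if odd (rank_at i) then i - 2 ^ level i else i + 2 ^ level i.
Proof.
move=> i_gt0 nt; rewrite parent_full // expnS.
move: (2 ^ level i) (rank_at i) (level_rankE i_gt0) => c u ->.
have := odd_double_half u; move: (u./2) => h; case: (odd u) => <-; rewrite -!mul2n /=; lia.
Qed.

Lemma left_parent i : 0 < i <= N -> 0 < parent i -> i < parent i ->
  [/\ parent i <= N, left_child (parent i) = i &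
      full_spill (level (parent i)) = spill_size (node_slots i)].
Proof.
move=> iN; have i_gt0 : 0 < i by lia.
case: (boolP (top i)) => [ti|nt]; first by rewrite /parent ti; lia.
have := parent_fullE i_gt0 nt; rewrite /left_child parent_full_level //.
case: odd => -> _; first lia.
move=> _; rewrite /= addnK; split=> //; first by rewrite leqNgt.
by rewrite /node_slots /slots (negPf nt).
Qed.

(** On the right boundary, the bits of [N] strictly between the level of [i] and that of its parent
    vanish, so [top_spill] is constant there. *)
Lemma right_parent i : 0 < i <= N -> 0 < parent i -> parent i <= i ->
  [/\ parent i <= N, right_child (parent i) = i &
      node_slots (parent i) %/ full_spill (level (parent i)) = spill_size (node_slots i)].
Proof.
move=> iN; have i_gt0 : 0 < i by lia.
rewrite node_slotsE; case: (boolP (top i)) => [ti|nt]; last first.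
  have b_gt0 : 0 < 2 ^ level i by rewrite expn_gt0.
  have := parent_fullE i_gt0 nt; case: odd => pE; last lia.
  move=> p_gt0 _; have np : top (parent i) = false.
    rewrite /top parent_full_level // pE expnS; move: nt; rewrite /top; lia.
  rewrite /right_child np parent_full_level //= pE; split; try lia.
  by rewrite /node_slots /slots (negPf nt).
rewrite /parent ti => p_gt0 _; set p := i - _ in p_gt0 *.
have [_ [topE topO]] := top_rank iN; have Nk := topO ti.
set k := level i in p topE Nk p_gt0 *; have b_gt0 : 0 < 2 ^ k by rewrite expn_gt0.
have iE := level_rankE i_gt0; rewrite -/k in iE.
move: topE; rewrite ti => /esym/eqP uE.
have NE : N %/ 2 ^ k = (rank_at i).*2.+1.
  by rewrite uE expnSr divnMA divn2 -[LHS]odd_double_half Nk.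
have Nr := divn_eq N (2 ^ k); have Nlt : N %% 2 ^ k < 2 ^ k by rewrite ltn_mod.
have iNE : N = i + N %% 2 ^ k by rewrite {1}Nr NE mulnC -iE.
have pE : p = 2 ^ k.+1 * rank_at i.
  by rewrite /p {1}iE mulnS -mul2n mulnA -expnSr addKn.
have u_gt0 : 0 < rank_at i by move: p_gt0; rewrite pE; case: rank_at => //; rewrite muln0.
have [k' kE] : exists m, level p = k.+1 + m /\ level (rank_at i) = m.
  by exists (level (rank_at i)); rewrite pE /level lognM ?expn_gt0 // pfactorK.
case: kE => lp lu.
have pN : 0 < p <= N by lia.
have tp : top p.
  rewrite /top lp expnD.
  have : 1 <= 2 ^ k' by rewrite expn_gt0.
  have : 2 ^ k.+1 * 1 <= 2 ^ k.+1 * 2 ^ k' by rewrite leq_mul2l expn_gt0 orbT.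
  by rewrite muln1 {1}expnS /p; lia.
rewrite /right_child tp; split; first lia.
  rewrite (_ : N - p = 2 ^ k + N %% 2 ^ k); last by rewrite /p; lia.
  rewrite (trunc_log_eq (n := k)) //; first by rewrite subnK // /p; lia.
  by rewrite leq_addr /= expnS; lia.
rewrite (@top_spill_gap k.+1) /node_slots /slots ?ti //= ?Nk // lp ?leq_addr // => j.
case/andP=> kj jk.
have -> : N %/ 2 ^ j = rank_at i %/ 2 ^ (j - k.+1).
  by rewrite uE -divnMA -expnD subnKC.
rewrite (level_rankE u_gt0) lu -(subnK (_ : (j - k.+1).+1 <= k')); last by lia.
rewrite expnD expnS -mulnA mulnCA -mulnA mulnCA mulKn ?expn_gt0 //.
by rewrite !oddM.
Qed.

Lemma spill_lt x i : x i < X -> spill x i < spill_size (node_slots i).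
Proof. by move=> xX; rewrite ltnS leq_div2r // ltnW. Qed.

Lemma tree_readP x rd F H i : (forall i, x i < X) -> N < 2 ^ H ->
  (forall i, 0 < i <= N -> rd (node_pos i) (node_len i) = node_word x i) ->
  F %% top_spill H = spill x (2 ^ trunc_log 2 N) ->
  0 < i <= N -> tree_read rd F H i = x i.
Proof.
move=> xX NH rdE FE iN; have i_gt0 : 0 < i by lia.
have C_gt0 j : 0 < content_size (node_slots j).
  by apply: leq_trans (content_ge _) => //; apply: slots_gt0.
have lowE : node_word x i %% content_size (node_slots i) = x i %% content_size (node_slots i).
  by rewrite modnMDl modn_mod.
rewrite /tree_read rdE // lowE [RHS](divn_eq _ (content_size (node_slots i))).
congr (_ * _ + _); rewrite -/(spill x i).
have csE p : 0 < p <= N -> children_spills rd p =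
    spill x (left_child p) %% full_spill (level p)
     + full_spill (level p) *
       (spill x (right_child p) %% (node_slots p %/ full_spill (level p))).
  move=> pN; rewrite /children_spills rdE // divnMDl // [x p %% _ %/ _]divn_small ?addn0 //.
  by rewrite ltn_mod.
(* Without a parent, [i] is the largest power of 2 up to [N], and its spill is in the final
   field. *)
rewrite /node_spill; case: eqP => [p0|/eqP p0].
  rewrite FE; congr spill; move: p0; rewrite /parent; case: ifP => ti; last first.
    by move/eqP; rewrite addn_eq0 !expn_eq0 andbF.
  move=> /eqP; rewrite subn_eq0 => ik; have iE := level_rankE i_gt0.
  have {}iE : i = 2 ^ level i.
    by apply/eqP; rewrite eqn_leq ik /= {2}iE leq_pmulr.
  rewrite [RHS]iE; congr (2 ^ _); apply: trunc_log_eq => //; apply/andP; split; first lia.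
  by move: ti; rewrite /top expnS; lia.
case: (ltnP i (parent i)) => [ip|pi].
  have [|pN lc fs] := left_parent iN _ ip; first by rewrite lt0n.
  rewrite csE ?lc ?fs ?lt0n ?p0 ?pN // addnC mulnC modnMDl modn_mod.
  by rewrite modn_small // spill_lt.
have [|pN rc fs] := right_parent iN _ pi; first by rewrite lt0n.
have fs_gt0 := full_spill_gt0 (level (parent i)).
rewrite csE ?rc ?fs ?lt0n ?p0 ?pN // addnC mulnC divnMDl //.
rewrite [_ %/ full_spill _]divn_small ?ltn_mod // addn0.
by rewrite modn_small // spill_lt.
Qed.

Lemma root_spill_lt x H : (forall i, x i < X) -> N < 2 ^ H -> 0 < N ->
  spill x (2 ^ trunc_log 2 N) < top_spill H.
Proof.
move=> xX NH N_gt0; set k := trunc_log 2 N.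
have [kN Nk] : 2 ^ k <= N /\ N < 2 ^ k.+1 by split; [exact: trunc_logP | exact: trunc_log_ltn].
have lk : level (2 ^ k) = k by rewrite /level pfactorK.
have iN : 0 < 2 ^ k <= N by rewrite expn_gt0.
have tk : top (2 ^ k) by rewrite /top lk addnn -mul2n -expnS.
have [_ [_ /(_ tk)]] := top_rank iN; rewrite lk => Nodd.
rewrite (@top_spill_gap k.+1 H) => [||j /andP[kj _]].
- rewrite /= Nodd; apply: leq_trans (spill_lt _) _ => //.
  by rewrite /node_slots lk tk.
- by rewrite -(ltn_exp2l _ _ (isT : 1 < 2)); apply: leq_ltn_trans NH.
- by rewrite divn_small // (leq_trans Nk) // leq_exp2l.
Qed.

Hypothesis X_ge : 2 * G * G <= X.

Lemma content_le Y : 0 < Y -> content_size Y <= 2 * G.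
Proof.
move=> Y_gt0; rewrite -ltnS ltn_divLR //; apply: leq_trans (up_log_lt _) _.
  by rewrite muln_gt0 Y_gt0.
by rewrite mulSn; lia.
Qed.

(** Two roundings cost a factor [1 + 1/G] each. With [C] the content size, there are at most
    [X / C + 1] spills, where [G * C <= X], and the word has at most [Y * (C + 1)] values, where
    [G <= C]. *)
Lemma node_cost Y : 0 < Y ->
  spill_size Y * 2 ^ word_bits Y * (G * G) <= Y * X * (G.+1 * G.+1).
Proof.
move=> Y_gt0; have GC := content_ge Y_gt0.
have C_gt0 := leq_trans G_gt0 GC.
have C2 := content_le Y_gt0.
have SC : spill_size Y * content_size Y <= X + content_size Y.
  by rewrite mulSn addnC leq_add2r leq_divM.
have MC : 2 ^ word_bits Y <= Y * (content_size Y).+1.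
  by rewrite mulnC ltnW // -ltn_divLR.
move: (content_size Y) (spill_size Y) (2 ^ word_bits Y) GC C_gt0 C2 SC MC.
move=> C S W GC C_gt0 C2 SC MC.
have GX : G * C <= X by apply: leq_trans X_ge; rewrite mulnC leq_mul2r C2 orbT.
rewrite -(leq_pmul2r C_gt0).
have h1 : G * (S * C) <= G.+1 * X.
  by apply: leq_trans (_ : G * (X + C) <= _); rewrite ?leq_mul2l ?SC ?orbT // mulnDr mulSn; lia.
have h2 : G * W <= Y * C * G.+1.
  apply: leq_trans (_ : G * (Y * C.+1) <= _); rewrite ?leq_mul2l ?MC ?orbT //.
  rewrite -mulnA mulnCA leq_mul2l; apply/orP; right; rewrite !mulnS [C * G]mulnC; lia.
have := leq_mul h1 h2.
have -> : G * (S * C) * (G * W) = S * W * (G * G) * C by lia.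
by have -> : G.+1 * X * (Y * C * G.+1) = Y * X * (G.+1 * G.+1) * C by lia.
Qed.

(** A potential argument over the levels: the number of states of the words stored so far times the
    number of combinations of spills not yet stored. *)
Lemma tree_cost H : N < 2 ^ H ->
  2 ^ level_pos H * top_spill H * (G * G) ^ N <= (X * (G.+1 * G.+1)) ^ N.
Proof.
move=> NH; set Z := X * (G.+1 * G.+1).
have cost Y : 0 < Y -> spill_size Y * 2 ^ word_bits Y * (G * G) <= Y * Z.
  by rewrite /Z [Y * _]mulnA; exact: node_cost.
(* [N - N %/ 2 ^ k] nodes have level below [k]. They leave [N %/ 2 ^ k] spills of full subtrees and
   one of the right boundary to be stored higher up. *)
have inv k : 2 ^ level_pos k * full_spill k ^ (N %/ 2 ^ k) * top_spill k
    * (G * G) ^ (N - N %/ 2 ^ k) <= Z ^ (N - N %/ 2 ^ k).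
  elim: k => [|k IH]; first by rewrite expn0 divn1 subnn exp1n.
  have Uk : N %/ 2 ^ k = odd (N %/ 2 ^ k) + 2 * (N %/ 2 ^ k.+1).
    by rewrite expnSr divnMA divn2 mul2n odd_double_half.
  set U := N %/ 2 ^ k in IH Uk *; set V := N %/ 2 ^ k.+1 in Uk *.
  have UN : U <= N by apply: leq_div.
  have -> : N - V = (N - U) + (V + odd U) by lia.
  have -> : level_pos k.+1 = level_pos k + V * word_bits (slots k false)
    + odd U * word_bits (slots k true) by [].
  have -> : full_spill k.+1 = spill_size (full_spill k * full_spill k) by [].
  have -> : top_spill k.+1 = if odd U then spill_size (full_spill k * top_spill k)
    else top_spill k by [].
  rewrite !expnD; set f := full_spill k in IH *; set t := top_spill k in IH *.
  have cf : (spill_size (f * f) * 2 ^ word_bits (f * f) * (G * G)) ^ V <= (f * f * Z) ^ V.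
    by case: (V) => // V'; rewrite leq_exp2r // cost // muln_gt0 full_spill_gt0.
  have ct : (if odd U then spill_size (f * t) else t) * 2 ^ (odd U * word_bits (slots k true))
      * (G * G) ^ odd U <= f ^ odd U * t * Z ^ odd U.
    case: (odd U); last by rewrite !muln1 mul1n.
    rewrite !expn1 mul1n; apply: cost.
    by rewrite muln_gt0 full_spill_gt0 top_spill_gt0.
  (* Multiplies the three bounds and cancels the spills consumed at this level. *)
  have aux A F x g z S1 W1 g1 z1 f1 tt W2 g2 f2 z2 : F = f2 * (f1 * f1) -> 0 < F * x ->
      A * F * x * g <= z -> S1 * W1 * g1 <= f1 * f1 * z1 -> tt * W2 * g2 <= f2 * x * z2 ->
      A * W1 * W2 * S1 * tt * (g * (g1 * g2)) <= z * (z1 * z2).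
    move=> FE Fx h1 h2 h3; rewrite -(leq_pmul2r Fx).
    have := leq_mul h1 (leq_mul h2 h3).
    have -> : A * F * x * g * (S1 * W1 * g1 * (tt * W2 * g2)) =
      A * W1 * W2 * S1 * tt * (g * (g1 * g2)) * (F * x) by lia.
    by have -> : z * (f1 * f1 * z1 * (f2 * x * z2)) = z * (z1 * z2) * (F * x) by rewrite FE; lia.
  rewrite [V * _]mulnC (expnM 2 _ V); apply: (aux _ _ _ _ _ _ _ _ _ (f ^ V) _ _ _ _ _ _ _ IH _ ct).
  - by rewrite -!expnD; congr (f ^ _); rewrite {1}Uk; lia.
  - by rewrite muln_gt0 expn_gt0 full_spill_gt0 top_spill_gt0.
  - by rewrite -!expnMn.
have := inv H; rewrite divn_small // subn0 expn0 muln1; exact.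
Qed.

Hypothesis G_gt1 : 1 < G.

Lemma spill_size_le Y : 0 < Y -> spill_size Y <= X.
Proof.
move=> Y_gt0; have X_gt1 : 1 < X by apply: leq_trans X_ge; lia.
apply: (@leq_trans (X %/ 2).+1); last by have := divn_eq X 2; lia.
by rewrite ltnS leq_div2l // (leq_trans G_gt1) // content_ge.
Qed.

Lemma full_spill_le k : full_spill k <= X.
Proof.
case: k => [|k]; first by apply: leq_trans X_ge; rewrite !muln_gt0 G_gt0.
by apply: spill_size_le; rewrite muln_gt0 full_spill_gt0.
Qed.

Lemma top_spill_le k : top_spill k <= X.
Proof.
elim: k => [|k IH]; first exact: (full_spill_le 0).
rewrite /=; case: ifP => // _.
by apply: spill_size_le; rewrite muln_gt0 full_spill_gt0 top_spill_gt0.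
Qed.

Lemma word_bits_le k t : 2 ^ word_bits (slots k t) <= 2 * (X * X * G).
Proof.
apply: leq_trans (ltnW (up_log_lt _)) _; first by rewrite muln_gt0 slots_gt0.
rewrite leq_mul2l leq_mul2r; apply/orP; right; apply/orP; right.
by apply: leq_mul; rewrite ?full_spill_le //; case: t; rewrite ?top_spill_le ?full_spill_le.
Qed.

End SpillTree.

(** * The encoding *)

(** A form of Bernoulli's inequality gives [(1 + 1/G) ^ m * (1 - m/G) <= 1], and [1 - m/G] is at
    least one half. *)
Lemma expn_succ_le G m : 2 * m <= G -> G.+1 ^ m <= 2 * G ^ m.
Proof.
move=> mG; have : G.+1 ^ m * (G - m) <= G ^ m * G.
  have : m <= G by lia.
  elim: {mG}m => [|m IH] mG; first by rewrite subn0.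
  have {}IH := IH (ltnW mG); rewrite !expnS.
  have step : G.+1 * (G - m.+1) <= G * (G - m).
    have [m' ->] : exists m', G = m.+1 + m' by exists (G - m.+1); lia.
    have -> : m.+1 + m' - m.+1 = m' by lia.
    have -> : m.+1 + m' - m = m'.+1 by lia.
    by rewrite mulSn mulnS; lia.
  apply: (@leq_trans (G * (G.+1 ^ m * (G - m)))).
    by rewrite mulnAC [_ ^ _ * (G - m)]mulnC mulnA leq_mul2r step orbT.
  by rewrite -mulnA leq_mul2l IH orbT.
have [G0|G_gt0] := posnP G; first by move: mG; rewrite G0; case: (m).
move=> h; rewrite -(leq_pmul2r G_gt0).
have h2 : G.+1 ^ m * G <= G.+1 ^ m * (2 * (G - m)) by rewrite leq_mul2l; apply/orP; right; lia.
by lia.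
Qed.

Fixpoint read_fields w (fs : seq (nat * nat)) : cp_algo (seq nat) :=
  if fs is f :: fs' then
    cp_bind (read_field w f.1 f.2) (fun x => cp_bind (read_fields w fs') (fun xs => Answer (x :: xs)))
  else Answer [::].

Lemma read_fieldsP w mem fs : 0 < w ->
  cp_run (cell w mem) (read_fields w fs) =
  ([seq bitsval (nth false mem) f.1 f.2 | f <- fs], \sum_(f <- fs) (f.2 %/ w).+2).
Proof.
move=> w_gt0; elim: fs => [|f fs IH]; first by rewrite big_nil.
rewrite (_ : read_fields w (f :: fs) = cp_bind (read_field w f.1 f.2)
  (fun x => cp_bind (read_fields w fs) (fun xs => Answer (x :: xs)))) //.
rewrite (cp_run_bind _ (read_field _ _ _)) (cp_run_bind _ (read_fields _ _)).
by rewrite read_fieldP // IH big_cons /= addn0.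
Qed.

Section Encoding.
Variables (T : finType) (e : rel T) (d : nat) (x0 : T).
Variables (n ell b D G X H : nat).
Local Notation tau := #|T|.
Local Notation nw := (nw e).

Definition blocks := n %/ ell.
Definition tail := n %% ell.
Local Notation N := blocks.

(** The spill of the root and the code of the partial block share a field, so that rounding to whole
    bits is paid once for both. *)
Definition final_size := top_spill N X G H * (tau * d ^ tail).
Definition final_bits := up_log 2 final_size.
Definition final_pos := level_pos N X G H.

Definition vtx r := nth x0 (enum T) r.

Lemma vtxK v : vtx (enum_rank v) = v.
Proof. by rewrite /vtx nth_enum_rank. Qed.

Definition element (rd : nat -> nat -> nat) i :=
  let F := rd final_pos final_bits in
  if N < i then F %/ top_spill N X G H else tree_read N X G rd F H i.

Definition piece_start (rd : nat -> nat -> nat) i := vtx (element rd i.+1 %% tau).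

Definition answer (rd : nat -> nat -> nat) q :=
  let i := q.-1 %/ ell in
  let z := q.-1 %% ell in
  let a := piece_start rd i in
  let j := element rd i.+1 %/ tau in
  if q == 0 then a
  else if i < N then piece_get e b D ell a (Some (piece_start rd i.+1)) j z
  else piece_get e b D tail a None j z.

Definition element_fields i :=
  let final := (final_pos, final_bits) in
  let node i := (node_pos N X G i, node_len N X G i) in
  let p := parent N i in
  if N < i then [:: final]
  else [:: final; node i; if p == 0 then final else node p].

Definition answer_fields q :=
  let i := q.-1 %/ ell in element_fields i.+1 ++ element_fields i.+2.

Lemma element_ext rd rd' i :
  (forall f, f \in element_fields i -> rd f.1 f.2 = rd' f.1 f.2) ->
  element rd i = element rd' i.
Proof.
rewrite /element_fields /element; case: ifP => _ rdE.
  by rewrite (rdE (final_pos, final_bits)) ?inE ?eqxx.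
rewrite (rdE (final_pos, final_bits)) ?inE ?eqxx //=.
rewrite /tree_read (rdE (node_pos N X G i, node_len N X G i)) ?inE ?eqxx ?orbT //=.
congr (_ * _ + _); rewrite /node_spill /children_spills; case: eqP => // p0.
have p0' : (parent N i == 0) = false by apply/eqP.
rewrite p0' in rdE.
by rewrite (rdE (node_pos N X G (parent N i), node_len N X G (parent N i))) // !inE eqxx !orbT.
Qed.

Lemma answer_ext rd rd' q :
  (forall f, f \in answer_fields q -> rd f.1 f.2 = rd' f.1 f.2) ->
  answer rd q = answer rd' q.
Proof.
rewrite /answer_fields /answer /piece_start => rdE.
rewrite !(@element_ext rd rd') // => f fP; apply: rdE; rewrite mem_cat fP ?orbT //.
Qed.

(** The fields to read depend on [q] only, so all are read beforehand and [answer] runs on the list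
    of results. *)
Definition answer_algo w q : cp_algo T :=
  cp_bind (read_fields w (answer_fields q)) (fun xs =>
    Answer (answer (fun p l => nth 0 xs (index (p, l) (answer_fields q))) q)).

Lemma answer_algoP w mem q : 0 < w ->
  cp_run (cell w mem) (answer_algo w q) =
  (answer (bitsval (nth false mem)) q, \sum_(f <- answer_fields q) (f.2 %/ w).+2).
Proof.
move=> w_gt0; rewrite /answer_algo cp_run_bind read_fieldsP //= addn0; congr (_, _).
apply: answer_ext => f fP; rewrite (nth_map (0, 0)) ?index_mem -?surjective_pairing //.
by rewrite nth_index.
Qed.

Lemma size_answer_fields q : size (answer_fields q) <= 6.
Proof. by rewrite size_cat /element_fields; do !case: ifP => _. Qed.

Hypothesis b_gt0 : 0 < b.
Hypothesis ell_gt0 : 0 < ell.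
Hypothesis ell_le : ell <= b ^ D.
Hypothesis D_gt0 : 0 < D.
Hypothesis reg : regular_graph e d.
Hypothesis X_gt0 : 0 < X.
Hypothesis X_piece : forall a c, tau * nw ell a (pred1 c) <= X.
Hypothesis N_lt : N < 2 ^ H.
Hypothesis G_gt0 : 0 < G.

Lemma block_value_lt (v : T) j k m : j < k -> tau * k <= m -> enum_rank v + tau * j < m.
Proof.
move=> jk; apply: leq_trans; apply: (@leq_trans (tau * j.+1)).
  by rewrite mulnS -addSn leq_add2r ltn_ord.
by rewrite leq_mul2l jk orbT.
Qed.

Lemma block_valueE (v : T) j :
  (enum_rank v + tau * j) %% tau = enum_rank v /\ (enum_rank v + tau * j) %/ tau = j.
Proof.
have h := ltn_ord (enum_rank v).
rewrite addnC mulnC modnMDl divnMDl; last by apply: leq_ltn_trans h.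
by rewrite modn_small // divn_small // addn0.
Qed.

Definition encodes (v : nat -> T) (x : nat -> nat) (y : nat) :=
  [/\ forall i, x i < X, y < tau * d ^ tail,
      forall i, i < N -> x i.+1 %% tau = enum_rank (v (i * ell)) /\
        forall z, z < ell ->
          piece_ok e b D ell (v (i * ell)) (Some (v (i.+1 * ell))) (x i.+1 %/ tau) z /\
          piece_get e b D ell (v (i * ell)) (Some (v (i.+1 * ell))) (x i.+1 %/ tau) z
          = v (i * ell + z).+1
    & y %% tau = enum_rank (v (N * ell)) /\
        forall z, z < tail ->
          piece_ok e b D tail (v (N * ell)) None (y %/ tau) z /\
          piece_get e b D tail (v (N * ell)) None (y %/ tau) z = v (N * ell + z).+1].

Lemma encodes_exists v : (forall i, i < n -> e (v i) (v i.+1)) ->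
  exists xy, encodes v xy.1 xy.2.
Proof.
move=> ev; have nE := divn_eq n ell; rewrite -/N -/tail in nE.
have /choice[x xP] i : exists x, x < X /\ forall i', i = i'.+1 -> i' < N ->
    x %% tau = enum_rank (v (i' * ell)) /\
    forall z, z < ell ->
      piece_ok e b D ell (v (i' * ell)) (Some (v (i'.+1 * ell))) (x %/ tau) z /\
      piece_get e b D ell (v (i' * ell)) (Some (v (i'.+1 * ell))) (x %/ tau) z
      = v (i' * ell + z).+1.
  case: i => [|i]; first by exists 0.
  have [iN|] := ltnP i N; last by exists 0; split=> // i' [<-]; lia.
  have iell : i * ell + ell <= n.
    by rewrite nE addnC -mulSn; apply: leq_trans (leq_addr _ _); rewrite leq_mul2r iN orbT.
  have [|||j jlt jE] := piece_codes (e := e) b_gt0 ell_le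
      (v := fun k => v (i * ell + k)) (oa := Some (v (i.+1 * ell))).
  - by rewrite orbT.
  - by move=> k kl; rewrite addnS; apply: ev; lia.
  - by rewrite /= mulSn addnC.
  rewrite addn0 in jlt jE.
  exists (enum_rank (v (i * ell)) + tau * j); split.
    exact: block_value_lt jlt (X_piece _ _).
  move=> i' [<-] _; have [-> ->] := block_valueE (v (i * ell)) j; split=> // z zl.
  by have [? ->] := jE z zl; rewrite addnS.
have [||||j jlt jE] := piece_codes (e := e) b_gt0 (t := D) (L := tail)
      (v := fun k => v (N * ell + k)) (oa := None).
- by apply: leq_trans ell_le; rewrite ltnW // ltn_mod.
- by rewrite D_gt0.
- by move=> k kl; rewrite addnS; apply: ev; lia.
- by [].
rewrite addn0 in jlt jE; rewrite (nw_regular _ _ reg) in jlt.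
exists (x, enum_rank (v (N * ell)) + tau * j); split=> /=.
- by move=> i; have [] := xP i.
- exact: block_value_lt jlt (leqnn _).
- by move=> i iN; have [_ /(_ i erefl iN)] := xP i.+1.
- by have [-> ->] := block_valueE (v (N * ell)) j; split=> // z zl; have [? ->] := jE z zl; rewrite addnS.
Qed.

(** Nodes are numbered from 1, which leaves index 0 for the final field. *)
Definition field_pos (i : 'I_N.+1) :=
  if val i == 0 then final_pos else node_pos N X G i.
Definition field_len (i : 'I_N.+1) :=
  if val i == 0 then final_bits else node_len N X G i.
(** For [N = 0] there is no root; [top_spill] is then 1 and the reduced spill 0. *)
Definition final_value x y :=
  spill N X G x (2 ^ trunc_log 2 N) %% top_spill N X G H + top_spill N X G H * y.
Definition field_val x y (i : 'I_N.+1) :=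
  if val i == 0 then final_value x y else node_word N X G x i.

Definition memory x y : (final_pos + final_bits).-tuple bool :=
  layout field_pos field_len (field_val x y) (final_pos + final_bits).

Lemma final_value_lt x y : y < tau * d ^ tail -> final_value x y < 2 ^ final_bits.
Proof.
move=> y_lt; apply: leq_trans (up_logP _ _) => //; rewrite /final_size /final_value.
have t_gt0 : 0 < top_spill N X G H by exact: top_spill_gt0.
have := ltn_pmod (spill N X G x (2 ^ trunc_log 2 N)) t_gt0 => h.
apply: (@leq_trans (top_spill N X G H * y.+1)); first by rewrite mulnS; lia.
by rewrite leq_mul2l y_lt orbT.
Qed.

Lemma memoryP x y : y < tau * d ^ tail ->
  let rd := bitsval (nth false (memory x y)) in
  rd final_pos final_bits = final_value x y /\
  forall i, 0 < i <= N -> rd (node_pos N X G i) (node_len N X G i) = node_word N X G x i.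
Proof.
move=> y_lt rd.
have fields : forall i : 'I_N.+1,
    bitsval (nth false (memory x y)) (field_pos i) (field_len i) = field_val x y i.
  apply: layoutP => [i|i|i j p].
  - rewrite /field_val /field_len; case: eqP => _; first exact: final_value_lt.
    exact: node_word_lt.
  - rewrite /field_pos /field_len; case: eqP => // /eqP i0.
    apply: leq_trans (leq_addr _ _); apply: node_le => //.
    by rewrite lt0n i0 /= -ltnS.
  - rewrite /field_pos /field_len => pi pj; apply: val_inj => /=; move: pi pj.
    have lei (k : 'I_N.+1) : val k != 0 -> 0 < k <= N by rewrite lt0n => ->; rewrite -ltnS ltn_ord.
    case: eqP => [->|/eqP /lei iN]; case: eqP => [->|/eqP /lei jN] //.
    + have := node_le X G_gt0 jN N_lt; rewrite -/final_pos; lia.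
    + have := node_le X G_gt0 iN N_lt; rewrite -/final_pos; lia.
    + exact: node_disjoint.
split; first exact: (fields ord0).
move=> i /andP[i_gt0 iN]; have iN' : i < N.+1 by [].
by have := fields (Ordinal iN'); rewrite /field_pos /field_len /field_val /= eqn0Ngt i_gt0.
Qed.

Section Decoding.
Variables (v : nat -> T) (x : nat -> nat) (y : nat).
Hypothesis xyP : encodes v x y.
Local Notation rd := (bitsval (nth false (memory x y))).

(** The range goes one index beyond the partial block, because a query in that block still asks for
    the element after it; the value [y] is returned again. *)
Lemma elementE i : i <= N.+1 -> element rd i.+1 = if i < N then x i.+1 else y.
Proof.
case: (xyP) => xX yX xP _ iN; have [FE nodeE] := memoryP x yX.
have t_gt0 : 0 < top_spill N X G H by exact: top_spill_gt0.
rewrite /element FE ltnS leqNgt; case: ltnP => iN' /=.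
  have N_gt0 : 0 < N by lia.
  apply: (tree_readP G_gt0 xX N_lt nodeE) => //.
  by rewrite /final_value addnC mulnC modnMDl modn_mod modn_small ?root_spill_lt.
by rewrite /final_value addnC mulnC divnMDl // [_ %/ _]divn_small ?addn0 // ltn_mod.
Qed.

Lemma piece_startE i : i <= N -> piece_start rd i = v (i * ell).
Proof.
case: (xyP) => _ _ xP [y_start _] iN; rewrite /piece_start (elementE (leqW iN)).
case: ltnP => iN'; first by have [-> _] := xP i iN'; rewrite vtxK.
have -> : i = N by lia.
by rewrite y_start vtxK.
Qed.

Lemma query_block q : q <= n -> q.-1 %/ ell <= N.
Proof. by move=> qn; apply: leq_div2r; lia. Qed.

Lemma answerP q : q <= n ->
  answer rd q = v q /\
  (0 < q -> let i := q.-1 %/ ell in let j := element rd i.+1 %/ tau in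
   if i < N then piece_ok e b D ell (piece_start rd i) (Some (piece_start rd i.+1)) j (q.-1 %% ell)
   else piece_ok e b D tail (piece_start rd i) None j (q.-1 %% ell)).
Proof.
move=> qn; case: (xyP) => _ _ xP [_ y_code]; have iN := query_block qn.
have nE := divn_eq n ell; rewrite -/N -/tail in nE.
rewrite /answer; case: eqP => [->|q0]; first by rewrite div0n piece_startE // mul0n.
have qE : q = (q.-1 %/ ell * ell + q.-1 %% ell).+1 by rewrite -divn_eq; lia.
have zl : q.-1 %% ell < ell by rewrite ltn_mod.
rewrite /= (elementE (leqW iN)) piece_startE //; case: ltnP => iN'.
  rewrite piece_startE //; have [_ /(_ _ zl)[ok get]] := xP _ iN'.
  by rewrite get -qE.
have iE : q.-1 %/ ell = N by lia.
have zt : q.-1 %% ell < tail by move: qE; rewrite iE; lia.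
by move: qE; rewrite iE => qE; have [ok get] := y_code _ zt; rewrite get -qE.
Qed.

Lemma element_lt i : i <= N.+1 -> element rd i.+1 < maxn X (tau * d ^ tail).
Proof.
move=> iN; rewrite elementE //; case: (xyP) => xX yX _ _.
by case: ifP => _; rewrite leq_max ?xX ?yX ?orbT.
Qed.

End Decoding.

Hypothesis X_ge : 2 * G * G <= X.
Hypothesis X_le : X * G <= G.+1 * d ^ ell.
Hypothesis G_ge : 6 * N <= G.
Hypothesis d_gt0 : 0 < d.

(** Each block loses the factor [(G + 1) / G] three times, once in [X] and twice in its node, and
    [6 * N <= G] keeps the product of all losses at most 2. Rounding the final field up costs at
    most another factor 2. *)
Lemma memory_bits : 2 ^ (final_pos + final_bits) <= 8 * (tau * d ^ n).
Proof.
have nE := divn_eq n ell; rewrite -/N -/tail in nE.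
have cost := tree_cost G_gt0 X_ge N_lt; rewrite -/final_pos in cost.
have t_gt0 : 0 < top_spill N X G H by exact: top_spill_gt0.
have GN_gt0 : 0 < G ^ N by rewrite expn_gt0 G_gt0.
have dN_gt0 : 0 < d ^ n by rewrite expn_gt0 d_gt0.
have half : 2 ^ final_pos * top_spill N X G H <= 2 * (d ^ ell) ^ N.
  rewrite -(leq_pmul2r (_ : 0 < (G ^ N) * (G ^ N * G ^ N))); last by rewrite !muln_gt0 GN_gt0.
  have h1 : (X * G) ^ N <= (G.+1 * d ^ ell) ^ N by case: (N) => // N'; rewrite leq_exp2r.
  have h2 := @expn_succ_le G (3 * N) (_ : 2 * (3 * N) <= G).
  have {}h2 : G.+1 ^ N * (G.+1 ^ N * G.+1 ^ N) <= 2 * (G ^ N * (G ^ N * G ^ N)).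
    by rewrite -!expnD (_ : N + (N + N) = 3 * N); [apply: h2|]; lia.
  rewrite !expnMn in cost h1.
  move: cost h1 h2 GN_gt0; move: (G ^ N) (G.+1 ^ N) (X ^ N) ((d ^ ell) ^ N) => g g' x dd.
  move: (2 ^ final_pos) (top_spill _ _ _ _) => A t h0 h1 h2 g_gt0.
  apply: (@leq_trans (x * (g' * g') * g)).
    have -> : A * t * (g * (g * g)) = A * t * (g * g) * g by lia.
    by rewrite leq_mul2r h0 orbT.
  apply: (@leq_trans (g' * dd * (g' * g'))); first by rewrite mulnAC leq_mul2r h1 orbT.
  have -> : g' * dd * (g' * g') = g' * (g' * g') * dd by lia.
  have -> : 2 * dd * (g * (g * g)) = 2 * (g * (g * g)) * dd by lia.
  by rewrite leq_mul2r h2 orbT.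
have F_gt0 : 0 < final_size.
  by rewrite !muln_gt0 t_gt0 expn_gt0 d_gt0 andbT; apply/card_gt0P; exists x0.
have := up_log_lt F_gt0; rewrite -/final_bits expnD => h.
apply: (@leq_trans (2 ^ final_pos * (2 * final_size))); first by rewrite leq_mul2l ltnW ?orbT.
have -> : d ^ n = (d ^ ell) ^ N * d ^ tail by rewrite -expnM -expnD mulnC -nE.
rewrite /final_size.
have := leq_mul half (leqnn (tau * d ^ tail)).
move: (2 ^ final_pos) (top_spill _ _ _ _) (_ ^ N) (_ ^ tail) => A t dd dt; lia.
Qed.

Hypothesis G_gt1 : 1 < G.

Lemma final_bits_le : 2 ^ final_bits <= 2 * (X * (tau * d ^ ell)).
Proof.
have [F0|F_gt0] := posnP final_size.
  have tau_gt0 : 0 < tau by apply/card_gt0P; exists x0.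
  by rewrite /final_bits F0 up_log0 !muln_gt0 X_gt0 tau_gt0 expn_gt0 d_gt0.
apply: leq_trans (ltnW (up_log_lt F_gt0)) _; rewrite leq_mul2l /=; apply: leq_mul.
  exact: top_spill_le.
by rewrite leq_mul2l leq_pexp2l ?orbT // ltnW // ltn_mod.
Qed.

Lemma answer_fields_le L q f : 2 * (X * X * G) <= 2 ^ L ->
  2 * (X * (tau * d ^ ell)) <= 2 ^ L -> f \in answer_fields q -> f.2 <= L.
Proof.
move=> nodeL finalL; rewrite mem_cat.
have bits k t : word_bits G (slots N X G k t) <= L.
  rewrite -(leq_exp2l _ _ (isT : 1 < 2)); apply: leq_trans nodeL.
  exact: word_bits_le.
have fin : final_bits <= L.
  by rewrite -(leq_exp2l _ _ (isT : 1 < 2)); apply: leq_trans final_bits_le finalL.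
have elL i : f \in element_fields i -> f.2 <= L.
  rewrite /element_fields; case: ifP => _; first by rewrite inE => /eqP ->.
  rewrite !inE => /or3P[/eqP -> //|/eqP -> /=|]; first exact: bits.
  by case: ifP => _ /eqP -> //=; exact: bits.
by case/orP; exact: elL.
Qed.

Lemma encoding_exists : exists enc : n.+1.-tuple T -> (final_pos + final_bits).-tuple bool,
  forall v : n.+1.-tuple T, sorted e v ->
    exists x y, encodes (nth x0 v) x y /\ enc v = memory x y.
Proof.
have /choice[xy xyP] (v : n.+1.-tuple T) : exists xy,
    sorted e v -> encodes (nth x0 v) xy.1 xy.2.
  have [vs|] := boolP (sorted e v); last by exists (fun=> 0, 0).
  have [|xy xyP] := @encodes_exists (nth x0 v); last by exists xy.
  by move=> i i_n; apply: (sortedP x0 vs); rewrite size_tuple.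
exists (fun v => memory (xy v).1 (xy v).2) => v vs.
by exists (xy v).1, (xy v).2; split=> //; apply: xyP.
Qed.

Lemma cell_probe_bound w L (enc : n.+1.-tuple T -> (final_pos + final_bits).-tuple bool) :
  0 < w -> 2 * (X * X * G) <= 2 ^ L -> 2 * (X * (tau * d ^ ell)) <= 2 ^ L ->
  (forall v : n.+1.-tuple T, sorted e v ->
    exists x y, encodes (nth x0 v) x y /\ enc v = memory x y) ->
  cell_probe_retrieval e w (6 * (L %/ w).+2) enc.
Proof.
move=> w_gt0 nodeL finalL encP; exists (fun q => answer_algo w q) => v vs q.
rewrite answer_algoP //; split.
  change (answer (bitsval (nth false (enc v))) q = tnth v q).
  have [x [y [xyP ->]]] := encP v vs.
  by have [|-> _] := answerP xyP (q := q); rewrite ?(tnth_nth x0) // -ltnS.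
change (\sum_(f <- answer_fields q) (f.2 %/ w).+2 <= 6 * (L %/ w).+2).
apply: (@leq_trans (\sum_(f <- answer_fields q) (L %/ w).+2)).
  rewrite !big_seq; apply: leq_sum => f fP.
  by rewrite !ltnS leq_div2r // (answer_fields_le nodeL finalL fP).
by rewrite big_const_seq count_predT iter_addn_0 mulnC leq_mul2r size_answer_fields orbT.
Qed.

End Encoding.

(** * Word-RAM programs *)

Inductive cmd : Type :=
  | Block of seq instr
  | Seq of cmd & cmd
  | IfLt of nat & nat & cmd & cmd
  | WhileLt of nat & nat & cmd.

Fixpoint csize c :=
  match c with
  | Block s => size s
  | Seq c1 c2 => csize c1 + csize c2
  | IfLt _ _ c1 c2 => (csize c1 + csize c2).+2
  | WhileLt _ _ c1 => (csize c1).+3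
  end.

(** Jumps are absolute, so the load address [p] is a parameter. The else branch comes right after
    the test, which falls through to it. *)
Fixpoint compile p c : seq instr :=
  match c with
  | Block s => s
  | Seq c1 c2 => compile p c1 ++ compile (p + csize c1) c2
  | IfLt x y c1 c2 =>
      JumpLt x y (p + csize c2).+2 ::
      (compile p.+1 c2 ++ Jump (p + csize c2 + csize c1).+2 :: compile (p + csize c2).+2 c1)
  | WhileLt x y c1 =>
      [:: JumpLt x y p.+2, Jump (p + csize c1).+3 & rcons (compile p.+2 c1) (Jump p)]
  end.

Lemma size_compile p c : size (compile p c) = csize c.
Proof.
elim: c p => [s|c1 IH1 c2 IH2|x y c1 IH1 c2 IH2|x y c1 IH1] p //=.
- by rewrite size_cat IH1 IH2.
- by rewrite size_cat /= IH1 IH2 addnS addnC.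
- by rewrite size_rcons IH1.
Qed.

Definition code_at (P : seq instr) p (code : seq instr) :=
  forall j, j < size code -> p + j < size P /\ nth (Jump 0) P (p + j) = nth (Jump 0) code j.

Lemma code_at_self P : code_at P 0 P. Proof. by []. Qed.

Lemma code_at_cat P p s1 s2 :
  code_at P p (s1 ++ s2) -> code_at P p s1 /\ code_at P (p + size s1) s2.
Proof.
rewrite /code_at size_cat => h; split=> j jlt.
  by have := h j (ltn_addr _ jlt); rewrite nth_cat jlt.
have := h (size s1 + j); rewrite ltn_add2l => /(_ jlt).
rewrite addnA nth_cat; have -> : (size s1 + j < size s1) = false by lia.
by rewrite addKn.
Qed.

Lemma code_at_cons P p i s : code_at P p (i :: s) ->
  [/\ p < size P, nth (Jump 0) P p = i & code_at P p.+1 s].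
Proof.
move=> h; have [] := h 0 isT; rewrite addn0 => h1 h2; split=> // j jlt.
by have := h j.+1 jlt; rewrite addnS addSn.
Qed.

(** * Big-step semantics and time bounds *)

Section Execution.
Variables (w : nat) (data table : nat -> nat).

Definition straight i :=
  match i with Const _ _ | Op _ _ _ _ | ReadData _ _ | ReadTable _ _ => true | _ => false end.

Definition effect (R : nat -> nat) i :=
  match i with
  | Const x k => upd R x (k %% 2 ^ w)
  | Op op x y z => upd R x (eval_binop w op (R y) (R z))
  | ReadData x y => upd R x (data (R y))
  | ReadTable x y => upd R x (table (R y))
  | _ => R
  end.

(** The counts are exact and include the jumps inserted by [compile]. Only registers occur, as these
    programs leave the scratch memory alone. *)
Inductive big : cmd -> (nat -> nat) -> (nat -> nat) -> nat -> Prop :=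
  | BigBlock s R : all straight s -> big (Block s) R (foldl effect R s) (size s)
  | BigSeq c1 c2 R R1 R2 k1 k2 : big c1 R R1 k1 -> big c2 R1 R2 k2 ->
      big (Seq c1 c2) R R2 (k1 + k2)
  | BigThen x y c1 c2 R R1 k : R x < R y -> big c1 R R1 k -> big (IfLt x y c1 c2) R R1 k.+1
  | BigElse x y c1 c2 R R1 k : R y <= R x -> big c2 R R1 k -> big (IfLt x y c1 c2) R R1 k.+2
  | BigStop x y c R : R y <= R x -> big (WhileLt x y c) R R 2
  | BigLoop x y c R R1 R2 k1 k2 : R x < R y -> big c R R1 k1 ->
      big (WhileLt x y c) R1 R2 k2 -> big (WhileLt x y c) R R2 (k1 + k2).+2.

Local Notation step := (ram_step w data table).

Lemma ram_stepE P p R M i : p < size P -> nth (Jump 0) P p = i ->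
  step P (RamState p R M) = exec w data table i (RamState p R M).
Proof. by move=> pP iE; rewrite /ram_step /ram_halted /= leqNgt pP iE. Qed.

Lemma compileP c R R' k : big c R R' k -> forall P p M, code_at P p (compile p c) ->
  iter k (step P) (RamState p R M) = RamState (p + csize c) R' M.
Proof.
elim=> {c R R' k}.
- elim=> [|i s IH] R str P p M; first by rewrite addn0.
  case/code_at_cons => pP iE at_s; case/andP: str => str_i str_s.
  rewrite [csize _]/= -addSnnS -(IH _ str_s _ _ M at_s) iterSr; congr iter.
  by rewrite (ram_stepE _ _ pP iE); case: (i) str_i.
- move=> c1 c2 R R1 R2 k1 k2 _ IH1 _ IH2 P p M; rewrite [compile _ _]/= => /code_at_cat[].
  rewrite size_compile => at1 at2.
  by rewrite addnC iterD (IH1 _ _ _ at1) (IH2 _ _ _ at2) addnA.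
- move=> x y c1 c2 R R1 k lt _ IH P p M; rewrite [compile _ _]/=.
  case/code_at_cons=> pP iE /code_at_cat[_]; rewrite size_compile => /code_at_cons[_ _].
  have -> : (p.+1 + csize c2).+1 = (p + csize c2).+2 by lia.
  move=> at1; rewrite iterSr (ram_stepE _ _ pP iE) /= lt (IH _ _ _ at1).
  by congr RamState; lia.
- move=> x y c1 c2 R R1 k le _ IH P p M; rewrite [compile _ _]/=.
  case/code_at_cons=> pP iE /code_at_cat[at2]; rewrite size_compile => /code_at_cons[jP jE _].
  rewrite iterSr (ram_stepE _ _ pP iE) [exec _ _ _ _ _]/= ltnNge le /=.
  rewrite (IH _ _ _ at2) (ram_stepE _ _ jP jE) /=.
  by congr RamState; lia.
- move=> x y c R le P p M; rewrite [compile _ _]/=.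
  case/code_at_cons=> pP iE /code_at_cons[jP jE _].
  rewrite /= (ram_stepE _ _ pP iE) /= ltnNge le /= (ram_stepE _ _ jP jE) /=.
  by congr RamState; lia.
- move=> x y c R R1 R2 k1 k2 lt _ IH1 _ IH2 P p M at_w.
  have := at_w; rewrite [compile _ _]/=.
  case/code_at_cons=> pP iE /code_at_cons[_ _]; rewrite -cats1 => /code_at_cat[at1].
  rewrite size_compile => /code_at_cons[jP jE _].
  have -> : (k1 + k2).+2 = k2 + (k1.+1).+1 by lia.
  rewrite iterD iterSr (ram_stepE _ _ pP iE) [exec _ _ _ _ _]/= lt.
  by rewrite iterS (IH1 _ _ _ at1) (ram_stepE _ _ jP jE) /= (IH2 _ _ _ at_w).
Qed.

(** Termination within [k] instructions in registers satisfying [Q]. An upper bound, rather than the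
    exact count, lets branches of different lengths be joined. *)
Definition wp c R k (Q : (nat -> nat) -> Prop) := exists R' n, [/\ big c R R' n, n <= k & Q R'].

Definition runs s R (Q : (nat -> nat) -> Prop) := Q (foldl effect R s).

Lemma wp_block s R k Q : all straight s -> size s <= k -> runs s R Q -> wp (Block s) R k Q.
Proof. by move=> str sk QR; exists (foldl effect R s), (size s); split=> //; constructor. Qed.

Lemma wp_seq c1 c2 R k1 k2 k Q : k1 + k2 <= k ->
  wp c1 R k1 (fun R1 => wp c2 R1 k2 Q) -> wp (Seq c1 c2) R k Q.
Proof.
move=> kk [R1 [n1 [b1 n1k [R2 [n2 [b2 n2k QR]]]]]]; exists R2, (n1 + n2); split=> //.
  exact: BigSeq b1 b2.
by apply: leq_trans kk; exact: leq_add.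
Qed.

Lemma wp_if x y c1 c2 R k Q :
  (R x < R y -> wp c1 R k Q) -> (R y <= R x -> wp c2 R k Q) -> wp (IfLt x y c1 c2) R k.+2 Q.
Proof.
case: ltnP => [lt /(_ isT) [R' [n [bg nk QR]]] _|le _ /(_ isT) [R' [n [bg nk QR]]]].
  by exists R', n.+1; split=> //; [exact: BigThen|exact: leqW].
by exists R', n.+2; split=> //; exact: BigElse.
Qed.

Lemma wp_conseq c R k k' (Q Q' : _ -> Prop) : k <= k' -> (forall R', Q R' -> Q' R') ->
  wp c R k Q -> wp c R k' Q'.
Proof.
move=> kk QQ [R' [n [bg nk QR]]]; exists R', n; split=> //; last exact: QQ.
exact: leq_trans kk.
Qed.

Lemma wp_stop x y c R k (Q : _ -> Prop) : 2 <= k -> R y <= R x -> Q R -> wp (WhileLt x y c) R k Q.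
Proof. by move=> k2 le QR; exists R, 2; split=> //; exact: BigStop. Qed.

Lemma wp_loop x y c R k k1 k2 Q : k1 + k2 + 2 <= k -> R x < R y ->
  wp c R k1 (fun R1 => wp (WhileLt x y c) R1 k2 Q) -> wp (WhileLt x y c) R k Q.
Proof.
move=> kk lt [R1 [n1 [b1 n1k [R2 [n2 [b2 n2k QR]]]]]].
exists R2, (n1 + n2).+2; split=> //; first exact: BigLoop lt b1 b2.
by apply: leq_trans kk; rewrite addn2 !ltnS leq_add.
Qed.

End Execution.

Lemma wp_computes w data table c q k out :
  wp w (cell w data) (cell w table) c (upd (fun=> 0) 0 (q %% 2 ^ w)) k
    (fun R => R 0 = out) ->
  exists2 k', k' <= k & ram_computes w data table (compile 0 c) q k' out.
Proof.
case=> R [n [bg nk RE]]; exists n => //.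
rewrite /ram_computes /ram_init (compileP bg (fun=> 0) (@code_at_self _)) /=; split=> //.
by rewrite /ram_halted size_compile.
Qed.

(** * Symbolic execution of single instructions *)

Section Steps.
Variables (w : nat) (data table : nat -> nat) (Q : (nat -> nat) -> Prop).
Local Notation run s R := (runs w data table s R Q).

Lemma step_const x k s R v : k = v -> v < 2 ^ w -> run s (upd R x v) -> run (Const x k :: s) R.
Proof. by move=> -> vw h; rewrite /runs /= modn_small. Qed.

Lemma step_add x y z s R v : R y + R z = v -> v < 2 ^ w ->
  run s (upd R x v) -> run (Op Add x y z :: s) R.
Proof. by move=> vE vw h; change (run s (upd R x ((R y + R z) %% 2 ^ w))); rewrite vE modn_small. Qed.

Lemma step_sub x y z s R v : R z <= R y -> R y - R z = v -> v < 2 ^ w ->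
  run s (upd R x v) -> run (Op Defs.Sub x y z :: s) R.
Proof. move=> le vE vw h; change (run s (upd R x ((R y + 2 ^ w - R z) %% 2 ^ w))).
by rewrite addnC -addnBA // vE modnDl modn_small.
Qed.

Lemma step_mul x y z s R v : R y * R z = v -> v < 2 ^ w ->
  run s (upd R x v) -> run (Op Mul x y z :: s) R.
Proof. by move=> vE vw h; change (run s (upd R x ((R y * R z) %% 2 ^ w))); rewrite vE modn_small. Qed.

Lemma step_div x y z s R v : R y %/ R z = v -> v < 2 ^ w ->
  run s (upd R x v) -> run (Op Div x y z :: s) R.
Proof. by move=> vE vw h; change (run s (upd R x ((R y %/ R z) %% 2 ^ w))); rewrite vE modn_small. Qed.

Lemma step_mod x y z s R v : R y %% R z = v -> v < 2 ^ w ->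
  run s (upd R x v) -> run (Op Mod x y z :: s) R.
Proof. by move=> vE vw h; change (run s (upd R x ((R y %% R z) %% 2 ^ w))); rewrite vE modn_small. Qed.

Lemma step_xor x y z s R v : Nat.lxor (R y) (R z) = v -> v < 2 ^ w ->
  run s (upd R x v) -> run (Op Xor x y z :: s) R.
Proof. by move=> vE vw h; change (run s (upd R x ((Nat.lxor (R y) (R z)) %% 2 ^ w))); rewrite vE modn_small. Qed.

(** Overflow is allowed here: a shift serves to discard high bits when two cells are joined. *)
Lemma step_shl x y z s R v : (R y * 2 ^ R z) %% 2 ^ w = v ->
  run s (upd R x v) -> run (Op Shl x y z :: s) R.
Proof. by move=> <- h. Qed.

Lemma step_shr x y z s R v : R y %/ 2 ^ R z = v -> v < 2 ^ w ->
  run s (upd R x v) -> run (Op Shr x y z :: s) R.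
Proof. by move=> vE vw h; change (run s (upd R x ((R y %/ 2 ^ R z) %% 2 ^ w))); rewrite vE modn_small. Qed.

Lemma step_data x y s R v : data (R y) = v -> run s (upd R x v) -> run (ReadData x y :: s) R.
Proof. by move=> <- h. Qed.

Lemma step_table x y s R v : table (R y) = v -> run s (upd R x v) -> run (ReadTable x y :: s) R.
Proof. by move=> <- h. Qed.

Lemma step_nil R : Q R -> run [::] R.
Proof. by []. Qed.

Lemma step_cat s1 s2 R :
  runs w data table s1 R (fun R' => run s2 R') -> run (s1 ++ s2) R.
Proof. by rewrite /runs foldl_cat. Qed.

End Steps.

(** * Finding the level of a node *)

Lemma lxor_double (a c : nat) (s t : bool) :
  Nat.lxor (s + a.*2) (t + c.*2) = (s (+) t) + (Nat.lxor a c).*2.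
Proof.
have bitE x (u : bool) : u + x.*2 = Nat.add (Nat.mul 2 x) (PeanoNat.Nat.b2n u).
  by rewrite -[Nat.add _ _]/(addn _ _) -[Nat.mul _ _]/(muln 2 x) mul2n addnC; case: u.
apply: PeanoNat.Nat.bits_inj => -[|m]; rewrite PeanoNat.Nat.lxor_spec !bitE.
  by rewrite !PeanoNat.Nat.testbit_0_r; case: s t => [] [].
by rewrite !PeanoNat.Nat.testbit_succ_r PeanoNat.Nat.lxor_spec.
Qed.

(* Subtracting one flips exactly the lowest set bit and the zeros below it. *)
Lemma lxor_pred i : 0 < i -> Nat.lxor i (i - 1) = 2 ^ (level i).+1 - 1.
Proof.
move=> i_gt0; rewrite {1 2}(level_rankE i_gt0).
elim: (level i) (rank_at i) => [|k IH] u.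
  rewrite mul1n subn1 /=; have := lxor_double u u true false.
  by rewrite /= add1n add0n PeanoNat.Nat.lxor_nilpotent.
have p_gt0 : 0 < 2 ^ k * u.*2.+1 by rewrite muln_gt0 expn_gt0.
have -> : 2 ^ k.+1 * u.*2.+1 = false + (2 ^ k * u.*2.+1).*2 by rewrite expnS -mulnA mul2n.
have -> : false + (2 ^ k * u.*2.+1).*2 - 1 = true + (2 ^ k * u.*2.+1 - 1).*2.
  by move: p_gt0; move: (2 ^ k * _) => p p_gt0; rewrite -!mul2n /=; lia.
rewrite lxor_double IH.
have : 0 < 2 ^ k.+1 by rewrite expn_gt0.
by rewrite [2 ^ k.+2]expnS; move: (2 ^ k.+1) => p; rewrite -mul2n /=; lia.
Qed.

(** Lifting the exponent: [4 ^ k] is [3 * k + 1] modulo 9, which gives [3 %| m]. For [m = 3 m'], the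
    cofactor of [4 ^ m' - 1] in [4 ^ m - 1] is divisible by 3 exactly once. *)
Lemma pow4_order a m : 3 ^ a.+1 %| 4 ^ m - 1 -> 3 ^ a %| m.
Proof.
elim: a m => [|a IH] m; first by rewrite expn0 dvd1n.
move=> dv; have mod3 k : exists y, 4 ^ k = 3 * y + 1.
  elim: k => [|k [y yE]]; first by exists 0.
  by exists (4 * y + 1); rewrite expnS yE; lia.
have mod9 k : exists y, 4 ^ k = 9 * y + 3 * k + 1.
  elim: k => [|k [y yE]]; first by exists 0.
  by exists (4 * y + k); rewrite expnS yE; lia.
have : 3 %| m.
  have [y yE] := mod9 m.
  have : 9 %| 4 ^ m - 1 by apply: dvdn_trans dv; rewrite !expnS mulnA dvdn_mulr.
  by rewrite yE addnK (dvdn_addr _ (dvdn_mulr _ (dvdnn 9))) -[9]/(3 * 3) dvdn_pmul2l.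
case/dvdnP => m' mE; rewrite mE in dv *; rewrite expnSr dvdn_pmul2r //.
apply: IH; move: dv; rewrite expnM; have [y yE] := mod3 m'; rewrite yE.
have -> : (3 * y + 1) ^ 3 - 1 = 3 * y * (3 * (3 * (y * y + y) + 1)).
  by rewrite !expnS expn0; lia.
rewrite addnK [3 ^ a.+2]expnS -mulnCA dvdn_pmul2l // Gauss_dvdl //.
by rewrite coprimeXl // prime_coprime // dvdn_addr ?dvdn_mulr.
Qed.

(* As 2 is a primitive root modulo 3 ^ a, the residue of 2 ^ k is a perfect hash of [k]
   with a range of linear size. *)
Lemma pow2_hash a k k' : k < 3 ^ a -> k' < 3 ^ a ->
  2 ^ k %% 3 ^ a.+1 = 2 ^ k' %% 3 ^ a.+1 -> k = k'.
Proof.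
wlog le : k k' / k <= k' => [wl|].
  by case: (leqP k k') => [/wl//|/ltnW /wl h] ? ? ?; symmetry; apply: h.
move=> _ k'lt /eqP; rewrite eq_sym eqn_mod_dvd ?leq_exp2l // => dv.
have [m mE] : exists m, k' = k + m by exists (k' - k); rewrite subnKC.
move: dv; rewrite mE expnD -{2}[2 ^ k]muln1 -mulnBr Gauss_dvdr; last first.
  by rewrite coprimeXl // coprimeXr.
(* An odd power of 2 is 2 modulo 3, so the difference of the exponents is even. *)
move=> dv; have [h hE] : exists h, m = 2 * h.
  exists m./2; rewrite -[LHS]odd_double_half mul2n; case: odd (odd_double_half m) => //= mo.
  have : 3 %| 2 ^ m - 1 by apply: dvdn_trans dv; rewrite expnS dvdn_mulr.
  have [y yE] : exists y, 4 ^ m./2 = 3 * y + 1.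
    elim: (m./2) => [|j [y yE]]; first by exists 0.
    by exists (4 * y + 1); rewrite expnS yE; lia.
  by rewrite -mo -mul2n expnS expnM yE; move=> /dvdnP[z]; lia.
move: dv; rewrite hE expnM => /pow4_order; case: h hE => [|h] hE; first by lia.
by move=> /dvdn_leq -/(_ isT); lia.
Qed.

(** * Reading the spill tree *)

(* Registers of the query program: 1 word size, 2 the constant 1, 3 the number N of
   blocks, 4 N+1, 5 modulus of the level hash, 6 spill universe of the root, 7 number
   of vertices, 8 final field. [node_code] takes a node in 13 and returns 2^k in 16,
   2^(k+1) in 17, whether it is a top node in 18, the address of the constants of
   level k in 19, the word in 20 and the content size in 22. *)
Definition record_base := 12.

(** Register 20 holds a bit position on entry and the [w] bits found there on exit, joined from two
    adjacent cells as in [bitsval_two_cells]. *)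
Definition read_code : seq instr := [::
  Op Div 21 20 1; Op Mod 20 20 1; ReadData 22 21; Op Shr 22 22 20;
  Op Add 21 21 2; ReadData 21 21; Op Defs.Sub 20 1 20; Op Shl 21 21 20;
  Op Add 20 22 21].

Definition node_code : seq instr := [::
  Op Defs.Sub 17 13 2; Op Xor 17 13 17; Op Add 17 17 2; Op Shr 16 17 2;
  Op Mod 19 16 5; Const 21 3; Op Shl 19 19 21; Const 21 12; Op Add 19 19 21;
  Op Add 18 13 16; Op Div 18 18 4; Op Div 20 13 17;
  Op Add 21 19 2; ReadTable 21 21; Op Mul 20 20 21; ReadTable 21 19; Op Add 20 20 21]
  ++ read_code ++ [::
  Const 21 2; Op Add 21 19 21; Op Add 21 21 18; ReadTable 21 21; Op Mod 20 20 21;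
  Const 21 4; Op Add 21 19 21; Op Add 21 21 18; ReadTable 22 21].

(* The parent of the node in 13, whose level data are in 16 to 18. *)
Definition parent_code : cmd :=
  IfLt 18 2
    (Block [:: Op Add 21 17 17; Op Div 13 13 21; Op Mul 13 13 21; Op Add 13 13 17])
    (Block [:: Op Defs.Sub 13 13 16]).

(* The spill of the node in 23 with parent in 13, read from the word of the parent. *)
Definition spill_code : cmd :=
  IfLt 13 2
    (Block [:: Op Mod 24 8 6])
    (Seq (Block (node_code ++ [:: Op Div 20 20 22; Const 21 6; Op Add 21 19 21; ReadTable 21 21]))
         (IfLt 23 13 (Block [:: Op Mod 24 20 21]) (Block [:: Op Div 24 20 21]))).

Definition element_code : cmd :=
  IfLt 3 13 (Block [:: Op Div 25 8 6])
  (Seq (Block (node_code ++ [:: Op Mod 15 20 22; Op Mul 14 22 2; Op Mul 23 13 2]))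
  (Seq parent_code
  (Seq spill_code
  (Block [:: Op Mul 24 24 14; Op Add 25 24 15])))).

Lemma updN R x a r : r != x -> upd R x a r = R r.
Proof. by rewrite /upd => /negPf ->. Qed.

(** * Correctness of the tree program *)

Section TreeProgram.
Variables (w N X G H h3 Bd : nat) (mem : seq bool) (table : nat -> nat).
Local Notation data := (cell w mem).
Local Notation rd := (bitsval (nth false mem)).
Local Notation runs := (runs w data table).
Local Notation wp := (wp w data table).

(** Fields 2, 3 and 4, 5 are pairs for full and top nodes, selected by adding the Boolean [top].
    Storing powers [2 ^ word_bits] makes truncation to the word a single remainder. A record
    occupies eight words so that its address is found by a shift. *)
Definition level_record k : seq nat :=
  let Y t := slots N X G k t in
  [:: level_pos N X G k; word_bits G (Y false); 2 ^ word_bits G (Y false);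
      2 ^ word_bits G (Y true); content_size G (Y false); content_size G (Y true);
      full_spill X G k].

Hypothesis w_gt3 : 3 < w.
Hypothesis Bd_le : 16 * Bd <= 2 ^ w.
Hypothesis N_le : N + 16 <= Bd.
Hypothesis h3_le : 8 * h3 + 32 <= Bd.
Hypothesis h3_gt0 : 0 < h3.
Hypothesis pos_le : level_pos N X G H <= Bd.
Hypothesis len_le : forall k t, 2 ^ word_bits G (slots N X G k t) <= Bd.
Hypothesis N_lt : N < 2 ^ H.
Hypothesis G_gt0 : 0 < G.
Hypothesis tableP : forall k f, k < H -> f < 7 ->
  table (record_base + 8 * (2 ^ k %% h3) + f) = nth 0 (level_record k) f.

Lemma read_codeP R Q pos : R 1 = w -> R 2 = 1 -> R 20 = pos -> pos <= Bd ->
  (forall R', R' 20 = rd pos w -> (forall r, (r < 20) || (22 < r) -> R' r = R r) -> Q R') ->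
  runs read_code R Q.
Proof.
move=> R1 R2 R20 posB QR.
have w_gt0 : 0 < w by lia.
have ww : w < 2 ^ w by apply: ltn_expl.
have dw : pos %/ w <= pos by apply: leq_div.
apply: (step_div (v := pos %/ w)); [by rewrite R20 R1|lia|].
apply: (step_mod (v := pos %% w)); [by rewrite /upd /= R20 R1| |].
  by apply: leq_ltn_trans ww; rewrite ltnW // ltn_mod.
apply: (step_data (v := bitsval (nth false mem) (pos %/ w * w) w)); first by rewrite /upd /= cellE.
apply: (step_shr (v := bitsval (nth false mem) (pos %/ w * w) w %/ 2 ^ (pos %% w))).
- by rewrite /upd.
- by apply: leq_ltn_trans (leq_div _ _) (bitsval_lt _ _ _).
apply: (step_add (v := (pos %/ w).+1)); [by rewrite /upd /= R2 addn1|lia|].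
apply: (step_data (v := bitsval (nth false mem) ((pos %/ w).+1 * w) w)); first by rewrite /upd /= cellE.
apply: (step_sub (v := w - pos %% w)).
- by rewrite /upd /= R1 ltnW // ltn_mod.
- by rewrite /upd /= R1.
- by apply: leq_ltn_trans ww; exact: leq_subr.
apply: (step_shl (v := (bitsval (nth false mem) ((pos %/ w).+1 * w) w * 2 ^ (w - pos %% w)) %% 2 ^ w)).
  by rewrite /upd.
apply: (step_add (v := rd pos w)); first by rewrite /upd /= (bitsval_two_cells _ pos w_gt0).
  exact: bitsval_lt.
apply: step_nil; apply: QR => [|r rN]; first by rewrite /upd.
by rewrite /= !updN //; lia.
Qed.

Lemma node_codeP R Q i : R 1 = w -> R 2 = 1 -> R 4 = N.+1 -> R 5 = h3 -> R 13 = i ->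
  0 < i <= N ->
  (forall R', R' 16 = 2 ^ level i -> R' 17 = 2 ^ (level i).+1 -> R' 18 = top N i ->
     R' 19 = record_base + 8 * (2 ^ level i %% h3) ->
     R' 20 = rd (node_pos N X G i) (node_len N X G i) ->
     R' 22 = content_size G (node_slots N X G i) ->
     (forall r, (r < 16) || (22 < r) -> R' r = R r) -> Q R') ->
  runs node_code R Q.
Proof.
move=> R1 R2 R4 R5 R13 iN QR; set k := level i.
have i_gt0 : 0 < i by lia.
have kH : k < H by exact: level_lt iN N_lt.
have bi : 2 ^ k <= i by rewrite [X in _ <= X](level_rankE i_gt0) leq_pmulr.
have b_gt0 : 0 < 2 ^ k by rewrite expn_gt0.
have hm : 2 ^ k %% h3 < h3 by rewrite ltn_mod.
have tabP f : f < 7 -> table (record_base + 8 * (2 ^ k %% h3) + f) = nth 0 (level_record k) f.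
  exact: tableP.
(* Since [2 ^ k <= i <= N], the sum is less than [2 * N.+1], so a division decides the comparison
   without a branch. *)
have topE : (i + 2 ^ k) %/ N.+1 = top N i.
  rewrite /top -/k; case: ltnP => h.
    apply/eqP; rewrite eqn_leq leq_divRL // mul1n h andbT -ltnS ltn_divLR //; lia.
  by rewrite divn_small.
have rk : rank_at i = i %/ 2 ^ k.+1 by [].
have posN : node_pos N X G i <= Bd.
  by have := node_le X G_gt0 iN N_lt; lia.
have w1 : 1 < 2 ^ w by lia.
rewrite /node_code; apply: step_cat.
apply: (step_sub (v := i - 1)); [by rewrite R13 R2|by rewrite R13 R2|lia|].
apply: (step_xor (v := 2 ^ k.+1 - 1)); [by rewrite /upd /= R13 lxor_pred|rewrite expnS; lia|].
apply: (step_add (v := 2 ^ k.+1)); [rewrite /upd /= R2 expnS; lia|rewrite expnS; lia|].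
apply: (step_shr (v := 2 ^ k)); [by rewrite /upd /= R2 expnS mulKn|lia|].
apply: (step_mod (v := 2 ^ k %% h3)); [by rewrite /upd /= R5|lia|].
apply: (step_const (v := 3)); [by []|lia|].
apply: (step_shl (v := 8 * (2 ^ k %% h3))).
  by rewrite /upd /= mulnC modn_small //; lia.
apply: (step_const (v := record_base)); [by []|rewrite /record_base; lia|].
apply: (step_add (v := record_base + 8 * (2 ^ k %% h3)));
  [by rewrite /upd /= addnC|rewrite /record_base; lia|].
apply: (step_add (v := i + 2 ^ k)); [by rewrite /upd /= R13|lia|].
apply: (step_div (v := top N i)); [by rewrite /upd /= R4 topE|by case: (top N i); lia|].
apply: (step_div (v := rank_at i)); [by rewrite /upd /= R13| |].
  by rewrite rk; apply: leq_ltn_trans (leq_div _ _) _; lia.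
apply: (step_add (v := record_base + 8 * (2 ^ k %% h3) + 1));
  [by rewrite /upd /= R2|rewrite /record_base; lia|].
apply: (step_table (v := word_bits G (slots N X G k false))); first by rewrite /upd /= tabP.
apply: (step_mul (v := rank_at i * word_bits G (slots N X G k false))); first by [].
  by apply: (@leq_ltn_trans (node_pos N X G i)); [exact: leq_addl|lia].
apply: (step_table (v := level_pos N X G k)); first by rewrite /upd /= -[X in table X]addn0 tabP.
apply: (step_add (v := node_pos N X G i)); [by rewrite /upd /= addnC|lia|].
apply: step_nil; apply: step_cat.
apply: (@read_codeP _ _ (node_pos N X G i)); [by rewrite /upd|by rewrite /upd|by []|by []|].
move=> R' R20 R'E.
have R'1 : R' 1 = w by rewrite R'E /upd.
have R'19 : R' 19 = record_base + 8 * (2 ^ k %% h3) by rewrite R'E /upd.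
have R'18 : R' 18 = top N i by rewrite R'E /upd.
apply: (step_const (v := 2)); [by []|lia|].
apply: (step_add (v := record_base + 8 * (2 ^ k %% h3) + 2));
  [by rewrite /upd /= R'19|rewrite /record_base; lia|].
apply: (step_add (v := record_base + 8 * (2 ^ k %% h3) + (2 + top N i)));
  [by rewrite /upd /= R'18 addnA|rewrite /record_base; case: (top N i); lia|].
apply: (step_table (v := 2 ^ node_len N X G i)).
  by rewrite /upd /= tabP /node_len /node_slots -/k; case: (top N i).
apply: (step_mod (v := rd (node_pos N X G i) (node_len N X G i))).
- rewrite /upd /= R20 bitsval_mod // -(leq_exp2l _ _ (isT : 1 < 2)).
  by apply: leq_trans (len_le _ _) _; lia.
- by apply: leq_trans (bitsval_lt _ _ _) _; apply: leq_trans (len_le _ _) _; lia.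
apply: (step_const (v := 4)); [by []|lia|].
apply: (step_add (v := record_base + 8 * (2 ^ k %% h3) + 4));
  [by rewrite /upd /= R'19|rewrite /record_base; lia|].
apply: (step_add (v := record_base + 8 * (2 ^ k %% h3) + (4 + top N i)));
  [by rewrite /upd /= R'18 addnA|rewrite /record_base; case: (top N i); lia|].
apply: (step_table (v := content_size G (node_slots N X G i))).
  by rewrite /upd /= tabP /node_slots -/k; case: (top N i).
apply: step_nil; apply: QR; try by rewrite /upd /= ?R'E.
by move=> r rN; rewrite /= !updN ?R'E ?updN //; lia.
Qed.


Definition tree_element F i := if N < i then F %/ top_spill N X G H else tree_read N X G rd F H i.

Lemma contents_le j : content_size G (node_slots N X G j) <= Bd.
Proof. by apply: leq_trans (leq_div _ _) (len_le _ _). Qed.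

Lemma read_node_lt j : rd (node_pos N X G j) (node_len N X G j) < 2 ^ w.
Proof.
by apply: leq_trans (bitsval_lt _ _ _) _; apply: leq_trans (len_le _ _) _; lia.
Qed.

Lemma parent_codeP R Q i : R 2 = 1 -> R 13 = i -> 0 < i <= N -> R 16 = 2 ^ level i ->
  R 17 = 2 ^ (level i).+1 -> R 18 = top N i ->
  (forall R', R' 13 = parent N i -> (forall r, r != 13 -> r != 21 -> R' r = R r) -> Q R') ->
  wp parent_code R 6 Q.
Proof.
move=> R2 R13 iN R16 R17 R18 QR; set k := level i in R16 R17.
have i_gt0 : 0 < i by lia.
have bi : 2 ^ k <= i by rewrite [X in _ <= X](level_rankE i_gt0) leq_pmulr.
apply: (@wp_if _ _ _ 18 2 _ _ _ 4); rewrite R18 R2; case: (boolP (top N i)) => // ti _.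
  have pE : parent N i = i %/ 2 ^ k.+2 * 2 ^ k.+2 + 2 ^ k.+1.
    by rewrite /parent (negPf ti) mulnC.
  have b4 : 2 ^ k.+2 = 2 ^ k.+1 + 2 ^ k.+1 by rewrite addnn -mul2n -expnS.
  have b2 : 2 ^ k.+1 = 2 ^ k + 2 ^ k by rewrite addnn -mul2n -expnS.
  have dm : i %/ 2 ^ k.+2 * 2 ^ k.+2 <= i by exact: leq_divM.
  apply: wp_block => //.
  apply: (step_add (v := 2 ^ k.+2)); [by rewrite R17 b4|lia|].
  apply: (step_div (v := i %/ 2 ^ k.+2)); [by rewrite /upd /= R13| |].
    by apply: leq_ltn_trans (leq_div _ _) _; lia.
  apply: (step_mul (v := i %/ 2 ^ k.+2 * 2 ^ k.+2)); [by []|lia|].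
  apply: (step_add (v := parent N i)); [by rewrite /upd /= R17 pE|lia|].
  by apply: step_nil; apply: QR => // r r13 r21; rewrite !updN.
apply: wp_block => //.
have pE : parent N i = i - 2 ^ k by rewrite /parent ti.
apply: (step_sub (v := parent N i)); rewrite ?R13 ?R16 //; first lia.
by apply: step_nil; apply: QR => // r r13 r21; rewrite updN.
Qed.

Lemma spill_codeP R Q i F : R 1 = w -> R 2 = 1 -> R 4 = N.+1 -> R 5 = h3 ->
  R 6 = top_spill N X G H -> R 8 = F -> F < 2 ^ w ->
  R 13 = parent N i -> R 23 = i -> 0 < i <= N ->
  (forall R', R' 24 = node_spill N X G rd F H i ->
     (forall r, r != 13 -> (r < 16) || (24 < r) -> R' r = R r) -> Q R') ->
  wp spill_code R 44 Q.
Proof.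
move=> R1 R2 R4 R5 R6 R8 Fw R13 R23 iN QR; rewrite /node_spill in QR.
have par0 : 0 < parent N i -> 0 < parent N i <= N.
  move=> p_gt0; rewrite p_gt0 /=.
  by case: (ltnP i (parent N i)) => ip;
    [case: (left_parent X G_gt0 iN p_gt0 ip)|case: (right_parent X G_gt0 iN p_gt0 ip)].
apply: (@wp_if _ _ _ 13 2 _ _ _ 42); rewrite R13 R2 => p0.
  have {}p0 : parent N i == 0 by rewrite -leqn0 -ltnS.
  rewrite p0 in QR; apply: wp_block => //.
  apply: (step_mod (v := F %% top_spill N X G H)); [by rewrite R8 R6| |].
    exact: leq_ltn_trans (leq_mod _ _) Fw.
  by apply: step_nil; apply: QR => // r r13 r16; rewrite updN //; lia.
have pN := par0 p0; rewrite eqn0Ngt p0 /= in QR.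
apply: (@wp_seq _ _ _ _ _ _ 39 3) => //.
apply: wp_block => //; apply: step_cat; apply: (node_codeP R1 R2 R4 R5 R13 pN).
move=> R' R'16 R'17 R'18 R'19 R'20 R'22 R'E.
set p := parent N i in R13 p0 pN R'16 R'17 R'18 R'19 R'20 R'22 QR *.
have hm : 2 ^ level p %% h3 < h3 by rewrite ltn_mod.
apply: (step_div (v := children_spills N X G rd p)); [by rewrite R'20 R'22| |].
  exact: leq_ltn_trans (leq_div _ _) (read_node_lt _).
apply: (step_const (v := 6)); [by []|lia|].
apply: (step_add (v := record_base + 8 * (2 ^ level p %% h3) + 6));
  [by rewrite /upd /= R'19|rewrite /record_base; lia|].
apply: (step_table (v := full_spill X G (level p))).
  by rewrite /upd /= tableP //; apply: level_lt pN N_lt.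
apply: step_nil; set R1' := upd _ 21 _.
have R1E r : r != 13 -> (r < 16) || (24 < r) -> R1' r = R r.
  by move=> r13 r16; rewrite /R1' !updN ?R'E //; lia.
have R1_23 : R1' 23 = i by rewrite /R1' /upd /= R'E.
have R1_13 : R1' 13 = p by rewrite /R1' /upd /= R'E.
have [R1_20 R1_21] : R1' 20 = children_spills N X G rd p /\ R1' 21 = full_spill X G (level p) by [].
move: R1' R1E R1_23 R1_13 R1_20 R1_21 => R1' R1E R1_23 R1_13 R1_20 R1_21.
have csw : children_spills N X G rd p < 2 ^ w.
  exact: leq_ltn_trans (leq_div _ _) (read_node_lt _).
apply: (@wp_if _ _ _ 23 13 _ _ _ 1); rewrite R1_23 R1_13 => ip.
  rewrite ip in QR; apply: wp_block => //.
  apply: (step_mod (v := children_spills N X G rd p %% full_spill X G (level p)));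
    [by rewrite R1_20 R1_21|exact: leq_ltn_trans (leq_mod _ _) csw|].
  by apply: step_nil; apply: QR => // r r13 r16; rewrite updN ?R1E //; lia.
rewrite ltnNge ip /= in QR; apply: wp_block => //.
apply: (step_div (v := children_spills N X G rd p %/ full_spill X G (level p)));
  [by rewrite R1_20 R1_21|exact: leq_ltn_trans (leq_div _ _) csw|].
by apply: step_nil; apply: QR => // r r13 r16; rewrite updN ?R1E //; lia.
Qed.

Lemma element_codeP R Q i F : R 1 = w -> R 2 = 1 -> R 3 = N -> R 4 = N.+1 -> R 5 = h3 ->
  R 6 = top_spill N X G H -> R 8 = F -> R 13 = i -> 0 < i -> F < 2 ^ w ->
  tree_element F i <= Bd ->
  (forall R', R' 25 = tree_element F i -> (forall r, r < 13 -> R' r = R r) -> Q R') ->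
  wp element_code R 92 Q.
Proof.
move=> R1 R2 R3 R4 R5 R6 R8 R13 i_gt0 Fw elB QR; rewrite /tree_element in elB QR.
apply: (@wp_if _ _ _ 3 13 _ _ _ 90); rewrite R3 R13 => Ni.
  rewrite Ni in elB QR; apply: wp_block => //.
  apply: (step_div (v := F %/ top_spill N X G H)); [by rewrite R8 R6|lia|].
  apply: step_nil; apply: QR => [|r r13]; first by rewrite /upd.
  by rewrite updN //; lia.
have iN : 0 < i <= N by rewrite i_gt0.
rewrite ltnNge Ni /= in elB QR.
set k := level i in elB QR *.
have bi : 2 ^ k <= i by rewrite [X in _ <= X](level_rankE i_gt0) leq_pmulr.
have b_gt0 : 0 < 2 ^ k by rewrite expn_gt0.
apply: (@wp_seq _ _ _ _ _ _ 38 52) => //.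
apply: wp_block => //; apply: step_cat; apply: (node_codeP R1 R2 R4 R5 R13 iN).
move=> R' R'16 R'17 R'18 R'19 R'20 R'22 R'E.
set C0 := content_size _ _ in R'22; set wd := rd _ _ in R'20.
apply: (step_mod (v := wd %% C0)); [by rewrite R'20 R'22| |].
  exact: leq_ltn_trans (leq_mod _ _) (read_node_lt _).
(* There is no move instruction; a product with register 2, which holds 1, makes a copy. *)
apply: (step_mul (v := C0)); [by rewrite /upd /= R'22 R'E // R2 muln1| |].
  by apply: leq_ltn_trans (contents_le _) _; lia.
apply: (step_mul (v := i)); [by rewrite /upd /= !R'E // R2 R13 muln1|lia|].
apply: step_nil; set R1' := upd _ 23 i.
have R1E r : r < 13 -> R1' r = R r by move=> r13; rewrite /R1' !updN ?R'E //; lia.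
have R1_13 : R1' 13 = i by rewrite /R1' /upd /= R'E.
have [R1_14 R1_15 R1_23] : [/\ R1' 14 = C0, R1' 15 = wd %% C0 & R1' 23 = i] by [].
have [R1_16 R1_17 R1_18] : [/\ R1' 16 = 2 ^ k, R1' 17 = 2 ^ k.+1 & R1' 18 = top N i] by [].
move: R1' R1E R1_13 R1_14 R1_15 R1_23 R1_16 R1_17 R1_18 =>
  R1' R1E R1_13 R1_14 R1_15 R1_23 R1_16 R1_17 R1_18.
apply: (@wp_seq _ _ _ _ _ _ 6 46) => //.
apply: (parent_codeP (i := i)) => //; first by rewrite R1E.
move=> R2' R2_13 R2E.
apply: (@wp_seq _ _ _ _ _ _ 44 2) => //.
apply: (spill_codeP (i := i) (F := F)) => //; try by rewrite R2E // ?R1_23 ?R1E.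
move=> R3' R3_24 R3E; apply: wp_block => //.
have R3_14 : R3' 14 = C0 by rewrite R3E // R2E.
have R3_15 : R3' 15 = wd %% C0 by rewrite R3E // R2E.
have elB' : node_spill N X G rd F H i * C0 + wd %% C0 <= Bd by exact: elB.
apply: (step_mul (v := node_spill N X G rd F H i * C0)); [by rewrite R3_24 R3_14|lia|].
apply: (step_add (v := node_spill N X G rd F H i * C0 + wd %% C0));
  [by rewrite /upd /= R3_15|lia|].
apply: step_nil; apply: QR => [|r r13]; first by rewrite /upd.
by rewrite !updN ?R3E ?R2E ?R1E //; lia.
Qed.

End TreeProgram.

(** * The lookup table for piece codes *)

Lemma divn_digit n m r : r < n -> (m * n + r) %/ n = m.
Proof. by move=> rn; rewrite divnMDl ?divn_small ?addn0 // (leq_ltn_trans _ rn). Qed.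

Lemma modn_digit n m r : r < n -> (m * n + r) %% n = r.
Proof. by move=> rn; rewrite modnMDl modn_small. Qed.

(** [piece_get] on raw words. A node consists of the bucket size, the piece length and nine words
    for each pair of a bucket and a piece: the threshold and, for each half of the bucket, the first
    code, the product of the preceding factors, the factor and the address of the child. Bucket size
    0 marks a leaf, whose second word is the answer. *)
Fixpoint table_get (tbl : nat -> nat) (b fuel A j z : nat) : nat :=
  let s := tbl A in
  if s == 0 then tbl (A + 1) else
  if fuel is fuel'.+1 then
    let p := j %% s in
    let l := tbl (A + 1) in
    let r := A + (2 + 9 * ((j %/ s) * b + z %/ l)) in
    let r' := if p < tbl r then r + 1 else r + 5 in
    let o := tbl r' + (if p < tbl r then p else p - tbl r) in
    table_get tbl b fuel' (tbl (r' + 3)) ((o %/ tbl (r' + 1)) %% tbl (r' + 2)) (z %% l)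
  else 0.

(* The side condition for running [table_get] on words: nothing it computes reaches [m]. *)
Fixpoint table_safe (tbl : nat -> nat) (b m fuel A j z : nat) : bool :=
  let s := tbl A in
  (A + 1 < m) && ((s == 0) ||
  if fuel is fuel'.+1 then
    let p := j %% s in
    let l := tbl (A + 1) in
    let r := A + (2 + 9 * ((j %/ s) * b + z %/ l)) in
    let r' := if p < tbl r then r + 1 else r + 5 in
    let o := tbl r' + (if p < tbl r then p else p - tbl r) in
    [&& r + 9 < m, o < m &
    table_safe tbl b m fuel' (tbl (r' + 3)) ((o %/ tbl (r' + 1)) %% tbl (r' + 2)) (z %% l)]
  else false).

Section NodeTable.
Variables (T : finType) (e : rel T) (d : nat) (x0 : T).
Variables (b D ell tail nbase : nat).
Local Notation tau := #|T|.
Local Notation nw := (nw e).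
Local Notation vtx := (vtx x0).

(* Kinds of nodes: 0 for full pieces of length b^t, 1 and 2 for the remainders of
   blocks and of the tail, 3 for the tail with a free end. *)
Definition kind_len t kind :=
  if kind == 0 then b ^ t else if kind == 1 then ell %% b ^ t else tail %% b ^ t.

Definition kind_end kind (a : T) := if kind == 3 then None else Some a.

Definition child_kind kind (full : bool) := if full then 0 else if kind == 1 then 1 else 2.

(** Room for two leading words and for the records of [2 * tau ^ b] buckets and [b] pieces, by the
    bound of [alias_buckets]. *)
Definition stride := 2 + 9 * (2 * tau ^ b * b).

Definition node_address t kind (a a' : T) :=
  nbase + stride * (((t * 4 + kind) * tau + enum_rank a) * tau + enum_rank a').

Definition half_record t kind a (p : seq T) f c : seq nat :=
  let L := kind_len t.+1 kind in
  let ns := factors e (node_pieces b t L) a p in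
  [:: f; \prod_(n <- take c ns) n; nth 0 ns c;
      node_address t (child_kind kind (c < L %/ b ^ t)) (nth a (a :: p) c) (nth a p c)].

Definition node_record t kind a a' k c : seq nat :=
  let: (thr, (p, f), (p', f')) := node_table e b t (kind_len t.+1 kind) a (kind_end kind a') k in
  thr :: half_record t kind a p f c ++ half_record t kind a p' f' c.

Definition node_entry t kind a a' f : nat :=
  if t is t'.+1 then
    if f == 0 then node_size e b t' (kind_len t kind) a (kind_end kind a')
    else if f == 1 then b ^ t'
    else nth 0 (node_record t' kind a a' ((f - 2) %/ 9 %/ b) ((f - 2) %/ 9 %% b)) ((f - 2) %% 9)
  else if f == 0 then 0 else enum_rank a'.

(** Inverts the mixed radix of [node_address], recovering depth, kind, ends and field from an
    offset. *)
Definition node_cell m : nat :=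
  let f := m %% stride in
  let y := m %/ stride in
  let t := y %/ tau %/ tau in
  node_entry (t %/ 4) (t %% 4) (vtx (y %/ tau %% tau)) (vtx (y %% tau)) f.

Lemma node_cellE t kind a a' f : kind < 4 -> f < stride ->
  node_cell (node_address t kind a a' - nbase + f) = node_entry t kind a a' f.
Proof.
move=> k4 fs; have s_gt0 : 0 < stride by lia.
have ra := ltn_ord (enum_rank a); have ra' := ltn_ord (enum_rank a').
have t_gt0 : 0 < tau by apply: leq_ltn_trans ra.
rewrite /node_cell /node_address addKn [stride * _]mulnC.
by rewrite !(divn_digit, modn_digit) // !vtxK.
Qed.

Hypothesis b_gt0 : 0 < b.
Hypothesis d_gt0 : 0 < d.
Hypothesis reg : regular_graph e d.

Lemma kind_len_le t kind : kind_len t kind <= b ^ t.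
Proof.
have bt : 0 < b ^ t by rewrite expn_gt0 b_gt0.
by rewrite /kind_len; do !case: ifP => _ //; rewrite ltnW // ltn_mod.
Qed.

Lemma child_kindP kind f a : [/\ child_kind kind f < 4, child_kind kind f != 3 &
  kind_end (child_kind kind f) a = Some a].
Proof. by rewrite /child_kind; case: f => //; case: ifP. Qed.

(** A few kinds per depth suffice because [(L %% b ^ t.+1) %% b ^ t = L %% b ^ t]: what remains of a
    remainder is a remainder of the original length. *)
Lemma child_kind_len t kind c :
  kind < 4 -> c < size (node_pieces b t (kind_len t.+1 kind)) ->
  kind_len t (child_kind kind (c < kind_len t.+1 kind %/ b ^ t)) =
  nth 0 (node_pieces b t (kind_len t.+1 kind)) c.
Proof.
move=> k4; have bt : 0 < b ^ t by rewrite expn_gt0 b_gt0.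
set L := kind_len t.+1 kind; rewrite size_pieces nth_cat size_nseq nth_nseq.
case: (ltnP c (L %/ b ^ t)) => // cL; have [rem|rem] := eqVneq (L %% b ^ t) 0; rewrite /= ?addn0 ?addn1.
  by rewrite ltnNge cL.
rewrite ltnS => cL'; have -> : c - L %/ b ^ t = 0 by apply/eqP; rewrite subn_eq0.
move: rem; rewrite /= /L /kind_len /child_kind /=.
case: kind k4 @L cL cL' => [|[|kind]] k4 L cL cL' /=.
- by rewrite expnS modnMl.
- by rewrite expnS modn_dvdm // dvdn_mull.
- by rewrite expnS modn_dvdm // dvdn_mull.
Qed.

Lemma factors_le Ls a p c : \prod_(n <- take c (factors e Ls a p)) n <= d ^ sumn Ls /\
  nth 0 (factors e Ls a p) c <= d ^ sumn Ls.
Proof.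
elim: Ls a p c => [|L Ls IH] a [|u p] c; rewrite /= ?big_nil ?nth_nil ?expn_gt0 ?d_gt0 //.
have nL := nw_le_pow L a (pred1 u) reg; rewrite expnD.
case: c => [|c]; rewrite ?take0 ?big_nil /= ?big_cons.
  by rewrite muln_gt0 !expn_gt0 d_gt0 /=; split=> //; apply: leq_trans nL _;
    rewrite leq_pmulr ?expn_gt0 ?d_gt0.
have [h1 h2] := IH u p c; split; first exact: leq_mul.
by apply: leq_trans h2 _; rewrite leq_pmull ?expn_gt0 ?d_gt0.
Qed.

Variables (tbl : nat -> nat) (m : nat).
Hypothesis tblP : forall t kind a a' f, t <= D -> kind < 4 -> f < stride ->
  node_entry t kind a a' f < m ->
  tbl (node_address t kind a a' + f) = node_entry t kind a a' f.

Lemma stride_record k c f : k < 2 * tau ^ b -> c < b -> f < 9 ->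
  2 + 9 * (k * b + c) + f < stride.
Proof.
move=> kb cb f9; rewrite /stride.
have : k.+1 * b <= 2 * tau ^ b * b by rewrite leq_mul2r kb orbT.
by rewrite mulSn; lia.
Qed.

Lemma node_count_gt0 t L a oa j : j < nw L a (ending oa) ->
  0 < count (fun p => 0 < node_weight e b t L a oa p) (node_paths T b t L).
Proof.
move=> jM; rewrite -has_count; apply/hasPn => /= z0; move: jM.
rewrite -(node_total e b t L a oa) big_seq big1 // => p /z0.
by rewrite -eqn0Ngt => /eqP.
Qed.

Lemma node_size_gt0 t L a oa j : j < nw L a (ending oa) -> 0 < node_size e b t L a oa.
Proof.
move=> /(node_count_gt0 t) n_gt0; rewrite divn_gt0 //.
rewrite -sum1_count [X in X <= _]big_mkcond; apply: leq_sum => p _.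
by case: (node_weight _ _ _ _ _ _ _).
Qed.

Lemma node_bucket_lt t L a oa j : L <= b ^ t.+1 -> j < nw L a (ending oa) ->
  j %/ node_size e b t L a oa < 2 * tau ^ b.
Proof.
move=> Lb jM; have c_gt0 := node_count_gt0 t jM.
have tau_gt0 : 0 < tau by apply/card_gt0P; exists a.
apply: leq_trans (alias_buckets c_gt0 _) _; first by rewrite node_total.
rewrite size_paths leq_mul2l leq_pexp2l // size_pieces_le // ?expn_gt0 ?b_gt0 //.
by rewrite -expnS.
Qed.

Hypothesis address_lt : forall t kind a a', t <= D -> kind < 4 ->
  node_address t kind a a' + stride < m.
Hypothesis code_le : 2 * d ^ ell <= m.
Hypothesis ell_ge : b ^ D.-1 <= ell.
Hypothesis ell_lt_m : ell < m.
Hypothesis tau_le : tau <= m.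

(** First codes and positions within a bucket are each bounded by the number of walks, at most
    [d ^ ell]; their sum explains the factor 2 in [code_le]. *)
Lemma bucket_get_lt t L a oa j : L <= ell -> j < nw L a (ending oa) ->
  let s := node_size e b t L a oa in
  let: (thr, (_, f), (_, f')) := node_table e b t L a oa (j %/ s) in
  [/\ s < m, thr < m, f + j %% s < m & f' + (j %% s - thr) < m] /\ (f < m /\ f' < m).
Proof.
move=> Lell jM s; have s_gt0 := node_size_gt0 t jM; rewrite -/s in s_gt0.
have Mle : nw L a (ending oa) <= d ^ ell.
  by apply: leq_trans (nw_le_pow L a _ reg) _; rewrite leq_pexp2l.
have := @alias_table_ok _ [::] (node_paths T b t L) (node_weight e b t L a oa) (j %/ s).
rewrite node_total -/(node_size e b t L a oa) -/s -/(node_table e b t L a oa).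
move=> /(_ (leq_ltn_trans (leq_divM _ _) jM)).
have sM : s <= nw L a (ending oa) by rewrite -(node_total e b t) leq_div.
have := ltn_pmod j s_gt0; case: (node_table _ _ _ _ _ _ _) => [[thr [p f]] [p' f']] /=.
have dl : 0 < d ^ ell by rewrite expn_gt0 d_gt0.
move=> js /and5P[t1 _ f1 _ f2]; split; split; lia.
Qed.

(** In every round [piece_ok] bounds the bucket and the piece, which keeps the address inside the
    node. Kind 3 is excluded at depth 0, since a leaf stores a prescribed end. *)
Lemma table_getP t kind a a' j z : t <= D -> kind < 4 -> (t == 0) ==> (kind != 3) ->
  kind_len t kind <= ell ->
  piece_ok e b t (kind_len t kind) a (kind_end kind a') j z ->
  table_safe tbl b m t (node_address t kind a a') j z /\
  table_get tbl b t (node_address t kind a a') j z =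
  enum_rank (piece_get e b t (kind_len t kind) a (kind_end kind a') j z).
Proof.
have str1 : 0 < stride by rewrite /stride; lia.
have str2 : 1 < stride by rewrite /stride; lia.
elim: t kind a a' j z => [|t IH] kind a a' j z tD k4 t_kind Lell.
  move=> _; have := @address_lt 0 kind a a' tD k4 => h.
  have ra : enum_rank a' < m by apply: leq_trans (ltn_ord _) tau_le.
  rewrite /= -[X in tbl X]addn0 !tblP //=; last by lia.
  split; first by rewrite andbT; lia.
  by rewrite /kind_end; move: t_kind; rewrite implyTb => /negPf ->.
set L := kind_len t.+1 kind in Lell *; set oa := kind_end kind a'.
rewrite [piece_ok _ _ _ _ _ _ _ _]/= [piece_get _ _ _ _ _ _ _ _]/= -/L -/oa.
case E : (alias_get _ _ _) => [p o]; case/and3P => jM zL.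
have bt : 0 < b ^ t by rewrite expn_gt0 b_gt0.
set c := z %/ b ^ t; set Ls := node_pieces b t L; set ns := factors e Ls a p.
have s_gt0 := node_size_gt0 t jM; have fm := bucket_get_lt t Lell jM; cbv zeta in fm.
set s := node_size e b t L a oa in s_gt0 fm.
have cb : c < b.
  by rewrite ltn_divLR // -expnS; apply: leq_trans zL (kind_len_le _ _).
have cm : c < size Ls.
  rewrite ltnNge; apply/negP => mz.
  have : 0 < minn (b ^ t) (L - c * b ^ t).
    by rewrite leq_min bt subn_gt0 (leq_ltn_trans _ zL) // leq_divM.
  by rewrite -nth_pieces // nth_default.
have kb : j %/ s < 2 * tau ^ b by apply: node_bucket_lt jM; exact: kind_len_le.
have t0 : tbl (node_address t.+1 kind a a') = s.
  rewrite -[X in tbl X]addn0 tblP //=.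
  by move: fm; case: (node_table _ _ _ _ _ _ _) => [[? [? ?]] [? ?]] [[]].
have t1 : tbl (node_address t.+1 kind a a' + 1) = b ^ t.
  rewrite tblP //=; apply: leq_ltn_trans ell_lt_m; apply: leq_trans ell_ge.
  by rewrite leq_pexp2l //; lia.
have [p1m p2m] : (forall u c', \prod_(n <- take c' (factors e Ls a u)) n < m) /\
    forall u c', nth 0 (factors e Ls a u) c' < m.
  have Lm : d ^ sumn Ls < m.
    apply: leq_ltn_trans (_ : d ^ ell < m); last first.
      by apply: leq_trans code_le; rewrite mul2n -addnn -addn1 leq_add2l expn_gt0 d_gt0.
    by rewrite leq_pexp2l // sumn_pieces.
  by split=> u c'; have [? ?] := factors_le Ls a u c'; apply: leq_ltn_trans Lm.
have tr f : f < 9 -> tbl (node_address t.+1 kind a a' + (2 + 9 * (j %/ s * b + c)) + f) =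
    nth 0 (node_record t kind a a' (j %/ s) c) f.
  move=> f9; rewrite -addnA.
  suff entryE : node_entry t.+1 kind a a' (2 + 9 * (j %/ s * b + c) + f) =
      nth 0 (node_record t kind a a' (j %/ s) c) f.
    rewrite tblP ?stride_record // {}entryE.
    rewrite /node_record -/L -/oa; move: fm.
    case: (node_table _ _ _ _ _ _ _) => [[thr [q1 f1]] [q2 f2]] [[sm tm _ _] [f1m f2m]].
    rewrite /half_record -/L -/Ls.
    have am u c1 c2 : node_address t (child_kind kind u) c1 c2 < m.
      have [k4' _ _] := child_kindP kind u a.
      by have := address_lt c1 c2 (ltnW tD) k4'; lia.
    do 9 ![case: f f9 => [|f] f9; [by rewrite /= ?am ?p1m ?p2m|]].
    by [].
  rewrite /node_entry; have key x : [/\ (2 + 9 * x + f == 0) = false, (2 + 9 * x + f == 1) = false &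
      2 + 9 * x + f - 2 = x * 9 + f] by clear -f9; split; lia.
  have [-> -> ->] := key (j %/ s * b + c).
  by rewrite !(divn_digit, modn_digit).
have rm : node_address t.+1 kind a a' + (2 + 9 * (j %/ s * b + c)) + 9 < m.
  have := @stride_record _ _ 8 kb cb isT; have := @address_lt t.+1 kind a a' tD k4.
  move: (node_address _ _ _ _) (j %/ s * b + c) => A x; lia.
have Am : node_address t.+1 kind a a' + 1 < m.
  by have := @address_lt t.+1 kind a a' tD k4; lia.
move: (node_address t.+1 kind a a') t0 t1 tr rm Am => A t0 t1 tr rm Am.
rewrite [table_safe _ _ _ _ _ _ _]/= [table_get _ _ _ _ _ _]/= t0 t1.
rewrite (negPf (_ : s != 0)) -?lt0n // -/c Am /=.
move: (A + (2 + 9 * (j %/ s * b + c))) tr rm => r tr rm.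
have tr0 := tr 0 isT; rewrite addn0 in tr0.
move: E tr tr0 fm; rewrite /alias_get /node_record -/L -/oa -/s.
case: (node_table _ _ _ _ _ _ _) => [[thr [p1 f1]] [p2 f2]].
rewrite [bucket_get _ _]/= => E tr -> [[_ _ fm1 fm2] _]; rewrite [nth 0 _ 0]/= rm.
move=> ok; have child := child_kind_len k4 cm; rewrite -/L -/Ls in child.
have childell : nth 0 Ls c <= ell.
  by rewrite nth_pieces // (leq_trans (geq_minr _ _)) // (leq_trans (leq_subr _ _)).
move: ok; rewrite -/Ls -/ns -child => ok; rewrite -child in childell.
case: ifP E => _ [pE oE]; move: ok; rewrite /ns -pE -oE => ok; rewrite -?addnA !tr //=.
  have [k4' k3' kE] := child_kindP kind (c < L %/ b ^ t) (nth a p1 c).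
  rewrite -/L -/Ls fm1; have := IH _ _ (nth a p1 c) _ _ (ltnW tD) k4' _ childell.
  by rewrite kE k3' implybT => /(_ _ _ _ isT ok).
have [k4' k3' kE] := child_kindP kind (c < L %/ b ^ t) (nth a p2 c).
rewrite -/L -/Ls fm2; have := IH _ _ (nth a p2 c) _ _ (ltnW tD) k4' _ childell.
by rewrite kE k3' implybT => /(_ _ _ _ isT ok).
Qed.

End NodeTable.

(* Decoding loop: 16 node address, 17 its first word, 15 code, 11 distance, 19 arity. *)
Definition loop_body : cmd :=
  Seq (Block [::
    Op Div 20 15 17; Op Mod 15 15 17; Op Add 21 16 2; ReadTable 21 21;
    Op Div 22 11 21; Op Mod 11 11 21; Op Mul 20 20 19; Op Add 20 20 22;
    Const 22 9; Op Mul 20 22 20; Const 22 2; Op Add 20 22 20; Op Add 20 16 20;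
    ReadTable 21 20])
  (Seq (IfLt 15 21 (Block [:: Op Add 20 20 2])
         (Block [:: Const 22 5; Op Add 20 20 22; Op Defs.Sub 15 15 21]))
  (Block [::
    ReadTable 21 20; Op Add 15 21 15; Op Add 20 20 2; ReadTable 21 20; Op Div 15 15 21;
    Op Add 20 20 2; ReadTable 21 20; Op Mod 15 15 21; Op Add 20 20 2; ReadTable 16 20;
    ReadTable 17 16])).

Section Loop.
Variables (w : nat) (data table : nat -> nat) (b : nat).
Hypothesis w_gt3 : 3 < w.
Local Notation wp := (wp w data table).

(** [table_safe] excludes overflow, and a round takes at most 30 instructions besides the two jumps
    of the loop. On exit register 16 addresses a leaf, whose answer is loaded afterwards. *)
Lemma loopP fuel R Q A j z : table_safe table b (2 ^ w) fuel A j z -> j < 2 ^ w -> z < 2 ^ w ->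
  R 2 = 1 -> R 11 = z -> R 15 = j -> R 16 = A -> R 17 = table A -> R 18 = 0 -> R 19 = b ->
  (forall R', R' 2 = 1 -> R' 16 + 1 < 2 ^ w ->
     table (R' 16 + 1) = table_get table b fuel A j z -> Q R') ->
  wp (WhileLt 18 17 loop_body) R (32 * fuel + 2) Q.
Proof.
have w16 : 2 ^ 4 <= 2 ^ w by rewrite leq_exp2l.
elim: fuel R A j z => [|fuel IH] R A j z safe jw zw R2 R11 R15 R16 R17 R18 R19 QR.
  move: safe; rewrite /= orbF => /andP[Aw s0].
  apply: wp_stop; rewrite ?R17 ?R18 //; first by rewrite (eqP s0).
  by apply: QR => //; rewrite R16 //= s0.
have [s0|s_gt0] := posnP (table A).
  move: safe => /= /andP[Aw _].
  apply: wp_stop; rewrite ?R17 ?R18 //; [lia|by rewrite s0|].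
  by apply: QR => //; rewrite R16 //= s0.
have s0 : (table A == 0) = false by lia.
move: safe QR => /=; rewrite s0 /=.
set s := table A in s_gt0 s0 R17 *; set p := j %% s; set l := table (A + 1).
set m := j %/ s * b + z %/ l; set r := A + (2 + 9 * m).
set lt := p < table r; set r' := if lt then r + 1 else r + 5.
set p' := if lt then p else p - table r; set o := table r' + p'.
case/and4P=> Aw rw ow safe QR.
have r'w : r' + 3 < 2 ^ w by rewrite /r'; case: (lt); lia.
apply: (@wp_loop _ _ _ _ _ _ _ _ 30 (32 * fuel + 2)); first lia.
  by rewrite R17 R18.
have js : j %/ s <= j by exact: leq_div.
have zl : z %/ l <= z by exact: leq_div.
apply: (@wp_seq _ _ _ _ _ _ 14 16) => //.
apply: wp_block => //.
apply: (step_div (v := j %/ s)); [by rewrite R15 R17|lia|].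
apply: (step_mod (v := p)); [by rewrite /upd /= R15 R17| |].
  by apply: leq_ltn_trans jw; exact: leq_mod.
apply: (step_add (v := A + 1)); [by rewrite /upd /= R16 R2|lia|].
apply: (step_table (v := l)); first by rewrite /upd.
apply: (step_div (v := z %/ l)); [by rewrite /upd /= R11|lia|].
apply: (step_mod (v := z %% l)); [by rewrite /upd /= R11| |].
  by apply: leq_ltn_trans zw; exact: leq_mod.
have mw : 9 * m < 2 ^ w by rewrite /r in rw; lia.
apply: (step_mul (v := j %/ s * b)); [by rewrite /upd /= R19| |].
  by apply: (@leq_ltn_trans m); [exact: leq_addr|lia].
apply: (step_add (v := m)); [by rewrite /upd /=|lia|].
apply: (step_const (v := 9)); [by []|lia|].
apply: (step_mul (v := 9 * m)); [by rewrite /upd /=|lia|].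
apply: (step_const (v := 2)); [by []|lia|].
apply: (step_add (v := 2 + 9 * m)); [by rewrite /upd /=|rewrite /r in rw; lia|].
apply: (step_add (v := r)); [by rewrite /upd /= R16|lia|].
apply: (step_table (v := table r)); first by rewrite /upd.
apply: step_nil; set R1 := upd _ 21 (table r).
have R1E x : x \in [:: 2; 18; 19] -> R1 x = R x.
  by move=> xin; rewrite /R1 !updN //; apply: contraTneq xin => ->.
have [R1_15 R1_20 R1_21 R1_11] : [/\ R1 15 = p, R1 20 = r, R1 21 = table r & R1 11 = z %% l] by [].
move: R1 R1E R1_15 R1_20 R1_21 R1_11 => R1 R1E R1_15 R1_20 R1_21 R1_11.
have pw : p < 2 ^ w by apply: leq_ltn_trans jw; exact: leq_mod.
have next : wp (IfLt 15 21 (Block [:: Op Add 20 20 2])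
         (Block [:: Const 22 5; Op Add 20 20 22; Op Defs.Sub 15 15 21])) R1 5
    (fun R2 => [/\ forall x, x \in [:: 2; 11; 18; 19] -> R2 x = R1 x, R2 20 = r' & R2 15 = p']).
  apply: (@wp_if _ _ _ 15 21 _ _ _ 3); rewrite R1_15 R1_21 /r' /p' /lt => h.
    rewrite h; apply: wp_block => //.
    apply: (step_add (v := r + 1)); [by rewrite R1_20 R1E ?R2|lia|].
    apply: step_nil; split=> // x xin.
    by rewrite updN //; apply: contraTneq xin => ->.
  rewrite ltnNge h /=; apply: wp_block => //.
  apply: (step_const (v := 5)); [by []|lia|].
  apply: (step_add (v := r + 5)); [by rewrite /upd /= R1_20|lia|].
  apply: (step_sub (v := p - table r)); [by rewrite /upd /= R1_15 R1_21|by rewrite /upd /= R1_15 R1_21|lia|].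
  apply: step_nil; split=> // x xin.
  by rewrite !updN //; apply: contraTneq xin => ->.
apply: (@wp_seq _ _ _ _ _ _ 5 11) => //; apply: wp_conseq next => // R2' [R2E R2_20 R2_15].
apply: wp_block => //.
apply: (step_table (v := table r')); first by rewrite R2_20.
apply: (step_add (v := o)); [by rewrite /upd /= R2_15|by []|].
have one : R2' 2 = 1 by rewrite R2E // R1E.
apply: (step_add (v := r' + 1)); [by rewrite /upd /= R2_20 one|lia|].
apply: (step_table (v := table (r' + 1))); first by rewrite /upd.
have ole x : o %/ x < 2 ^ w by apply: leq_ltn_trans ow; exact: leq_div.
apply: (step_div (v := o %/ table (r' + 1))); [by rewrite /upd|by []|].
apply: (step_add (v := r' + 2)); [by rewrite /upd /= one -addnA|lia|].
apply: (step_table (v := table (r' + 2))); first by rewrite /upd.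
have j'w : (o %/ table (r' + 1)) %% table (r' + 2) < 2 ^ w.
  by apply: leq_ltn_trans (ole (table (r' + 1))); exact: leq_mod.
apply: (step_mod (v := (o %/ table (r' + 1)) %% table (r' + 2))); [by rewrite /upd|by []|].
apply: (step_add (v := r' + 3)); [by rewrite /upd /= one -addnA|lia|].
apply: (step_table (v := table (r' + 3))); first by rewrite /upd.
apply: (step_table (v := table (table (r' + 3)))); first by rewrite /upd.
apply: step_nil; apply: (IH _ (table (r' + 3)) ((o %/ table (r' + 1)) %% table (r' + 2)) (z %% l)) => //.
- by apply: leq_ltn_trans zw; exact: leq_mod.
- by rewrite /upd /= R2E // R1E.
- by rewrite /upd /= R2E // R1E.
- by rewrite /upd /= R2E // R1E.
Qed.

End Loop.

(** * The query program *)

Definition setup_code : seq instr := [::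
  Const 2 1; Const 21 0; ReadTable 1 21; Const 21 1; ReadTable 9 21;
  Const 21 2; ReadTable 3 21; Op Add 4 3 2; Const 21 3; ReadTable 5 21;
  Const 21 4; ReadTable 6 21; Const 21 5; ReadTable 7 21; Const 21 6; ReadTable 20 21]
  ++ read_code ++ [:: Const 21 7; ReadTable 21 21; Op Mod 8 20 21;
  Op Div 10 0 0; Op Defs.Sub 10 0 10; Op Mod 11 10 9; Op Div 10 10 9;
  Op Add 13 10 2; Op Add 13 13 2].

Definition piece_code : cmd :=
  Seq (IfLt 10 3 (Block [:: Const 21 8; ReadTable 16 21]) (Block [:: Const 21 9; ReadTable 16 21]))
  (Seq (Block [:: Op Mul 14 14 7; Op Add 14 14 12; Const 21 10; ReadTable 21 21;
    Op Mul 14 21 14; Op Add 16 16 14; ReadTable 17 16; Const 18 0;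
    Const 21 11; ReadTable 19 21])
  (Seq (WhileLt 18 17 loop_body)
  (Block [:: Op Add 16 16 2; ReadTable 0 16]))).

Definition query_code : cmd :=
  Seq (Block setup_code)
  (Seq element_code
  (Seq (Block [:: Op Mod 12 25 7; Op Add 13 10 2])
  (Seq element_code
  (Seq (Block [:: Op Mod 14 25 7; Op Div 15 25 7])
  (IfLt 0 2 (Block [:: Op Mul 0 14 2]) piece_code))))).

Section Query.
Variables (T : finType) (e : rel T) (d : nat) (x0 : T).
Variables (n ell b D G X H w al Bd : nat) (table : nat -> nat).
Local Notation h3 := (3 ^ al.+1).
Local Notation tau := #|T|.
Local Notation N := (blocks n ell).
Local Notation tl := (tail n ell).

Definition node_base := record_base + 8 * h3.
(** Depth [D] is the last one and kinds are below 4, so [root_address 4] is the end of the table. *)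
Definition root_address kind := node_base + stride T b * ((D * 4 + kind) * tau * tau).

Arguments root_address : simpl never.
Arguments stride : simpl never.

Definition header : seq nat :=
  [:: w; ell; N; h3; top_spill N X G H; tau; final_pos n ell G X H;
      2 ^ final_bits T d n ell G X H; root_address 1; root_address 3; stride T b; b].

Hypothesis b_gt0 : 0 < b.
Hypothesis ell_gt0 : 0 < ell.
Hypothesis ell_lt : ell < b ^ D.
Hypothesis d_gt0 : 0 < d.
Hypothesis reg : regular_graph e d.
Hypothesis X_gt0 : 0 < X.
Hypothesis N_lt : N < 2 ^ H.
Hypothesis G_gt0 : 0 < G.

Hypothesis w_gt3 : 3 < w.
Hypothesis Bd_le : 16 * Bd <= 2 ^ w.
Hypothesis n_le : n + 16 <= Bd.
Hypothesis h3_le : 8 * h3 + 32 <= Bd.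
Hypothesis pos_le : final_pos n ell G X H <= Bd.
Hypothesis len_le : forall k t, 2 ^ word_bits G (slots N X G k t) <= Bd.
Hypothesis final_le : 2 ^ final_bits T d n ell G X H <= Bd.
Hypothesis value_le : maxn X (tau * d ^ tl) <= Bd.
Hypothesis code_le : 2 * d ^ ell <= Bd.
Hypothesis address_le : root_address 4 <= Bd.

Hypothesis top_le : top_spill N X G H <= Bd.
Hypothesis full_le : forall k, full_spill X G k <= Bd.
Hypothesis ell_ge : b ^ D.-1 <= ell.
Hypothesis ell_le : ell <= Bd.
Hypothesis tau_le : tau <= Bd.
Hypothesis H_le : H <= 3 ^ al.

(** The record of level [k] is in the slot [2 ^ k %% h3]; by [pow2_hash] the level picked for a slot
    is unique. Slots met by no level contain 0. *)
Definition table_word m :=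
  if m < 12 then nth 0 header m
  else if m < node_base then
    if [pick k : 'I_H | 2 ^ k %% h3 == (m - record_base) %/ 8] is Some k
    then nth 0 (level_record N X G k) ((m - record_base) %% 8) else 0
  else node_cell e x0 b ell tl node_base (m - node_base).

Hypothesis tableE : forall m, m < root_address 4 -> table m = table_word m %% 2 ^ w.

Lemma node_address_root kind (a a' : T) :
  node_address b node_base D kind a a' =
  root_address kind + stride T b * (enum_rank a * tau + enum_rank a').
Proof.
rewrite /node_address /root_address -addnA -mulnDr; congr (_ + _ * _).
by rewrite [(_ * _ + enum_rank a) * _]mulnDl -addnA.
Qed.

Lemma node_address_le t kind (a a' : T) : t <= D -> kind < 4 ->
  node_address b node_base t kind a a' + stride T b <= root_address 4.
Proof.
move=> tD k4; rewrite /node_address /root_address -addnA leq_add2l -mulnSr leq_mul2l.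
apply/orP; right; have ra := ltn_ord (enum_rank a); have ra' := ltn_ord (enum_rank a').
rewrite -addnS; apply: (@leq_trans (((t * 4 + kind) * tau + enum_rank a).+1 * tau)).
  by rewrite mulSn addnC leq_add2r.
rewrite leq_mul2r; apply/orP; right; rewrite -addnS.
apply: (@leq_trans ((t * 4 + kind).+1 * tau)); first by rewrite mulSn addnC leq_add2r.
by rewrite leq_mul2r; apply/orP; right; lia.
Qed.

Lemma h3_gt0 : 0 < h3. Proof. by rewrite expn_gt0. Qed.

Lemma tau_gt0 : 0 < tau. Proof. by apply/card_gt0P; exists x0. Qed.

Lemma node_base_le : node_base <= root_address 4.
Proof. exact: leq_addr. Qed.

Lemma stride_le : stride T b <= root_address 4.
Proof.
apply: leq_trans (leq_addl _ _); rewrite leq_pmulr // !muln_gt0 tau_gt0 /=; lia.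
Qed.

Lemma headerP f : f < 12 -> table f = nth 0 header f.
Proof.
move=> f12; have t1 := tau_gt0; have rb := node_base_le.
have b_le : b <= stride T b.
  have : 1 * b <= tau ^ b * b by rewrite leq_mul2r expn_gt0 t1 orbT.
  by rewrite /stride; lia.
have r4 k : k < 4 -> root_address k <= root_address 4.
  move=> k4; rewrite leq_add2l leq_mul2l leq_mul2r leq_mul2r; apply/orP; right.
  by apply/orP; right; apply/orP; right; lia.
have [r1 r3] : root_address 1 <= Bd /\ root_address 3 <= Bd.
  by split; apply: leq_trans address_le; apply: r4.
have ts : top_spill N X G H <= Bd by apply: top_le.
have N_n : N <= n by exact: leq_div.
have s4 := stride_le; have ww : w < 2 ^ w by apply: ltn_expl.
rewrite tableE; last by apply: leq_trans node_base_le; rewrite /node_base /record_base ltn_addr.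
rewrite /table_word f12 modn_small //.
suff: all (fun u => u < 2 ^ w) header by move/(all_nthP 0)/(_ f f12).
rewrite /=; repeat (apply/andP; split); try lia.
by apply: leq_ltn_trans tau_le _; lia.
Qed.

Lemma recordP k f : k < H -> f < 7 ->
  table (record_base + 8 * (2 ^ k %% h3) + f) = nth 0 (level_record N X G k) f.
Proof.
move=> kH f7; have hm : 2 ^ k %% h3 < h3 by rewrite ltn_mod h3_gt0.
have mb : record_base + 8 * (2 ^ k %% h3) + f < node_base by rewrite /node_base; lia.
rewrite tableE; last by apply: leq_trans mb node_base_le.
rewrite /table_word mb [_ < 12]ltnNge -addnA leq_addr addKn /= mulnC.
have f8 : f < 8 by lia.
rewrite divn_digit // modn_digit //; case: pickP => [k' /eqP kk|/(_ (Ordinal kH))]; last by rewrite eqxx.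
have -> : val k' = k by apply: pow2_hash kk; [apply: leq_trans (ltn_ord k') H_le|apply: leq_trans kH H_le].
rewrite modn_small //.
have lp : level_pos N X G k <= Bd.
  by apply: leq_trans pos_le; apply: level_pos_mono; exact: ltnW.
have wb t : word_bits G (slots N X G k t) <= Bd.
  by apply: leq_trans (ltnW (ltn_expl _ (isT : 1 < 2))) (len_le _ _).
have ct t : content_size G (slots N X G k t) <= Bd by apply: leq_trans (leq_div _ _) (len_le _ _).
have l1 := len_le k false; have l2 := len_le k true.
have w1 := wb false; have c1 := ct false; have c2 := ct true; have fs := full_le k.
suff: all (fun u => u < 2 ^ w) (level_record N X G k) by move/(all_nthP 0)/(_ f f7).
by rewrite /=; repeat (apply/andP; split); lia.
Qed.

Lemma nodeP t kind c c' f : t <= D -> kind < 4 -> f < stride T b ->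
  node_entry e b ell tl node_base t kind c c' f < 2 ^ w ->
  table (node_address b node_base t kind c c' + f) =
  node_entry e b ell tl node_base t kind c c' f.
Proof.
move=> tD k4 fs ew; have := node_address_le c c' tD k4 => le.
have ge : node_base <= node_address b node_base t kind c c' by exact: leq_addr.
rewrite tableE; last by lia.
rewrite /table_word [_ < 12]ltnNge; have -> : 12 <= node_address b node_base t kind c c' + f.
  by move: ge; rewrite /node_base /record_base; lia.
rewrite [_ < node_base]ltnNge (leq_trans ge (leq_addr _ _)) /=.
rewrite -addnBAC // node_cellE // modn_small //.
Qed.

Lemma vtx_rank r : r < tau -> enum_rank (vtx x0 r) = r :> nat.
Proof.
by move=> rt; rewrite /vtx -[r]/(val (Ordinal rt)) -enum_val_nth enum_valK.
Qed.

Variables (v : nat -> T) (x : nat -> nat) (y : nat).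
Hypothesis xyP : encodes e d n ell b D X v x y.

Local Notation mem := (memory T d n ell G X H x y).
Local Notation data := (cell w mem).
Local Notation rd := (bitsval (nth false mem)).
Local Notation runs := (runs w data table).
Local Notation wp := (wp w data table).
Local Notation elem := (element T d n ell G X H rd).

Let F := rd (final_pos n ell G X H) (final_bits T d n ell G X H).

Definition consts R q :=
  [/\ [/\ R 0 = q, R 1 = w, R 2 = 1, R 3 = N & R 4 = N.+1],
      [/\ R 5 = h3, R 6 = top_spill N X G H, R 7 = tau & R 8 = F] &
      [/\ R 10 = q.-1 %/ ell & R 11 = q.-1 %% ell]].

Lemma setup_codeP R Q q : q <= n -> R 0 = q ->
  (forall R', consts R' q -> R' 13 = (q.-1 %/ ell).+2 -> Q R') -> runs setup_code R Q.
Proof.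
move=> qn R0 QR.
have ww : w < 2 ^ w by apply: ltn_expl.
have N_n : N <= n by exact: leq_div.
have iN : q.-1 %/ ell <= n by apply: leq_trans (leq_div _ _) _; lia.
rewrite /setup_code; apply: step_cat.
apply: (step_const (v := 1)); [by []|lia|].
apply: (step_const (v := 0)); [by []|lia|].
apply: (step_table (v := w)); first by rewrite /upd /= headerP.
apply: (step_const (v := 1)); [by []|lia|].
apply: (step_table (v := ell)); first by rewrite /upd /= headerP.
apply: (step_const (v := 2)); [by []|lia|].
apply: (step_table (v := N)); first by rewrite /upd /= headerP.
apply: (step_add (v := N.+1)); [by rewrite /upd /= addn1|lia|].
apply: (step_const (v := 3)); [by []|lia|].
apply: (step_table (v := h3)); first by rewrite /upd /= headerP.
apply: (step_const (v := 4)); [by []|lia|].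
apply: (step_table (v := top_spill N X G H)); first by rewrite /upd /= headerP.
apply: (step_const (v := 5)); [by []|lia|].
apply: (step_table (v := tau)); first by rewrite /upd /= headerP.
apply: (step_const (v := 6)); [by []|lia|].
apply: (step_table (v := final_pos n ell G X H)); first by rewrite /upd /= headerP.
apply: step_nil; apply: step_cat.
have N_le : N + 16 <= Bd by apply: leq_trans n_le; rewrite leq_add2r.
apply: (read_codeP table w_gt3 Bd_le N_le h3_le h3_gt0 pos_le N_lt G_gt0
  (pos := final_pos n ell G X H)) => //.
move=> R' R'20 R'E.
apply: (step_const (v := 7)); [by []|lia|].
apply: (step_table (v := 2 ^ final_bits T d n ell G X H)); first by rewrite /upd /= headerP.
have fw : final_bits T d n ell G X H <= w.
  by rewrite -(leq_exp2l _ _ (isT : 1 < 2)); apply: leq_trans final_le _; lia.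
apply: (step_mod (v := F)).
- by rewrite /upd /= R'20 bitsval_mod.
- by apply: leq_trans (bitsval_lt _ _ _) _; rewrite leq_exp2l.
have [R'0 R'9 R'2] : [/\ R' 0 = q, R' 9 = ell & R' 2 = 1] by split; rewrite R'E.
(* The quotient [q %/ q] is 1 unless [q = 0], when division by zero gives 0; subtracting it yields
   [q.-1] without a branch. *)
apply: (step_div (v := 0 < q)).
- by rewrite /upd /= R'0; case: (q) => // q'; rewrite divnn.
- by case: (0 < q); lia.
apply: (step_sub (v := q.-1)).
- by rewrite /upd /= R'0; case: (q).
- by rewrite /upd /= R'0; case: (q) => // q'; rewrite subn1.
- by lia.
apply: (step_mod (v := q.-1 %% ell)); [by rewrite /upd /= R'9| |].
  by apply: leq_ltn_trans (leq_mod _ _) _; lia.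
apply: (step_div (v := q.-1 %/ ell)); [by rewrite /upd /= R'9|lia|].
apply: (step_add (v := (q.-1 %/ ell).+1)); [by rewrite /upd /= R'2 addn1|lia|].
apply: (step_add (v := (q.-1 %/ ell).+2)); [by rewrite /upd /= R'2 addn1|lia|].
by apply: step_nil; apply: QR => //; split; split; rewrite /upd /= ?R'E.
Qed.

Lemma consts_eq R R' q : (forall r, r < 12 -> R' r = R r) -> consts R q -> consts R' q.
Proof.
move=> RE [[? ? ? ? ?] [? ? ? ?] [? ?]].
by split; split; rewrite RE.
Qed.

Lemma element_wp R Q q i : consts R q -> i <= N.+1 -> R 13 = i.+1 ->
  (forall R', consts R' q -> R' 25 = elem i.+1 -> R' 12 = R 12 -> Q R') ->
  wp element_code R 92 Q.
Proof.
move=> cR iN R13 QR; have [[? ? ? ? ?] [? ? ? ?] [? ?]] := cR.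
have N_n : N <= n by exact: leq_div.
have N_le : N + 16 <= Bd by apply: leq_trans n_le; rewrite leq_add2r.
have D_gt0 : 0 < D by case: (D) ell_lt; rewrite ?expn0; lia.
apply: (element_codeP w_gt3 Bd_le N_le h3_le h3_gt0 pos_le len_le N_lt G_gt0 recordP
  (i := i.+1) (F := F)) => //.
- by apply: leq_trans (bitsval_lt _ _ _) _; apply: leq_trans final_le _; lia.
- apply: leq_trans value_le; apply: ltnW.
  exact: (element_lt b_gt0 ell_gt0 (ltnW ell_lt) D_gt0 X_gt0 N_lt G_gt0 xyP iN).
- move=> R' R'25 R'E; apply: QR => //; last by rewrite R'E.
  by apply: consts_eq cR => r r12; rewrite R'E // ltnW.
Qed.

Lemma query_codeP q : q <= n ->
  wp query_code (upd (fun=> 0) 0 (q %% 2 ^ w)) (300 + 32 * D) (fun R => R 0 = enum_rank (v q)).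
Proof.
move=> qn; have N_n : N <= n by exact: leq_div.
have D_gt0 : 0 < D by case: (D) ell_lt; rewrite ?expn0; lia.
have [ansE ok] := answerP x0 b_gt0 ell_gt0 (ltnW ell_lt) D_gt0 X_gt0 N_lt G_gt0 xyP qn.
have iN : q.-1 %/ ell <= N by apply: leq_div2r; lia.
have tau_gt0 : 0 < tau by apply/card_gt0P; exists x0.
set i := q.-1 %/ ell in iN ok; set z := q.-1 %% ell in ok.
pose j := elem i.+1 %/ tau.
have elt k : k <= N.+1 -> elem k.+1 < 2 ^ w.
  move=> kN; apply: leq_trans (element_lt b_gt0 ell_gt0 (ltnW ell_lt) D_gt0 X_gt0 N_lt G_gt0 xyP kN) _.
  by apply: leq_trans value_le _; lia.
have startE k : elem k.+1 %% tau = enum_rank (piece_start d x0 n ell G X H rd k).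
  by rewrite vtx_rank // ltn_mod.
apply: (@wp_seq _ _ _ _ _ _ 34 (266 + 32 * D)); first by lia.
apply: wp_block => //; apply: (setup_codeP (q := q)) => //.
  by rewrite /upd /= modn_small //; lia.
move=> R1 c1 R1_13.
apply: (@wp_seq _ _ _ _ _ _ 92 (174 + 32 * D)); first by lia.
(* The next element is read before that of the block itself: only its start vertex matters later,
   and it survives the second reading in register 12. *)
apply: (element_wp c1 (i := i.+1)) => // R2 c2 R2_25 _.
have [[_ _ R2_2 _ _] [_ _ R2_7 _] [R2_10 _]] := c2.
apply: (@wp_seq _ _ _ _ _ _ 2 (172 + 32 * D)); first by lia.
apply: wp_block => //.
apply: (step_mod (v := elem i.+2 %% tau)); [by rewrite R2_25 R2_7| |].
  by apply: leq_ltn_trans (leq_mod _ _) (elt _ _).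
apply: (step_add (v := i.+1)); [by rewrite /upd /= R2_10 R2_2 addn1|lia|].
apply: step_nil.
apply: (@wp_seq _ _ _ _ _ _ 92 (80 + 32 * D)); first by lia.
apply: (element_wp (q := q) (i := i)); [|by lia|by []|].
  by apply: consts_eq c2 => r r12; rewrite !updN //; lia.
move=> R3 c3 R3_25 R3_12.
have [[R3_0 _ R3_2 R3_3 _] [_ _ R3_7 _] [R3_10 R3_11]] := c3.
apply: (@wp_seq _ _ _ _ _ _ 2 (78 + 32 * D)); first by lia.
apply: wp_block => //.
apply: (step_mod (v := elem i.+1 %% tau)); [by rewrite R3_25 R3_7| |].
  by apply: leq_ltn_trans (leq_mod _ _) (elt _ _); lia.
apply: (step_div (v := j)); [by rewrite /upd /= R3_25 R3_7| |].
  by apply: leq_ltn_trans (leq_div _ _) (elt _ _); lia.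
apply: step_nil.
apply: (@wp_if _ _ _ 0 2 _ _ _ (76 + 32 * D)).
  rewrite /upd /= R3_0 R3_2 => q0; have {}q0 : q = 0 by lia.
  apply: wp_block => //.
  apply: (step_mul (v := elem i.+1 %% tau)); [by rewrite /upd /= R3_2 muln1| |].
    by apply: leq_ltn_trans (leq_mod _ _) (elt _ _); lia.
  apply: step_nil; rewrite /upd /= startE.
  have q00 : (q == 0) = true by rewrite q0.
  by rewrite -ansE /answer q00.
move=> q_gt0; have {}q_gt0 : 0 < q by move: q_gt0; rewrite /upd /= R3_0 R3_2.
have {}ok := ok q_gt0; cbv zeta in ok.
have qE : (q == 0) = false by lia.
rewrite -/(elem _) -/j in ok; set a := piece_start d x0 n ell G X H rd i in ok.
set a' := piece_start d x0 n ell G X H rd i.+1 in ok.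
(* In the partial block [a'] is not an end of the piece; it only selects one of the nodes of kind 3,
   which all have a free end. *)
pose kind := if i < N then 1 else 3.
have tl_lt : tl < ell by rewrite ltn_mod.
have lenE : kind_len b ell tl D kind = if i < N then ell else tl.
  by rewrite /kind_len /kind; case: (i < N) => /=; rewrite modn_small // (ltn_trans tl_lt).
have {}ok : piece_ok e b D (kind_len b ell tl D kind) a (kind_end kind a') j z.
  by move: ok; rewrite lenE /kind /kind_end; case: ifP.
have k4 : kind < 4 by rewrite /kind; case: ifP.
have address_lt t k (c c' : T) : t <= D -> k < 4 ->
    node_address b node_base t k c c' + stride T b < 2 ^ w.
  by move=> tD k4'; apply: leq_ltn_trans (node_address_le c c' tD k4') _; lia.
have cw : 2 * d ^ ell <= 2 ^ w by lia.
have [ellw tauw] : ell < 2 ^ w /\ tau <= 2 ^ w by lia.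
have [||safe getE] := table_getP b_gt0 d_gt0 reg nodeP address_lt cw
    ell_ge ellw tauw (leqnn D) k4 _ _ ok.
- by rewrite (negPf (_ : D != 0)) // -lt0n.
- by rewrite lenE; case: ifP => // _; exact: ltnW.
have {}getE : table_get table b D (node_address b node_base D kind a a') j z
    = enum_rank (v q).
  by rewrite getE -ansE /answer qE lenE -/i -/z -/(elem _) -/j /kind /kind_end -/a -/a'; case: ifP.
rewrite /piece_code.
set R4 := upd _ 15 j.
have [R4_2 R4_3 R4_7 R4_10 R4_11] : [/\ R4 2 = 1, R4 3 = N, R4 7 = tau, R4 10 = i & R4 11 = z] by [].
have [R4_12 R4_14 R4_15] : [/\ R4 12 = enum_rank a', R4 14 = enum_rank a & R4 15 = j].
  by split=> //; rewrite /R4 /upd /= ?R3_12 /upd //= startE.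
move: R4 R4_2 R4_3 R4_7 R4_10 R4_11 R4_12 R4_14 R4_15.
move=> R4 R4_2 R4_3 R4_7 R4_10 R4_11 R4_12 R4_14 R4_15.
have rootE : wp (IfLt 10 3 (Block [:: Const 21 8; ReadTable 16 21])
      (Block [:: Const 21 9; ReadTable 16 21])) R4 4
    (fun R5 => R5 16 = root_address kind /\ forall r, r \in [:: 2; 7; 11; 12; 14; 15] -> R5 r = R4 r).
  apply: (@wp_if _ _ _ 10 3 _ _ _ 2); rewrite R4_10 R4_3 /kind => h.
    rewrite h; apply: wp_block => //; apply: (step_const (v := 8)); [by []|lia|].
    apply: (step_table (v := root_address 1)); first by rewrite /upd /= headerP.
    apply: step_nil; split=> // r rin.
    by rewrite !updN //; apply: contraTneq rin => ->.
  rewrite ltnNge h /=; apply: wp_block => //; apply: (step_const (v := 9)); [by []|lia|].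
  apply: (step_table (v := root_address 3)); first by rewrite /upd /= headerP.
  apply: step_nil; split=> // r rin.
  by rewrite !updN //; apply: contraTneq rin => ->.
apply: (@wp_seq _ _ _ _ _ _ 4 (72 + 32 * D)); first by lia.
apply: wp_conseq rootE => // R5 [R5_16 R5E].
apply: (@wp_seq _ _ _ _ _ _ 10 (62 + 32 * D)); first by lia.
apply: wp_block => //.
have := node_address_le a a' (leqnn D) k4; have rootA := node_address_root kind a a'.
set ra := nat_of_ord (enum_rank a) in R4_14 rootA *; set ra' := nat_of_ord (enum_rank a') in R4_12 rootA *.
set A := node_address _ _ _ _ _ _ in safe getE rootA *; move=> A_le.
have s_gt0 : 0 < stride T b by rewrite /stride; lia.
have rlt : ra * tau + ra' <= stride T b * (ra * tau + ra') by rewrite leq_pmull.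
apply: (step_mul (v := ra * tau)); [by rewrite !R5E // R4_14 R4_7|lia|].
apply: (step_add (v := ra * tau + ra')); [by rewrite /upd /= R5E // R4_12|lia|].
apply: (step_const (v := 10)); [by []|lia|].
apply: (step_table (v := stride T b)); first by rewrite /upd /= headerP.
apply: (step_mul (v := stride T b * (ra * tau + ra'))); [by rewrite /upd|lia|].
apply: (step_add (v := A)); [by rewrite /upd /= R5_16 rootA|lia|].
apply: (step_table (v := table A)); first by rewrite /upd.
apply: (step_const (v := 0)); [by []|lia|].
apply: (step_const (v := 11)); [by []|lia|].
apply: (step_table (v := b)); first by rewrite /upd /= headerP.
apply: step_nil.
apply: (@wp_seq _ _ _ _ _ _ (32 * D + 2) 2); first by lia.
apply: (loopP data w_gt3 safe) => //.
- by apply: leq_ltn_trans (leq_div _ _) (elt _ _); lia.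
- by apply: leq_ltn_trans (leq_mod _ _) _; lia.
- by rewrite /upd /= R5E.
- by rewrite /upd /= R5E.
- by rewrite /upd /= R5E.
move=> R6 R6_2 Aw tE; apply: wp_block => //.
apply: (step_add (v := R6 16 + 1)); [by rewrite R6_2|by []|].
apply: (step_table (v := enum_rank (v q))); first by rewrite /upd /= tE getE.
by apply: step_nil.
Qed.

End Query.

(** * Choice of parameters *)

Lemma table_exists (word : nat -> nat) w r len : 0 < w -> len * w <= r ->
  exists table : r.-tuple bool, forall m, m < len -> cell w table m = word m %% 2 ^ w.
Proof.
move=> w_gt0 lr.
exists [tuple odd ((word (p %/ w) %% 2 ^ w) %/ 2 ^ (p %% w)) | p < r] => m ml.
rewrite cellE; apply: bitsval_of_nat => [|j jw]; first by rewrite ltn_mod expn_gt0.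
have plt : m * w + j < r.
  apply: leq_trans lr; apply: (@leq_trans (m.+1 * w)); last by rewrite leq_mul2r ml orbT.
  by rewrite mulSn addnC ltn_add2r.
rewrite (_ : nth _ _ _ = tnth [tuple odd ((word (p %/ w) %% 2 ^ w) %/ 2 ^ (p %% w)) | p < r] (Ordinal plt)).
  by rewrite tnth_mktuple /= divn_digit // modn_digit.
by rewrite (tnth_nth false).
Qed.

(** * Parameters for a given walk length and arity *)

Section Instance.
Variables (T : finType) (e : rel T) (d c : nat) (x0 : T).
Local Notation tau := #|T|.
Hypothesis c_gt0 : 0 < c.
Hypothesis d_gt1 : 1 < d.
Hypothesis reg : regular_graph e d.
Hypothesis mixes : forall h a b,
  2 ^ h * (tau * nw e (c * (h + tau)) a (pred1 b)) <= (2 ^ h).+1 * d ^ (c * (h + tau)).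

Variables (n b : nat).
Hypothesis b_gt1 : 1 < b.

Definition log_size := (trunc_log 2 n).+1.
Local Notation h0 := log_size.
(** The length at which mixing has relative error [1 / (2 * G ^ 2)]. *)
Definition block_len := c * ((2 * (h0 + 3)).+1 + tau).
Local Notation ell := block_len.
Definition depth := (trunc_log b ell).+1.
(** Exceeds [8 * n], hence six times the number of blocks. *)
Definition guard := 2 ^ (h0 + 3).
Local Notation G := guard.
Definition value_bound := (G.+1 * d ^ ell) %/ G.
Local Notation X := value_bound.
(** [3 ^ hash_exp] is the first power of 3 above [h0]: the hash is injective on all levels, with a
    range of at most [9 * h0] slots. *)
Definition hash_exp := (trunc_log 3 h0).+1.
(** Chosen so that [2 ^ (scale * ell)] bounds all words, fields, values and addresses of a query. *)
Definition scale := 2 * d + tau + 8.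

Lemma tau_pos : 0 < tau. Proof. by apply/card_gt0P; exists x0. Qed.

Lemma n_lt : n < 2 ^ h0. Proof. exact: trunc_log_ltn. Qed.

Lemma block_len_ge : 2 * h0 + 8 <= ell.
Proof.
have t_gt0 := tau_pos; rewrite /block_len.
by apply: leq_trans (leq_pmull _ c_gt0); lia.
Qed.

Lemma tau_le_block : tau + 7 <= ell.
Proof. by rewrite /block_len; apply: leq_trans (leq_pmull _ c_gt0); lia. Qed.

Lemma guard_gt0 : 0 < G. Proof. by rewrite expn_gt0. Qed.

Lemma blocks_lt : blocks n ell < 2 ^ h0.
Proof. exact: leq_ltn_trans (leq_div _ _) n_lt. Qed.

(** The mixing factor [1 + 1 / (2 * G ^ 2)] is well within the factor [1 + 1/G] built into [X]. *)
Lemma value_bound_piece a a' : tau * nw e ell a (pred1 a') <= X.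
Proof.
rewrite leq_divRL ?guard_gt0 // mulnC.
have := mixes (2 * (h0 + 3)).+1 a a'; rewrite -/ell.
have -> : 2 ^ (2 * (h0 + 3)).+1 = G * (2 * G) by rewrite expnS [2 * (_ + _)]mul2n -addnn expnD mulnCA.
move: (tau * _) (d ^ ell) guard_gt0 => x y; move: G => g g_gt0 h.
rewrite -(@leq_pmul2l (2 * g)); last by lia.
apply: (@leq_trans ((g * (2 * g)).+1 * y)); first by rewrite mulnA [2 * g * g]mulnC.
rewrite [2 * g * (_ * y)]mulnA leq_mul2r; apply/orP; right; rewrite mulnS [g * _]mulnC; lia.
Qed.

Lemma value_bound_le : X * G <= G.+1 * d ^ ell.
Proof. exact: leq_divM. Qed.

Lemma value_bound_ge : d ^ ell <= X.
Proof. by rewrite leq_divRL ?guard_gt0 // mulnC leq_mul2r leqnSn orbT. Qed.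

Lemma pow2_le_block k : k <= ell -> 2 ^ k <= d ^ ell.
Proof.
move=> kl; apply: (@leq_trans (2 ^ ell)); first by rewrite leq_exp2l.
by rewrite leq_exp2r //; have := block_len_ge; lia.
Qed.

Lemma value_bound_guard : 2 * G * G <= X.
Proof.
apply: leq_trans value_bound_ge; rewrite -mulnA /guard -expnD -expnS.
by apply: pow2_le_block; have := block_len_ge; lia.
Qed.

Lemma block_pow : d ^ ell <= 2 ^ (d * ell).
Proof. by rewrite expnM; case: (ell) => // k; rewrite leq_exp2r // ltnW // ltn_expl. Qed.

Lemma value_bound_pow : X <= 2 ^ (d * ell + 1).
Proof.
apply: (@leq_trans (2 * d ^ ell)); last by rewrite addn1 expnS leq_mul2l block_pow orbT.
rewrite -ltnS ltn_divLR ?guard_gt0 //.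
have : 0 < d ^ ell by rewrite expn_gt0; lia.
have := guard_gt0; move: G (d ^ ell) => g y g0 y0; rewrite mulSn mulSn.
have : g * y <= y * g by rewrite mulnC.
have : 1 * y <= g * y by rewrite leq_mul2r g0 orbT.
rewrite mulnAC -mulnA; lia.
Qed.

Lemma word_pow : 2 * (X * X * G) <= 2 ^ (scale * ell).
Proof.
have X_le := value_bound_pow.
apply: (@leq_trans (2 ^ 1 * (2 ^ (d * ell + 1) * 2 ^ (d * ell + 1) * 2 ^ (h0 + 3)))).
  by rewrite expn1 leq_mul2l; apply/orP; right; rewrite leq_mul2r; apply/orP; right; exact: leq_mul.
rewrite -!expnD leq_exp2l // /scale; have := block_len_ge; rewrite !mulnDl; lia.
Qed.

Lemma final_pow : 2 * (X * (tau * d ^ ell)) <= 2 ^ (scale * ell).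
Proof.
have X_le := value_bound_pow; have t_le : tau <= 2 ^ tau by apply: ltnW; exact: ltn_expl.
apply: (@leq_trans (2 ^ 1 * (2 ^ (d * ell + 1) * (2 ^ tau * 2 ^ (d * ell))))).
  by rewrite expn1 leq_mul2l leq_mul // leq_mul // block_pow.
rewrite -!expnD leq_exp2l // /scale; have := tau_le_block; rewrite !mulnDl; lia.
Qed.

Lemma depth_gt : ell < b ^ depth. Proof. exact: trunc_log_ltn. Qed.

Lemma depth_pred : b ^ depth.-1 <= ell.
Proof. by apply: trunc_logP => //; have := block_len_ge; lia. Qed.

Lemma tail_lt_block : tail n ell < ell.
Proof. by rewrite ltn_mod; have := block_len_ge; lia. Qed.

Local Notation bits := (final_pos n ell G X h0 + final_bits T d n ell G X h0).

Lemma block_len_gt0 : 0 < ell. Proof. by have := block_len_ge; lia. Qed.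

Lemma value_bound_gt0 : 0 < X.
Proof. by apply: leq_trans value_bound_ge; rewrite expn_gt0; lia. Qed.

Lemma guard_gt1 : 1 < G.
Proof. by rewrite -[1]/(2 ^ 0) ltn_exp2l //; lia. Qed.

Lemma depth_gt0 : 0 < depth. Proof. by []. Qed.

Let b_gt0 : 0 < b := ltnW b_gt1.
Let d_gt0 : 0 < d := ltnW d_gt1.

Lemma bits_le : 2 ^ bits <= 8 * (tau * d ^ n).
Proof.
have G_ge : 6 * blocks n ell <= G by have := blocks_lt; rewrite /guard expnD; lia.
exact: (memory_bits x0 b_gt0 block_len_gt0 (ltnW depth_gt) depth_gt0 value_bound_gt0 blocks_lt
  guard_gt0 value_bound_guard value_bound_le G_ge d_gt0).
Qed.

Lemma pow_add x y p q : x <= 2 ^ p -> y <= 2 ^ q -> x + y <= 2 ^ (p + q).+1.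
Proof.
move=> xp yq; rewrite expnS mul2n -addnn.
apply: leq_add; [apply: leq_trans xp _|apply: leq_trans yq _]; rewrite leq_exp2l //; lia.
Qed.

Lemma pow_mul x y p q : x <= 2 ^ p -> y <= 2 ^ q -> x * y <= 2 ^ (p + q).
Proof. by move=> xp yq; rewrite expnD; exact: leq_mul. Qed.

Lemma le_pow x : x <= 2 ^ x. Proof. by apply: ltnW; exact: ltn_expl. Qed.

Local Notation Bd := (2 ^ (scale * ell)).

Lemma hash_exp_le : 3 ^ hash_exp.+1 <= 9 * h0.
Proof. by rewrite /hash_exp !expnS mulnA leq_mul2l trunc_logP. Qed.

Lemma hash_exp_ge : h0 <= 3 ^ hash_exp. Proof. by apply: ltnW; exact: trunc_log_ltn. Qed.

Lemma scaleE : scale * ell = 2 * (d * ell) + tau * ell + 8 * ell.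
Proof. by rewrite /scale 2!mulnDl -mulnA. Qed.

Lemma length_small : n + 16 <= Bd.
Proof.
apply: leq_trans (pow_add (ltnW n_lt) (leqnn (2 ^ 4))) _; rewrite leq_exp2l // scaleE.
by have := block_len_ge; lia.
Qed.

Lemma hash_small : 8 * 3 ^ hash_exp.+1 + 32 <= Bd.
Proof.
apply: (@leq_trans (2 ^ 7 * h0 + 2 ^ 5)); first by have := hash_exp_le; lia.
apply: leq_trans (pow_add (pow_mul (leqnn _) (le_pow _)) (leqnn _)) _.
by rewrite leq_exp2l // scaleE; have := block_len_ge; lia.
Qed.

Lemma position_small : final_pos n ell G X h0 <= Bd.
Proof.
have bl : bits <= 3 + tau + d * n.
  rewrite -(leq_exp2l _ _ (isT : 1 < 2)); apply: leq_trans bits_le _.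
  rewrite !expnD -mulnA leq_mul2l leq_mul ?le_pow // expnM.
  by case: (n) => // k; rewrite leq_exp2r // le_pow.
apply: leq_trans (leq_addr _ _) (leq_trans bl _).
apply: leq_trans (pow_add (le_pow _) (pow_mul (le_pow _) (ltnW n_lt))) _.
rewrite leq_exp2l // scaleE; have := block_len_ge; have := tau_le_block.
have : d * 1 <= d * ell by rewrite leq_mul2l block_len_gt0 orbT.
by lia.
Qed.

Lemma word_small k t : 2 ^ word_bits G (slots (blocks n ell) X G k t) <= Bd.
Proof. exact: leq_trans (word_bits_le _ guard_gt0 value_bound_guard guard_gt1 _ _) word_pow. Qed.

Lemma final_small : 2 ^ final_bits T d n ell G X h0 <= Bd.
Proof.
exact: leq_trans (final_bits_le x0 _ _ block_len_gt0 value_bound_gt0 guard_gt0 value_bound_guard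
  d_gt0 guard_gt1) final_pow.
Qed.

Lemma value_bound_small : X <= Bd.
Proof.
apply: leq_trans final_pow; rewrite mulnCA leq_pmulr // !muln_gt0 tau_pos expn_gt0 d_gt0.
by [].
Qed.

Lemma element_small : maxn X (tau * d ^ tail n ell) <= Bd.
Proof.
rewrite geq_max value_bound_small; apply: leq_trans final_pow.
apply: (@leq_trans (tau * d ^ ell)).
  by rewrite leq_mul2l leq_pexp2l ?orbT // ltnW // tail_lt_block.
by rewrite mulnA leq_pmull // muln_gt0 value_bound_gt0.
Qed.

Lemma code_small : 2 * d ^ ell <= Bd.
Proof.
apply: leq_trans final_pow; rewrite leq_mul2l mulnA leq_pmull //.
by rewrite muln_gt0 value_bound_gt0 tau_pos.
Qed.

Lemma block_len_small : ell <= Bd.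
Proof. by apply: leq_trans (le_pow _) _; rewrite leq_exp2l // scaleE; lia. Qed.

Lemma tau_small : tau <= Bd.
Proof. by apply: leq_trans block_len_small; have := tau_le_block; lia. Qed.

Lemma depth_le : depth <= ell.
Proof.
have := depth_pred; apply: leq_trans; apply: leq_ltn_trans (ltn_expl _ b_gt1).
by [].
Qed.

(** The bound on [b] makes [tau ^ b] polynomial in [n], so that addresses fit in a word. *)
Lemma address_small : b <= h0.+1 -> root_address T b depth hash_exp 4 <= Bd.
Proof.
move=> bh; rewrite /root_address /node_base /record_base /stride.
have tb : tau ^ b <= 2 ^ (tau * b).
  by rewrite expnM leq_exp2r // le_pow.
have hb : 12 + 8 * 3 ^ hash_exp.+1 <= 2 ^ (7 + h0).
  apply: (@leq_trans (2 ^ 7 * h0)); first by have := hash_exp_le; rewrite -[2 ^ 7]/128; lia.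
  exact: pow_mul (leqnn _) (le_pow _).
have sb : 2 + 9 * (2 * tau ^ b * b) <= 2 ^ (1 + (5 + (tau * b + b))).+1.
  apply: (@leq_trans (2 ^ 1 + 2 ^ 5 * (tau ^ b * b))); first by rewrite -mulnA -[2 ^ 5]/32; lia.
  exact: pow_add (leqnn _) (pow_mul (leqnn _) (pow_mul tb (le_pow _))).
have db : (depth * 4 + 4) * tau * tau <= 2 ^ (2 + ell + tau + tau).
  apply: pow_mul (le_pow _); apply: pow_mul (le_pow _).
  apply: (@leq_trans (2 ^ 2 * depth.+1)); first by rewrite -[2 ^ 2]/4; lia.
  apply: pow_mul (leqnn _) _; apply: leq_ltn_trans depth_le _; exact: ltn_expl.
apply: leq_trans (pow_add hb (pow_mul sb db)) _; rewrite leq_exp2l // scaleE.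
have : tau * b <= tau * ell by rewrite leq_mul2l; have := block_len_ge; lia.
by have := block_len_ge; have := tau_le_block; lia.
Qed.

(** A single encoding serves both models, as neither the word size nor the table length enters it.
    The table is fixed before the walk. *)
Lemma instance : exists enc : n.+1.-tuple T -> bits.-tuple bool,
  (forall w, 0 < w -> cell_probe_retrieval e w (6 * ((scale * ell) %/ w).+2) enc) /\
  forall w r, b <= h0.+1 -> scale * ell + 4 <= w ->
    root_address T b depth hash_exp 4 * w <= r ->
    exists table : r.-tuple bool, forall v : n.+1.-tuple T, sorted e v -> forall q : 'I_n.+1,
      exists2 k, k <= 300 + 32 * depth &
        ram_computes w (enc v) table (compile 0 query_code) q k (enum_rank (tnth v q)).
Proof.
have [enc encP] := encoding_exists x0 b_gt0 block_len_gt0 (ltnW depth_gt) depth_gt0 reg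
  value_bound_gt0 value_bound_piece blocks_lt guard_gt0.
exists enc; split=> [w w_gt0|w r bh ww rr].
  exact: (cell_probe_bound b_gt0 block_len_gt0 (ltnW depth_gt) depth_gt0 value_bound_gt0
    blocks_lt guard_gt0 value_bound_guard d_gt0 guard_gt1 w_gt0 word_pow final_pow encP).
have w_gt0 : 0 < w by lia.
have [table tableE] := table_exists
  (table_word e d x0 n ell b depth G X h0 w hash_exp) w_gt0 rr.
exists table => v vs q; have [x [y [xyP ->]]] := encP v vs.
have w_gt3 : 3 < w by lia.
have Bdw : 16 * Bd <= 2 ^ w by rewrite -[16]/(2 ^ 4) -expnD leq_exp2l // addnC.
have qn : q <= n by rewrite -ltnS.
rewrite (tnth_nth x0); apply: wp_computes.
exact: (query_codeP b_gt0 block_len_gt0 depth_gt d_gt0 reg value_bound_gt0 blocks_lt guard_gt0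
  w_gt3 Bdw length_small hash_small position_small word_small final_small element_small
  code_small (address_small bh) (leq_trans (top_spill_le _ guard_gt0 value_bound_guard guard_gt1 _) value_bound_small)
  (fun k => leq_trans (full_spill_le guard_gt0 value_bound_guard guard_gt1 k) value_bound_small)
  depth_pred block_len_small tau_small hash_exp_ge tableE xyP qn).
Qed.

End Instance.

(** * Choice of the arity from the table size *)

Section Arity.
Variables (tau A B h r ell w : nat).
Hypothesis tau_gt0 : 0 < tau.
Hypothesis h_gt0 : 0 < h.
Hypothesis ell_gt0 : 0 < ell.
Hypothesis ell_le : ell <= A * h.
Hypothesis w_le : w <= B * h.

Definition table_factor := 80 * (tau * tau) * (A + 18).
(** The three summands pay for [log_r_ge], for the header with the level records, and for the node
    table. *)
Definition table_const := 2 ^ (256 * (tau * tau)) + 168 * B + 4 * (B * B) * (table_factor * table_factor).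
Hypothesis r_ge : table_const * (h * h) <= r.

Local Notation rho := (trunc_log 2 r).
(** The first bound keeps [tau ^ b] below the eighth root of [r], so that the table fits; the second
    keeps its addresses within a word. *)
Definition arity := minn (rho %/ (8 * tau)) h.+1.
Local Notation b := arity.
Local Notation D := (trunc_log b ell).+1.

Lemma const_le_r k : k <= table_const -> k <= r.
Proof.
move=> kc; apply: leq_trans r_ge; apply: leq_trans kc _.
by rewrite leq_pmulr // muln_gt0 h_gt0.
Qed.

Lemma r_gt0 : 0 < r.
Proof. by apply: const_le_r; rewrite /table_const -addnA ltn_addr ?expn_gt0. Qed.

Lemma log_r_ge : 256 * (tau * tau) <= rho.
Proof.
rewrite trunc_log_max //; apply: const_le_r; rewrite /table_const -addnA; exact: leq_addr.
Qed.

Lemma arity_quotient_ge : 32 * tau <= rho %/ (8 * tau).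
Proof. by rewrite leq_divRL ?muln_gt0 //; apply: leq_trans log_r_ge; lia. Qed.

Lemma arity_gt1 : 1 < b.
Proof. by rewrite leq_min; have := arity_quotient_ge; lia. Qed.

Lemma arity_le : b <= h.+1. Proof. exact: geq_minr. Qed.

Local Notation q := (rho %/ 8).

Lemma arity_bits : tau * b <= q.
Proof.
apply: (@leq_trans (tau * (rho %/ (8 * tau)))); first by rewrite leq_mul2l geq_minl orbT.
rewrite mulnC divnMA; exact: leq_divM.
Qed.

Lemma pow_q : 2 ^ (8 * q) <= r.
Proof.
apply: leq_trans (trunc_logP (isT : 1 < 2) r_gt0); rewrite leq_exp2l // mulnC; exact: leq_divM.
Qed.

Lemma depth_q : D.+1 <= (A + 18) * 2 ^ q.
Proof.
have bD : b ^ D.-1 <= ell by apply: trunc_logP => //; exact: arity_gt1.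
have DA : D.-1 <= A + rho.+1.
  rewrite -(leq_exp2l _ _ (isT : 1 < 2)).
  apply: (@leq_trans (b ^ D.-1)); first by case: (D.-1) => // k; rewrite leq_exp2r // arity_gt1.
  apply: leq_trans bD (leq_trans ell_le _); rewrite expnD; apply: leq_mul.
    by apply: ltnW; exact: ltn_expl.
  apply: leq_trans (ltnW (trunc_log_ltn r (isT : 1 < 2))).
  apply: leq_trans r_ge; apply: (@leq_trans (1 * (h * h))); first by rewrite mul1n leq_pmulr.
  by rewrite leq_mul2r /table_const -addnA ltn_addr ?expn_gt0 ?orbT.
have q1 : q.+1 <= 2 ^ q by apply: ltn_expl.
have rq : rho < 8 * q + 8 by rewrite {1}(divn_eq rho 8) mulnC ltn_add2l ltn_mod.
apply: (@leq_trans ((A + 18) * q.+1)); last by rewrite leq_mul2l q1 orbT.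
have : A * 1 <= A * q.+1 by rewrite leq_mul2l orbT.
move: DA rq; rewrite mulnDl; move: (A * _) (D) => x [|y]; lia.
Qed.

(** The header and the level records take half of [r], the node table the other half. The latter has
    at most a constant times [2 ^ (3 * q)] words, where [2 ^ (8 * q) <= r], so the square of its
    length is at most a constant times [r]. So is [w ^ 2], with a small constant; comparing squares
    avoids roots. *)
Lemma table_fits : (84 * h + (2 + 9 * (2 * tau ^ b * b)) * ((D * 4 + 4) * tau * tau)) * w <= r.
Proof.
have part1 : 84 * h * w * 2 <= r.
  apply: leq_trans r_ge; apply: (@leq_trans (168 * B * (h * h))).
    have hw : h * w <= h * (B * h) by rewrite leq_mul2l w_le orbT.
    by lia.
  by rewrite leq_mul2r; apply/orP; right; rewrite /table_const; lia.
set Z := _ * (_ * tau).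
have tb : tau ^ b <= 2 ^ q.
  apply: (@leq_trans (2 ^ (tau * b))); last by rewrite leq_exp2l // arity_bits.
  by rewrite expnM leq_exp2r ?(ltnW arity_gt1) // ltnW // ltn_expl.
have bq : b <= 2 ^ q.
  apply: leq_trans (ltnW (ltn_expl _ (isT : 1 < 2))) _; rewrite leq_exp2l //.
  by apply: leq_trans arity_bits; rewrite leq_pmull.
have ZE : Z <= table_factor * 2 ^ (3 * q).
  have e3 : 2 ^ (3 * q) = 2 ^ q * (2 ^ q * 2 ^ q) by rewrite -!expnD; congr (2 ^ _); lia.
  have tbb : tau ^ b * b <= 2 ^ q * 2 ^ q by exact: leq_mul.
  have t0 : 0 < tau ^ b * b by rewrite muln_gt0 expn_gt0 tau_gt0 (ltnW arity_gt1).
  apply: (@leq_trans ((20 * (2 ^ q * 2 ^ q)) * (4 * ((A + 18) * 2 ^ q) * tau * tau))).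
    apply: leq_mul; first by rewrite -mulnA; move: tbb t0; move: (tau ^ b * b) (2 ^ q * 2 ^ q) => x y; lia.
    rewrite leq_mul2r; apply/orP; right; rewrite leq_mul2r; apply/orP; right.
    have := depth_q; move: ((A + 18) * _) (D) => x y; lia.
  by rewrite e3 /table_factor; move: (2 ^ q) (A + 18) => x y; lia.
have part2 : Z * w * 2 <= r.
  have [B0|B_gt0] := posnP B; first by move: w_le; rewrite B0 mul0n leqn0 => /eqP ->; rewrite muln0.
  have T_gt0 : 0 < table_const by rewrite /table_const -addnA ltn_addr ?expn_gt0.
  rewrite -leq_sqr -(leq_pmul2l T_gt0).
  have ZZ : Z * Z <= table_factor * table_factor * r.
    apply: leq_trans (leq_mul ZE ZE) _; rewrite mulnACA -expnD leq_mul2l; apply/orP; right.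
    by apply: leq_trans pow_q; rewrite leq_exp2l //; lia.
  have ww : w * w <= B * h * (B * h) by exact: leq_mul.
  apply: (@leq_trans (table_const * (4 * (table_factor * table_factor * r) * (B * h * (B * h))))).
    rewrite leq_mul2l; apply/orP; right.
    apply: (@leq_trans (4 * (Z * Z) * (w * w))); first by rewrite -mulnn; lia.
    by apply: leq_mul => //; rewrite leq_mul2l ZZ orbT.
  apply: (@leq_trans (4 * (B * B) * (table_factor * table_factor) * r * (table_const * (h * h)))).
    by lia.
  rewrite -mulnn [table_const * (r * r)]mulnA; apply: leq_mul => //.
  rewrite leq_mul2r; apply/orP; right.
  by rewrite /table_const; lia.
by rewrite mulnDl; lia.
Qed.

(** If [b = h + 1], then [ell <= A * b] and the depth is bounded. Otherwise [b = rho %/ (8 * tau)]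
    is at least [32 * tau], so [b * b] exceeds [rho < 8 * tau * (b + 1)]. *)
Lemma arity_depth : D <= A + 2 \/ rho < b * b.
Proof.
case: (leqP (rho %/ (8 * tau)) h.+1) => [le|gt]; [right|left].
  have -> : b = rho %/ (8 * tau) by rewrite /arity; apply/minn_idPl.
  have := arity_quotient_ge.
  have := divn_eq rho (8 * tau); have : rho %% (8 * tau) < 8 * tau by rewrite ltn_mod muln_gt0.
  move: (rho %/ _) (rho %% _) => x y y_lt -> x_ge.
  apply: (@leq_trans (x * (8 * tau) + 8 * tau)); first by rewrite ltn_add2l.
  have : x * (32 * tau) <= x * x by rewrite leq_mul2l x_ge orbT.
  have : 1 * (8 * tau) <= x * (8 * tau) by rewrite leq_mul2r; apply/orP; right; lia.
  by lia.
have bE : b = h.+1 by rewrite /arity; apply/minn_idPr; exact: ltnW.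
have bD : b ^ D.-1 <= ell by apply: trunc_logP => //; exact: arity_gt1.
rewrite leqNgt; apply/negP => DA.
have : b ^ D.-1 <= A * b by apply: leq_trans bD (leq_trans ell_le _); rewrite leq_mul2l bE leqnSn orbT.
have [m mE] : exists m, D.-1 = m.+1 + A by exists (D.-1 - A).-1; lia.
rewrite mE addSn expnSr leq_pmul2r; last by rewrite bE.
rewrite leqNgt => /negP; apply; apply: (@leq_trans (2 ^ (m + A))).
  by apply: leq_trans (ltn_expl A (isT : 1 < 2)) _; rewrite leq_exp2l ?leq_addl.
by case: (m + A) => // k; rewrite leq_exp2r // arity_gt1.
Qed.

End Arity.

(** * Logarithms *)

Local Open Scope ring_scope.

Section Logarithm.
Variable R : realType.
Implicit Types x y : R.

Lemma ln2_gt0 : 0 < ln 2 :> R. Proof. by rewrite ln_gt0 // ltr1n. Qed.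

Lemma lg_le x y : 0 < x -> x <= y -> lg x <= lg y.
Proof.
move=> x_gt0 xy; rewrite ler_pM2r ?invr_gt0 ?ln2_gt0 // ler_ln //.
by rewrite posrE (lt_le_trans x_gt0).
Qed.

Lemma lgM x y : 0 < x -> 0 < y -> lg (x * y) = lg x + lg y.
Proof. by move=> x_gt0 y_gt0; rewrite /lg lnM ?posrE // mulrDl. Qed.

Lemma lgX x k : 0 < x -> lg (x ^+ k) = k%:R * lg x.
Proof. by move=> x_gt0; rewrite /lg lnXn // mulrA mulr_natl. Qed.

Lemma lg2 : lg 2 = 1 :> R. Proof. by rewrite /lg divff // gt_eqF // ln2_gt0. Qed.

Lemma lg_pow2 k : lg (2 ^ k)%:R = k%:R :> R.
Proof. by rewrite natrX lgX ?ltr0n // lg2 mulr1. Qed.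

Lemma lg_nat_le k n : (0 < k)%N -> (k <= n)%N -> lg k%:R <= lg n%:R :> R.
Proof. by move=> k_gt0 kn; rewrite lg_le ?ltr0n ?ler_nat. Qed.

Lemma trunc_log_le_lg n : (0 < n)%N -> (trunc_log 2 n)%:R <= lg n%:R :> R.
Proof.
by move=> n_gt0; rewrite -(lg_pow2 (trunc_log 2 n)) lg_nat_le ?expn_gt0 // trunc_logP.
Qed.

Lemma lg_le_trunc_log n : (0 < n)%N -> lg n%:R <= (trunc_log 2 n).+1%:R :> R.
Proof.
by move=> n_gt0; rewrite -(lg_pow2 (trunc_log 2 n).+1) lg_nat_le // ltnW // trunc_log_ltn.
Qed.

Lemma lg_nat_le_nat n : (0 < n)%N -> lg n%:R <= n%:R :> R.
Proof.
move=> n_gt0; apply: (@le_trans _ _ (lg (2 ^ n)%:R)); last by rewrite lg_pow2.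
by rewrite lg_nat_le // ltnW // ltn_expl.
Qed.

Lemma space_bound m t d n : (0 < t)%N -> (0 < d)%N -> (2 ^ m <= 8 * (t * d ^ n))%N ->
  m%:R <= lg t%:R + n%:R * lg d%:R + 3 :> R.
Proof.
move=> t_gt0 d_gt0 le; have dn_gt0 : (0 < d ^ n)%N by rewrite expn_gt0 d_gt0.
rewrite -(lg_pow2 m); apply: le_trans (lg_nat_le _ le) _; first by rewrite expn_gt0.
rewrite natrM natrM -[8%N]/(2 ^ 3)%N.
rewrite !lgM ?ltr0n ?muln_gt0 ?t_gt0 // ?mulr_gt0 ?ltr0n //.
by rewrite lg_pow2 natrX lgX ?ltr0n // addrC.
Qed.

(* The decoding depth [D] is the logarithm of the block length to the base [b], and
   either [b] exceeds the block length up to a constant or [b ^ 2] exceeds [lg r]. *)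
Lemma time_bound (A h n r b D : nat) : (0 < A)%N -> (2 <= n)%N -> (4 <= r)%N -> (1 < b)%N ->
  h%:R <= 2 * lg n%:R :> R -> (b ^ D <= A * h)%N ->
  (D.+1 <= A + 2)%N \/ (trunc_log 2 r < b * b)%N ->
  (300 + 32 * D.+1)%:R <=
    (600 + 200 * A)%:R * Num.max 1 (lg (lg n%:R) / lg (lg r%:R)) :> R.
Proof.
move=> A_gt0 n2 r4 b1 hn bD; set M := Num.max _ _.
have M1 : 1 <= M by rewrite le_max lexx.
case=> [DA|rb].
  apply: (@le_trans _ _ ((600 + 200 * A)%:R)); first by rewrite ler_nat; lia.
  by rewrite ler_peMr // ler0n.
have r0 : (0 < r)%N by lia.
have lgr2 : 2 <= lg r%:R :> R.
  by rewrite -(lg_pow2 2) lg_nat_le.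
have lgn1 : 1 <= lg n%:R :> R by have := @lg_nat_le 2 n isT n2; rewrite lg2.
set y := lg (lg r%:R) in M M1 *; set z := lg (lg n%:R) in M M1 *.
have y1 : 1 <= y by have := lg_le (ltr0Sn R 1) lgr2; rewrite lg2.
have y_gt0 : 0 < y by apply: lt_le_trans y1.
have b_gt0 : (0 < b)%N by lia.
have yb : y <= 2 * lg b%:R.
  rewrite -[2]/(2%:R) -lgX ?ltr0n // lg_le ?(lt_le_trans _ lgr2) //.
  apply: le_trans (lg_le_trunc_log r0) _; rewrite -natrX ler_nat.
  by rewrite -mulnn.
have Db : D%:R * lg b%:R <= 2 * A%:R + z :> R.
  rewrite -lgX ?ltr0n // -natrX.
  apply: (@le_trans _ _ (lg ((2 * A)%:R * lg n%:R))).
    rewrite lg_le ?ltr0n ?expn_gt0 ?b_gt0 //; apply: (@le_trans _ _ (A * h)%:R).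
      by rewrite ler_nat.
    by rewrite !natrM [2 * _]mulrC -mulrA ler_wpM2l ?ler0n.
  rewrite lgM ?ltr0n ?muln_gt0 ?A_gt0 // ?(lt_le_trans _ lgn1) // lerD2r -natrM.
  by rewrite lg_nat_le_nat // muln_gt0.
have zM : z <= M * y by rewrite -ler_pdivrMr // le_max lexx orbT.
have AM : A%:R <= A%:R * (M * y) :> R.
  by rewrite ler_peMr ?ler0n // -[1]mulr1 ler_pM.
have Dy : D%:R * y <= (4 * A%:R + 2) * M * y :> R.
  apply: (@le_trans _ _ (D%:R * (2 * lg b%:R))); first by rewrite ler_wpM2l ?ler0n.
  rewrite mulrCA; apply: (@le_trans _ _ (2 * (2 * A%:R + z))); first by rewrite ler_wpM2l.
  by lra.
move: Dy; rewrite ler_pM2r // => DM.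
have AM0 : 0 <= A%:R * (M - 1) :> R by rewrite mulr_ge0 ?ler0n // subr_ge0.
rewrite -(addn1 D) mulnDr !natrD !natrM.
have A0 : 0 <= A%:R :> R by rewrite ler0n.
nra.
Qed.

End Logarithm.

(** * The two models with their constants *)

Lemma cell_probe_retrieval_le (T : finType) (e : rel T) (n w t t' m : nat)
    (enc : n.+1.-tuple T -> m.-tuple bool) :
  (t <= t')%N -> cell_probe_retrieval e w t enc -> cell_probe_retrieval e w t' enc.
Proof.
move=> tt' [query queryP]; exists query => v vs q.
by have [? h] := queryP v vs q; split=> //; exact: leq_trans h tt'.
Qed.

Lemma block_len_le (T : finType) c n : (0 < #|T|)%N ->
  (block_len T c n <= c * (9 + #|T|) * log_size n)%N.
Proof.
move=> T_gt0; rewrite /block_len -mulnA leq_mul2l; apply/orP; right.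
have : (#|T| * 1 <= #|T| * log_size n)%N by rewrite leq_mul2l orbT.
by rewrite mulnDl /log_size; lia.
Qed.

Theorem theorem3p1 (R : realType) (T : finType) (e : rel T) (d : nat)
    (e_sym : symmetric e) (e_irr : irreflexive e)
    (e_connected : forall x y : T, connect e x y)
    (e_nonbip : ~ bipartite e)
    (e_regular : regular_graph e d) :
  (forall c : R, 0 < c ->
    exists t : nat,
    forall n w : nat, (0 < w)%N -> c * lg n%:R <= w%:R ->
    exists (m : nat) (enc : n.+1.-tuple T -> m.-tuple bool),
      m%:R <= lg (#|T|%:R : R) + n%:R * lg d%:R + 3 /\
      cell_probe_retrieval e w t enc)
  /\
  (exists c0 : R, 0 < c0 /\
    forall c1 : R,
    exists (t : nat) (P : seq instr) (C K : R), 0 < C /\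
    forall n w r : nat, (2 <= n)%N ->
      c0 * lg n%:R <= w%:R -> w%:R <= c1 * lg n%:R ->
      C * lg n%:R ^+ 2 <= r%:R ->
    exists (m : nat) (enc : n.+1.-tuple T -> m.-tuple bool)
           (table : r.-tuple bool),
      [/\ m%:R <= lg (#|T|%:R : R) + n%:R * lg d%:R + 3,
          cell_probe_retrieval e w t enc &
          forall v : n.+1.-tuple T, sorted e v -> forall q : 'I_n.+1,
          exists k : nat,
            k%:R <= K * Num.max 1 (lg (lg n%:R) / lg (lg r%:R)) /\
            ram_computes w (enc v) table P q k (enum_rank (tnth v q))]).
Proof.
have d_gt1 := degree_gt1 e_sym e_connected e_nonbip e_regular e_irr.
have [x0 _] : exists x0 : T, true.
  case: (pickP [pred x : T | true]) => [x0 _|no]; first by exists x0.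
  by case: e_nonbip; exists (fun=> true) => x; have := no x.
have T_gt0 : (0 < #|T|)%N by apply/card_gt0P; exists x0.
have d_gt0 : (0 < d)%N := ltnW d_gt1.
have [c c_gt0 mix] := mixing e_sym e_connected e_nonbip e_regular.
pose A := (c * (9 + #|T|))%N; pose sc := scale T d.
have A_gt0 : (0 < A)%N by rewrite muln_gt0 c_gt0.
have ellA n : (sc * block_len T c n <= sc * A * log_size n)%N.
  by rewrite -mulnA leq_mul2l block_len_le ?orbT.
have space n b (b_gt1 : (1 < b)%N) :=
  space_bound R T_gt0 d_gt0 (bits_le x0 c_gt0 d_gt1 n b_gt1).
split=> [c' c'_gt0|].
  (* From [c' * lg n <= w] follows [lg n <= m1 * w], so a field spans boundedly many cells. The
     successor of [m1] absorbs the 1 in [log_size], since [1 <= w]. *)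
  pose m1 := Num.bound c'^-1; exists (6 * (sc * A * m1.+1).+2)%N => n w w_gt0 cw.
  have h_le : (log_size n <= m1.+1 * w)%N.
    rewrite /log_size mulSn addnC -addn1 leq_add //.
    case: n cw => [|n] cw; first by rewrite trunc_log0.
    rewrite -(ler_nat R) natrM; apply: le_trans (trunc_log_le_lg R _) _ => //.
    apply: (@le_trans _ _ (c'^-1 * w%:R)); first by rewrite ler_pdivlMl.
    by rewrite ler_wpM2r ?ler0n // ltW // archi_boundP // invr_ge0 ltW.
  (* Only probes are charged here, so the arity is immaterial and 2 is taken. *)
  have [enc [cp _]] := instance x0 c_gt0 d_gt1 e_regular mix n (isT : (1 < 2)%N).
  exists _, enc; split; first exact: space.
  apply: cell_probe_retrieval_le (cp w w_gt0); rewrite leq_mul2l /= !ltnS.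
  rewrite -ltnS ltn_divLR // mulSn -/sc.
  have : (sc * block_len T c n <= sc * A * m1.+1 * w)%N.
    by apply: leq_trans (ellA n) _; rewrite -[(_ * _ * w)%N]mulnA leq_mul2l h_le orbT.
  by lia.
(* The factor 2 comes from [log_size n <= 2 * lg n], valid for [n >= 2]. *)
exists (2 * (sc * A + 4))%:R; split; first by rewrite ltr0n; lia.
move=> c1; pose B := Num.bound `|c1|; pose C0 := table_const #|T| A B.
(* A word is now longer than any field, so each of the six fields is covered by two cells. The 4 is
   the square of the factor 2 between [log_size n] and [lg n]. *)
exists 12%N, (compile 0 query_code), (4 * C0)%:R, (600 + 200 * A)%:R; split.
  by rewrite ltr0n muln_gt0 /= /C0 /table_const -addnA ltn_addr ?expn_gt0.
move=> n w r n2 cw wc Cr; set h := log_size n.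
have n_gt0 : (0 < n)%N by lia.
have lg_h : lg n%:R <= h%:R :> R by exact: lg_le_trunc_log.
have h_lg : h%:R <= 2 * lg n%:R :> R.
  have t1 : (1 <= trunc_log 2 n)%N by rewrite trunc_log_max.
  apply: (@le_trans _ _ (2 * trunc_log 2 n)%:R); first by rewrite ler_nat /h /log_size; lia.
  by rewrite natrM ler_wpM2l // trunc_log_le_lg.
have lg_ge0 : 0 <= lg n%:R :> R by apply: le_trans (trunc_log_le_lg R n_gt0); rewrite ler0n.
have w_ge : ((sc * A + 4) * h <= w)%N.
  rewrite -(ler_nat R); apply: le_trans cw; rewrite !natrM -mulrA.
  by rewrite mulrCA ler_wpM2l ?ler0n.
have w_le : (w <= B * h)%N.
  rewrite -(ler_nat R); apply: le_trans wc _; rewrite natrM.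
  apply: (@le_trans _ _ (B%:R * lg n%:R)); last by rewrite ler_wpM2l ?ler0n.
  by rewrite ler_wpM2r // (le_trans (ler_norm _)) // ltW // archi_boundP.
have r_ge : (C0 * (h * h) <= r)%N.
  rewrite -(ler_nat R); apply: le_trans Cr; rewrite !natrM expr2.
  have hh : h%:R * h%:R <= 2 * lg n%:R * (2 * lg n%:R) :> R by rewrite ler_pM ?ler0n.
  apply: (@le_trans _ _ (C0%:R * (2 * lg n%:R * (2 * lg n%:R)))); first by rewrite ler_wpM2l ?ler0n.
  by lra.
have h_gt0 : (0 < h)%N by [].
have ell_gt0 := block_len_gt0 x0 c_gt0 d_gt1 n (isT : (1 < 2)%N).
have ell_le : (block_len T c n <= A * h)%N by exact: block_len_le.
pose b := arity #|T| h r.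
have b_gt1 : (1 < b)%N := arity_gt1 T_gt0 h_gt0 ell_gt0 ell_le w_le r_ge.
have [enc [cp ram]] := instance x0 c_gt0 d_gt1 e_regular mix n b_gt1.
have w_big : (sc * block_len T c n + 4 <= w)%N.
  by apply: leq_trans w_ge; rewrite mulnDl leq_add ?ellA // -{1}[4%N]muln1 leq_mul2l.
have [|table tableP] := ram w r (arity_le _ _ _) w_big.
  apply: leq_trans (table_fits T_gt0 h_gt0 ell_gt0 ell_le w_le r_ge).
  rewrite leq_mul2r; apply/orP; right; rewrite leq_add2r /node_base /record_base.
  by have := hash_exp_le n; rewrite -/h; lia.
exists _, enc, table; split; first exact: space.
  apply: cell_probe_retrieval_le (cp w _); last by lia.
  by rewrite divn_small //; lia.
move=> v vs q; have [k k_le comp] := tableP v vs q; exists k; split=> //.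
apply: (@le_trans _ _ (300 + 32 * depth T c n b)%:R); first by rewrite ler_nat.
apply: (time_bound A_gt0 n2 _ b_gt1 h_lg).
- rewrite leqNgt; apply/negP => r4.
  have := leq_trans (log_r_ge h_gt0 r_ge) (leq_trunc_log 2 (ltnW r4)).
  rewrite -[4%N]/(2 ^ 2)%N trunc_expnK //.
  by have TT : (0 < #|T| * #|T|)%N; [rewrite muln_gt0 T_gt0 | lia].
- by apply: leq_trans ell_le; apply: trunc_logP.
- exact: arity_depth T_gt0 h_gt0 ell_gt0 ell_le w_le r_ge.
Qed.
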